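(* Let $L\ge\alpha>0$ and let $f:\mathbb{R}^d\to\mathbb{R}$ be $(\alpha,L)$-nearly convex with global minimizer $x^*$ and $f^*:=f(x^* )$. Suppose there is a constant $r\ge 0$ such that the stochastic gradient oracle $\mathrm{SG}$ satisfies $\mathbb{E}[\mathrm{SG}(x)]=\nabla f(x)$ and $\mathbb{E}[\|\mathrm{SG}(x)-\nabla f(x)\|^2]\le r^2$ for every $x\in\mathbb{R}^d$. Let $\eta=\frac{2\alpha}{5L^2}$, $\lambda=2\alpha-\eta L^2$, $s=\frac{\lambda}{3L}$, and assume $f_{\mathrm{lb}}^0<f^*$. Let $x_0\in\mathbb{R}^d$, $y_0:=x_0-\eta\nabla f(x_0)$ and $\beta=\beta(f,x^*,\alpha)$. For any $\varepsilon>0$ and $\zeta\in(0,1)$ define $$b^0:=\frac{\eta r^2}{\lambda}+\frac{5\eta\lambda+14}{42L}(f^*-f_{\mathrm{lb}}^0),\qquad b^\varepsilon:=\frac{\eta r^2}{\lambda}+\frac{5\eta\lambda+14}{42L}\,\varepsilon,\qquad \gamma:=\frac{(1-\eta L)^2\varepsilon}{(1-\eta L)^2\varepsilon+100Lb^\varepsilon}.$$ Suppose that the positive integers $N,T_1,T_2$ satisfy $$N\ge\frac1\gamma\ln\Big((1-\gamma)+\gamma\cdot\frac{f^*-f_{\mathrm{lb}}^0}{\varepsilon}\Big),\qquad T_1\ge\frac{200}{\eta\lambda}\ln\frac{\|y_0-x^*\|^2}{100b^0\zeta'},\qquad T_2\ge\frac{200}{\eta\lambda}\ln\frac{2(1+\eta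 L)^2Lb^0}{(1-\eta L)^2(\alpha-\beta)b^\varepsilon\zeta'},$$ where $\zeta':=\frac{\zeta}{N+1}$. Then, with probability at least $1-\zeta$, the output $x_{\min}^N$ of the double-loop Gaussian noise descent (DL-GND) algorithm with inputs $x_0,\mathrm{SG},\eta,s,f_{\mathrm{lb}}^0,\gamma,N,T_1,T_2$ satisfies $$f(x_{\min}^N)-f^*\le\frac{100Lb^\varepsilon}{(1-\eta L)^2}\qquad\text{and}\qquad \|x_{\min}^N-x^*\|^2\le\frac{200Lb^\varepsilon}{(1-\eta L)^2(\alpha-\beta)}.$$
   Context: Norms are Euclidean. For $\alpha>0$, $\bar x\in\mathbb{R}^d$, $c\in\mathbb{R}$, the set of one-point strongly convex functions is $$\mathcal{P}_\alpha(\bar x,c)=\{\bar f\in C^1(\mathbb{R}^d)\mid \bar f(\bar x)=c,\ \langle\nabla\bar f(x),x-\bar x\rangle\ge\alpha\|x-\bar x\|^2\ \ \forall x\in\mathbb{R}^d\}.$$ For $f\in C^1(\mathbb{R}^d)$, $$\beta(f,\bar x,\alpha):=\inf_{\bar f\in\mathcal{P}_\alpha(\bar x,f(\bar x))}\ \sup_{x\ne\bar x}\frac{2|f(x)-\bar f(x)|}{\|x-\bar x\|^2}.$$ For $L\ge\alpha>0$, a continuously differentiable $f:\mathbb{R}^d\to\mathbb{R}$ is $(\alpha,L)$-nearly convex if (i) $f$ has a unique global minimizer $x^*$; (ii) $\|\nabla f(x)\|\le L\|x-x^*\|$ for all $x\in\mathbb{R}^d$; (iii) $\beta(f,x^*,\alpha)\le\frac14\sqrt{\frac{\alpha^5}{dL^3}}$.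 GND subroutine: $\mathrm{GND}(\mathrm{SG},x_0,\eta,s,f_{\mathrm{lb}},T)$, where for each $x$ the oracle value $\mathrm{SG}(x)$ is a random vector in $\mathbb{R}^d$, computes for $t=0,\dots,T-1$: $$x_{t+\frac12}=x_t-\eta\,\mathrm{SG}(x_t),\qquad \sigma_t=\sqrt{\eta s\,\big(f(x_{t+\frac12})-f_{\mathrm{lb}}\big)^+},\qquad x_{t+1}=x_{t+\frac12}-\sigma_t\xi_t,\quad \xi_t\sim\mathcal{N}(0,\tfrac1d I_d),$$ where $(a)^+=\max\{a,0\}$, and returns $x_{t_*}$, where $t_*$ is the smallest index in $\operatorname{argmin}_{0\le t\le T}f(x_t)$. DL-GND algorithm, with inputs $x_0\in\mathbb{R}^d$, $\mathrm{SG}$, $\eta>0$, $s>0$, a lower bound $f_{\mathrm{lb}}^0$ of $f$, $\gamma\in(0,1)$, and positive integers $N,T_1,T_2$: set $x_{\min}^0=\mathrm{GND}(\mathrm{SG},x_0,\eta,s,f_{\mathrm{lb}}^0,T_1)$; then for $\nu=0,\dots,N-1$ set $$f_{\mathrm{lb}}^{\nu+1}=(1-\gamma)f_{\mathrm{lb}}^\nu+\gamma f(x_{\min}^\nu),\qquad x_{\min}^{\nu+1}=\mathrm{GND}(\mathrm{SG},x_{\min}^\nu,\eta,s,f_{\mathrm{lb}}^{\nu+1},T_2).$$ The output is $x_{\min}^N$. Each oracle call uses fresh randomness independent of the past, so that, conditionally on all randomness generated before the call, $\mathrm{SG}$ at the current iterate $x$ has mean $\nabla f(x)$ and $\mathbb{E}\|\mathrm{SG}(x)-\nabla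 f(x)\|^2\le r^2$; each Gaussian vector is independent of everything generated before it (including the oracle call of the same iteration). *)

(* Defs.v *)
From HB Require Import structures.
From mathcomp Require Import all_boot all_order all_algebra.
From mathcomp Require Import all_classical all_reals all_analysis.

Set Implicit Arguments.
Unset Strict Implicit.
Unset Printing Implicit Defensive.

Import Order.TTheory GRing.Theory Num.Theory.
Import numFieldNormedType.Exports.

Local Open Scope classical_set_scope.
Local Open Scope ring_scope.

Section Euclidean.
Context (R : realType) (d : nat).
Implicit Types (u v x : 'rV[R]_d) (f : 'rV[R]_d -> R).

Definition dotv u v : R := \sum_(i < d) u 0 i * v 0 i.

(* The library norm `|u| on row vectors is the sup norm. It induces the same
   topology and the same differentiability notion as the Euclidean norm. *)
Definition enorm u : R := Num.sqrt (dotv u u).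

Definition grad f x : 'rV[R]_d := \row_(i < d) 'D_(delta_mx 0 i) f x.

Definition C1 f : Prop :=
  (forall x, differentiable f x) /\ continuous (grad f).

Definition one_point_convex (alpha : R) (xbar : 'rV[R]_d) (c : R) :
    set ('rV[R]_d -> R) :=
  [set g | [/\ C1 g, g xbar = c &
    forall x, alpha * enorm (x - xbar) ^+ 2 <= dotv (grad g x) (x - xbar)]].

(* Extended-real valued, since the supremum can be infinite. *)
Definition convexity_gap f (xbar : 'rV[R]_d) (alpha : R) : \bar R :=
  ereal_inf [set ereal_sup
      [set (2 * `|f x - g x| / enorm (x - xbar) ^+ 2)%:E
         | x in [set x | x <> xbar]]
    | g in one_point_convex alpha xbar (f xbar)].

Definition global_minimizer f x : Prop := forall y, f x <= f y.

Definition unique_global_minimizer f x : Prop :=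
  global_minimizer f x /\ forall y, global_minimizer f y -> y = x.

Definition nearly_convex (alpha L : R) f (xstar : 'rV[R]_d) : Prop :=
  [/\ C1 f,
      unique_global_minimizer f xstar,
      forall x, enorm (grad f x) <= L * enorm (x - xstar) &
      (convexity_gap f xstar alpha <=
        (4^-1 * Num.sqrt (alpha ^+ 5 / (d%:R * L ^+ 3)))%:E)%E].

End Euclidean.

(* R^d with its Borel sigma-algebra. *)
Definition borel_rV (R : realType) (d : nat) :=
  g_sigma_algebraType (@open 'rV[R]_d).

(* An oracle is a jointly measurable map SG : R^d * Z -> R^d together with a
   law Q on the space Z of random seeds: SG(x) is the random vector
   z |-> SG x z on (Z, Q). *)
Section Oracle.
Context (R : realType) (d : nat) (dZ : measure_display) (Z : measurableType dZ).

Definition measurable_oracle (SG : 'rV[R]_d -> Z -> 'rV[R]_d) : Prop :=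
  measurable_fun [set: borel_rV R d * Z]
    ((fun p => SG p.1 p.2) : borel_rV R d * Z -> borel_rV R d).

Definition unbiased_oracle (Q : probability Z R)
    (SG : 'rV[R]_d -> Z -> 'rV[R]_d) (f : 'rV[R]_d -> R) : Prop :=
  forall x (i : 'I_d), Q.-integrable [set: Z] (EFin \o (fun z => SG x z 0 i)) /\
    ('E_Q[fun z => SG x z 0%R i] = (grad f x 0%R i)%:E :> \bar R)%E.

Definition oracle_variance_le (Q : probability Z R)
    (SG : 'rV[R]_d -> Z -> 'rV[R]_d) (f : 'rV[R]_d -> R) (r : R) : Prop :=
  forall x, ('E_Q[fun z => (enorm (SG x z - grad f x) ^+ 2)%R]
               <= (r ^+ 2)%:E)%E.

End Oracle.

(* One run of the algorithm: z k and xi k are the oracle seed and the Gaussian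
   vector used in the k-th inner iteration, counted globally over all GND
   calls. *)
Section Algorithm.
Context (R : realType) (d : nat) (Z : Type).
Context (f : 'rV[R]_d -> R) (SG : 'rV[R]_d -> Z -> 'rV[R]_d) (eta s : R).
Context (z : nat -> Z) (xi : nat -> 'rV[R]_d).

Definition gnd_step (flb : R) (k : nat) (x : 'rV[R]_d) : 'rV[R]_d :=
  let xhalf := x - eta *: SG x (z k) in
  let sigma := Num.sqrt (eta * s * Num.max (f xhalf - flb) 0) in
  xhalf - sigma *: xi k.

(* k0 is the global index of the first inner iteration of the call. *)
Fixpoint gnd_iter (flb : R) (k0 : nat) (x0 : 'rV[R]_d) (t : nat) :
    'rV[R]_d :=
  if t is t'.+1 then gnd_step flb (k0 + t') (gnd_iter flb k0 x0 t') else x0.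

Definition first_argmin (x : nat -> 'rV[R]_d) (T : nat) : nat :=
  find (fun t => all (fun u => f (x t) <= f (x u)) (iota 0 T.+1))
       (iota 0 T.+1).

Definition gnd (flb : R) (k0 : nat) (x0 : 'rV[R]_d) (T : nat) : 'rV[R]_d :=
  gnd_iter flb k0 x0 (first_argmin (gnd_iter flb k0 x0) T).

(* The pair (f_lb^nu, x_min^nu). *)
Fixpoint dlgnd_state (x0 : 'rV[R]_d) (flb0 gamma : R) (T1 T2 nu : nat) :
    R * 'rV[R]_d :=
  if nu is nu'.+1 then
    let: (flb, xmin) := dlgnd_state x0 flb0 gamma T1 T2 nu' in
    let flb' := (1 - gamma) * flb + gamma * f xmin in
    (flb', gnd flb' (T1 + nu' * T2) xmin T2)
  else (flb0, gnd flb0 0 x0 T1).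

Definition dlgnd (x0 : 'rV[R]_d) (flb0 gamma : R) (N T1 T2 : nat) :
    'rV[R]_d :=
  (dlgnd_state x0 flb0 gamma T1 T2 N).2.

End Algorithm.

Section Randomness.
Context (R : realType) (d : nat).
Context (dO : measure_display) (Omega : measurableType dO).
Context (P : probability Omega R).
Context (dZ : measure_display) (Z : measurableType dZ).

Definition independent_systems (F G : set (set Omega)) : Prop :=
  forall A B, F A -> G B -> P (A `&` B) = (P A * P B)%E.

Definition events_of dT (T : measurableType dT) (X : Omega -> T) :
    set (set Omega) :=
  preimage_set_system setT X measurable.

(* N(0, d^-1 I_d): the coordinates are independent N(0, d^-1);
   normal_prob takes the standard deviation. *)
Definition gaussian_vector (X : Omega -> borel_rV R d) : Prop :=
  measurable_fun setT X /\
  forall A : 'I_d -> set R, (forall i, measurable (A i)) ->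
    P [set w | forall i, A i ((X w : 'rV[R]_d) 0 i)] =
    (\prod_(i < d) normal_prob 0 (Num.sqrt d%:R^-1) (A i))%E.

Definition past (z : nat -> Omega -> Z) (xi : nat -> Omega -> borel_rV R d)
    (k : nat) : set (set Omega) :=
  \bigcup_(j in `I_k) (events_of (z j) `|` events_of (xi j)).

Definition fresh_randomness (Q : probability Z R)
    (z : nat -> Omega -> Z) (xi : nat -> Omega -> borel_rV R d) (K : nat) :
    Prop :=
  forall k, (k < K)%N ->
  [/\ measurable_fun setT (z k),
      forall A, measurable A -> P (z k @^-1` A) = Q A,
      gaussian_vector (xi k),
      independent_systems <<s past z xi k >> (events_of (z k)) &
      independent_systems <<s past z xi k `|` events_of (z k) >>
                          (events_of (xi k))].

End Randomness.

(* Main.v *)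
Require Import Defs.
From HB Require Import structures.
From mathcomp Require Import all_boot all_order all_algebra.
From mathcomp Require Import all_classical all_reals all_analysis.
From mathcomp Require Import measurable_realfun.
From mathcomp Require Import ring lra.

(** Write [y x := x - eta *: grad f x] for the exact descent point, [xs] for the
    minimizer and [Delta] for the gap between [f xs] and the current lower
    bound. The quantity followed along the iteration is the squared distance of
    [y x] to [xs].

    One step. From the half step [u] the iterate moves to [u - sigma *: xi].
    With [X] the displacement of that point from [xs], the new squared distance
    is at most [(1 + eta ^+ 2 * L ^+ 2) * |X| ^+ 2] minus [2 * eta] times the
    inner product of [grad f (xs + X)] and [X], so a lower bound of the mean of
    this inner product is needed. Near optimality provides a one-point convex
    [g] with [f - g] small relative to the squared distance, but the gradient of
    [f - g] is not small. The noise remedies this: the mean inner product is the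
    derivative of the mean of [f (xs + (1 + e) *: X)] at [e = 0]; for [g] the
    growth along rays bounds it below ([one_point_convex_growth]), and for
    [f - g] the dilation of the Gaussian [X] is turned into a change of density,
    whose chi-square divergence is of order [e ^+ 2] times the Fisher
    information [d * (2 + |u - xs| ^+ 2 / sigma ^+ 2)] ([affine_weight_chi2],
    [dilation_error], [smoothed_gradient]). Since [sigma ^+ 2] is proportional
    to [f u - flb], which is at least a multiple of the squared distance, the
    Fisher information is bounded by a multiple of [d * (L / alpha) ^+ 3], and
    the bound on the convexity gap is exactly what makes the error a fraction of
    [alpha] ([gaussian_step]). The oracle adds its variance ([oracle_step]).
    Altogether the mean squared distance contracts by [1 - q / 200], with
    [q = eta * lambda], as long as it exceeds 200 times a level affine in
    [Delta].

    One run. Let [far t] be the event that the run has stayed beyond that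
    threshold up to time [t]. The second moment truncated to [far t] contracts
    at each step ([far_step]); the noise and the oracle seed are integrated out
    conditionally on the past, in the form of an integration over a product
    ([decoupling]). Markov's inequality then bounds the probability of [far T]
    ([far_prob]). Off this event some iterate came close to [xs], so the best
    iterate has a value bounded by the level ([stage_output_le]).

    The outer loop is deterministic off the failures of the [N + 1] runs. Raising
    the lower bound by the fraction [gamma] of the observed gap keeps it below
    the minimum unless the final accuracy is already reached, and contracts
    [Delta], shifted by the accuracy, by [1 - gamma] ([stage_invariant]); after
    [N] rounds [Delta] would be below [eps] ([outer_accuracy]). The theorem is
    the union bound over the runs ([probability_avoid]), and the distance bound
    follows from the quadratic growth of [f] ([sqdist_of_value]). *)

Set Implicit Arguments.
Unset Strict Implicit.
Unset Printing Implicit Defensive.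

Import Order.TTheory GRing.Theory Num.Theory.
Import numFieldNormedType.Exports.

Local Open Scope classical_set_scope.
Local Open Scope ring_scope.

(** * Euclidean geometry *)

Section EuclideanAlgebra.
Context (R : realType) (d : nat).
Implicit Types (u v w : 'rV[R]_d) (a : R).

Definition sqn u : R := dotv u u.

Lemma dotvC u v : dotv u v = dotv v u.
Proof. by apply: eq_bigr => i _; rewrite mulrC. Qed.

Lemma dotvDl u v w : dotv (u + v) w = dotv u w + dotv v w.
Proof. by rewrite /dotv -big_split/=; apply: eq_bigr => i _; rewrite mxE mulrDl. Qed.

Lemma dotvZl a u v : dotv (a *: u) v = a * dotv u v.
Proof. by rewrite /dotv mulr_sumr; apply: eq_bigr => i _; rewrite mxE mulrA. Qed.

Lemma dotvNl u v : dotv (- u) v = - dotv u v.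
Proof. by rewrite -scaleN1r dotvZl mulN1r. Qed.

Lemma dotvDr u v w : dotv u (v + w) = dotv u v + dotv u w.
Proof. by rewrite dotvC dotvDl !(dotvC u). Qed.

Lemma dotvZr a u v : dotv u (a *: v) = a * dotv u v.
Proof. by rewrite dotvC dotvZl dotvC. Qed.

Lemma dotvNr u v : dotv u (- v) = - dotv u v.
Proof. by rewrite dotvC dotvNl dotvC. Qed.

Definition dotvE := (dotvDl, dotvDr, dotvNl, dotvNr, dotvZl, dotvZr).

Lemma sqnE u : sqn u = \sum_(i < d) u 0 i ^+ 2.
Proof. by apply: eq_bigr => i _; rewrite expr2. Qed.

Lemma sqn_ge0 u : 0 <= sqn u.
Proof. by rewrite sqnE; apply: sumr_ge0 => i _; rewrite sqr_ge0. Qed.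

Lemma sqnZ a u : sqn (a *: u) = a ^+ 2 * sqn u.
Proof. by rewrite /sqn !dotvE; ring. Qed.

Lemma sqnBZ a u v : sqn (u - a *: v) = sqn u - 2 * a * dotv v u + a ^+ 2 * sqn v.
Proof. by rewrite /sqn !dotvE (dotvC u v); ring. Qed.

Lemma sqn_eq0 u : sqn u = 0 -> u = 0.
Proof.
rewrite sqnE => /eqP; rewrite psumr_eq0; last by move=> i _; rewrite sqr_ge0.
move=> /allP u0; apply/rowP => i; rewrite mxE; apply/eqP.
by have := u0 i (mem_index_enum _); rewrite /= sqrf_eq0.
Qed.

Lemma sqn0 : sqn (0 : 'rV[R]_d) = 0.
Proof. by rewrite /sqn -(scale0r 0) dotvZl mul0r. Qed.

Lemma enorm_ge0 u : 0 <= enorm u.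
Proof. exact: sqrtr_ge0. Qed.

Lemma sqr_enorm u : enorm u ^+ 2 = sqn u.
Proof. by rewrite sqr_sqrtr// sqn_ge0. Qed.

Lemma cauchy_schwarz u v : dotv u v ^+ 2 <= sqn u * sqn v.
Proof.
have [v0|v0] := eqVneq (sqn v) 0.
  by rewrite (sqn_eq0 v0) -(scale0r 0) dotvZr sqnZ expr0n/= !mul0r expr0n/= mulr0.
have vp : 0 < sqn v by rewrite lt_neqAle eq_sym v0 sqn_ge0.
have : 0 <= sqn v * sqn (u - (dotv v u / sqn v) *: v).
  by rewrite mulr_ge0 ?sqn_ge0.
have -> : sqn v * sqn (u - (dotv v u / sqn v) *: v) =
    sqn u * sqn v - dotv u v ^+ 2.
  by rewrite sqnBZ (dotvC u); field.
by rewrite subr_ge0.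
Qed.

(** The growth condition on a gradient [g], with [e] the displacement from the
    minimizer, enters every estimate in this squared form; it avoids square
    roots. *)
Lemma dotv_bound (L : R) g e : 0 <= L -> sqn g <= L ^+ 2 * sqn e ->
  `|dotv g e| <= L * sqn e.
Proof.
move=> L0 gL; have e0 := sqn_ge0 e.
rewrite -(@ler_pXn2r _ 2)// ?nnegrE ?mulr_ge0// real_normK ?num_real//.
by have := cauchy_schwarz g e; nra.
Qed.

Lemma gradient_step_le (L eta : R) g e : 0 <= L -> 0 <= eta ->
  sqn g <= L ^+ 2 * sqn e ->
  sqn (e - eta *: g) <= (1 + eta * L) ^+ 2 * sqn e.
Proof.
move=> L0 eta0 gL; have := dotv_bound L0 gL; rewrite ler_norml => /andP[h _].
rewrite sqnBZ; have : 0 <= eta ^+ 2 by rewrite sqr_ge0.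
have : 0 <= eta * (dotv g e + L * sqn e) by rewrite mulr_ge0//; lra.
by nra.
Qed.

Lemma gradient_step_ge (L eta : R) g e : 0 <= L -> 0 <= eta -> eta * L <= 1 ->
  sqn g <= L ^+ 2 * sqn e ->
  (1 - eta * L) ^+ 2 * sqn e <= sqn (e - eta *: g).
Proof.
move=> L0 eta0 etaL gL.
have ge : dotv g e <= enorm g * enorm e.
  have := cauchy_schwarz g e; rewrite -!sqr_enorm -exprMn.
  have gE0 : 0 <= enorm g * enorm e by rewrite mulr_ge0 ?enorm_ge0.
  rewrite -ler_sqrt ?sqr_ge0// !sqrtr_sqr (ger0_norm gE0).
  exact/le_trans/ler_norm.
have gLe : enorm g <= L * enorm e.
  rewrite -(@ler_pXn2r _ 2)// ?nnegrE ?mulr_ge0 ?enorm_ge0// exprMn.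
  by rewrite !sqr_enorm.
have : ((1 - eta * L) * enorm e) ^+ 2 <= (enorm e - eta * enorm g) ^+ 2.
  rewrite ler_pXn2r ?nnegrE//.
  - nra.
  - by rewrite mulr_ge0 ?enorm_ge0 ?subr_ge0.
  - by have := enorm_ge0 e; nra.
by rewrite exprMn sqr_enorm sqnBZ -!sqr_enorm; nra.
Qed.

End EuclideanAlgebra.

(** * Growth along rays *)

Section Rays.
Context (R : realType).

(** The mean value theorem for [phi] minus the quadratic of second derivative
    [k]: the sign of the derivative of the difference settles the inequality,
    which avoids integrating [dphi]. *)
Lemma ray_growth (phi dphi : R -> R) (k s t : R) : s <= t ->
  (forall x : R, is_derive x (1 : R) phi (dphi x)) ->
  (forall x, s < x < t -> k * x <= dphi x) ->
  k / 2 * (t ^+ 2 - s ^+ 2) <= phi t - phi s.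
Proof.
move=> st dphiE kphi.
rewrite le_eqVlt in st; case/predU1P: st => [->|st]; first by rewrite !subrr mulr0.
pose psi := fun x : R => phi x - k / 2 * x ^+ 2.
have dpsi (x : R) : is_derive x (1 : R) psi (dphi x - k * x).
  rewrite /psi; apply: is_derive_eq; rewrite /GRing.scale/=; lra.
have cpsi : {within `[s, t], continuous psi}.
  apply: continuous_subspaceT => x; apply: differentiable_continuous.
  exact/derivable1_diffP/ex_derive.
have [c] := MVT st (fun x _ => dpsi x) cpsi.
rewrite in_itv/= => /kphi kc psiE.
have : 0 <= (dphi c - k * c) * (t - s) by rewrite mulr_ge0// subr_ge0// ltW.
by rewrite -psiE /psi; lra.
Qed.

Context (d : nat).
Implicit Types (f : 'rV[R]_d -> R) (x v c : 'rV[R]_d).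

Lemma derive_grad f x v : differentiable f x -> 'D_v f x = dotv (grad f x) v.
Proof.
move=> df; rewrite deriveE// {1}(row_sum_delta v) linear_sum/=.
apply: eq_bigr => i _; rewrite linearZ/= -deriveE// mxE mulrC.
by rewrite /GRing.scale.
Qed.

Lemma is_derive_ray f c v (t : R) : (forall x, differentiable f x) ->
  is_derive t (1 : R) (fun s : R => f (c + s *: v)) (dotv (grad f (c + t *: v)) v).
Proof.
move=> df.
pose r : R -> 'rV[R]_d := cst c + ( *:%R ^~ v).
have dr : is_diff t r (0 + ( *:%R ^~ v)) by exact: is_diffD.
have {dr} [dr rE] : differentiable r t /\ 'd r t = 0 + ( *:%R ^~ v) :> (R -> 'rV[R]_d).
  by case: dr.
rewrite (_ : (fun s => _) = f \o r)//.
have dfr : differentiable (f \o r) t by exact: differentiable_comp.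
apply: DeriveDef; first exact/derivable1_diffP.
rewrite deriveE// diff_comp//= rE !fctE scale1r add0r -deriveE//.
exact: derive_grad.
Qed.

End Rays.

(** * Functions close to one-point convex ones *)

Section Landscape.
Context (R : realType) (d : nat).
Implicit Types (f g : 'rV[R]_d -> R) (x v xs : 'rV[R]_d).

(** Growth holds between any two points of a ray issued from [xs], because the
    one-point inequality bounds the radial derivative at each of them. Dilations
    about [xs] use it away from the base point. *)
Lemma one_point_convex_growth (alpha : R) xs c g v (s t : R) :
  one_point_convex alpha xs c g -> 0 <= s -> s <= t ->
  alpha / 2 * (t ^+ 2 - s ^+ 2) * sqn v <= g (xs + t *: v) - g (xs + s *: v).
Proof.
move=> [[dg _] _ gP] s0 st.
lapply (@ray_growth R _ _ (alpha * sqn v) s t st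
  (fun x : R => is_derive_ray xs v x dg)); first lra.
move=> x /andP[sx xt].
have x0 : 0 < x by lra.
rewrite -(ler_pM2l x0).
by have := gP (xs + x *: v); rewrite (addrC xs) addrK dotvZr sqr_enorm sqnZ; lra.
Qed.

Lemma growth_upper (L : R) f xs v (s t : R) : 0 <= L ->
  (forall x, differentiable f x) ->
  (forall x, sqn (grad f x) <= L ^+ 2 * sqn (x - xs)) ->
  0 <= s -> s <= t ->
  `|f (xs + t *: v) - f (xs + s *: v)| <= L / 2 * (t ^+ 2 - s ^+ 2) * sqn v.
Proof.
move=> L0 df fL s0 st.
have bnd (x : R) : 0 < x -> `|dotv (grad f (xs + x *: v)) v| <= L * sqn v * x.
  move=> x0; rewrite -(ler_pM2l x0); have := dotv_bound L0 (fL (xs + x *: v)).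
  by rewrite (addrC xs) addrK dotvZr sqnZ normrM gtr0_norm//; lra.
rewrite ler_norml; apply/andP; split.
- lapply (@ray_growth R _ _ (- (L * sqn v)) s t st
    (fun x : R => is_derive_ray xs v x df)); first lra.
  move=> x /andP[sx xt].
  have x0 : 0 < x by lra.
  by have := bnd _ x0; rewrite ler_norml => /andP[]; lra.
- have dN (x : R) : is_derive x (1 : R) (- (fun s : R => f (xs + s *: v)))
      (- dotv (grad f (xs + x *: v)) v).
    by apply: is_deriveN; exact: is_derive_ray.
  lapply (@ray_growth R _ _ (- (L * sqn v)) s t st dN); first by rewrite !fctE; lra.
  move=> x /andP[sx xt].
  have x0 : 0 < x by lra.
  by have := bnd _ x0; rewrite ler_norml => /andP[]; lra.
Qed.

Lemma quadratic_upper (L : R) f xs x : 0 <= L ->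
  (forall x, differentiable f x) ->
  (forall x, sqn (grad f x) <= L ^+ 2 * sqn (x - xs)) ->
  f x - f xs <= L / 2 * sqn (x - xs).
Proof.
move=> L0 df fL; have := growth_upper (x - xs) L0 df fL (lexx 0) ler01.
rewrite scale1r scale0r addr0 (addrC xs) subrK expr1n expr0n/= subr0 mulr1.
by rewrite ler_norml => /andP[].
Qed.

(** The infimum defining the gap need not be attained, hence the slack
    [delta]. *)
Lemma near_optimal_surrogate (alpha : R) f xs (M delta : R) : (0 < d)%N ->
  (convexity_gap f xs alpha <= M%:E)%E -> 0 < delta ->
  [/\ 0 <= fine (convexity_gap f xs alpha),
      fine (convexity_gap f xs alpha) <= M &
      exists2 g, one_point_convex alpha xs (f xs) g & forall x,
        `|f x - g x| <= (fine (convexity_gap f xs alpha) + delta) / 2 * sqn (x - xs)].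
Proof.
move=> d0 gapM delta0.
have [e ex] : exists x : 'rV[R]_d, x <> xs.
  exists (xs + delta_mx 0 (Ordinal d0)) => /rowP/(_ (Ordinal d0)).
  by rewrite !mxE !eqxx/= => /eqP; rewrite -subr_eq0 (addrC (xs _ _)) addrK oner_eq0.
pose S g := ereal_sup [set (2 * `|f x - g x| / enorm (x - xs) ^+ 2)%:E
         | x in [set x | x <> xs]].
have S0 g : (0 <= S g)%E.
  apply: (@le_trans _ _ (2 * `|f e - g e| / enorm (e - xs) ^+ 2)%:E).
    rewrite lee_fin; apply: divr_ge0; first exact: mulr_ge0.
    exact: sqr_ge0.
  by apply: ereal_sup_ubound; exists e.
have gap0 : (0 <= convexity_gap f xs alpha)%E.
  by apply: le_ereal_inf_tmp => _ [g _ <-]; exact: S0.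
have gapfin : convexity_gap f xs alpha \is a fin_num.
  by rewrite ge0_fin_numE// (le_lt_trans gapM) ?ltry.
split; first exact: fine_ge0.
  by rewrite -lee_fin fineK.
have : (convexity_gap f xs alpha < convexity_gap f xs alpha + delta%:E)%E.
  by rewrite lteDl// lte_fin.
rewrite {1}/convexity_gap => /ereal_inf_lt[_ [g gP <-]] Sg.
exists g => // x; have [->|xxs] := eqVneq x xs.
  by case: gP => _ -> _; rewrite !subrr normr0 sqn0 mulr0.
have xp : 0 < sqn (x - xs).
  rewrite lt_neqAle sqn_ge0 andbT eq_sym; apply: contra_neq xxs => /sqn_eq0.
  by move/eqP; rewrite subr_eq0 => /eqP.
have : ((2 * `|f x - g x| / enorm (x - xs) ^+ 2)%:E <=
    convexity_gap f xs alpha + delta%:E)%E.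
  apply: le_trans (ltW Sg); apply: ereal_sup_ubound; exists x => //.
  exact/eqP.
rewrite -{1}(fineK gapfin) -EFinD lee_fin sqr_enorm ler_pdivrMr//; lra.
Qed.

End Landscape.

(** * The one-dimensional Gaussian law *)

Section Density.
Context d (T : measurableType d) (R : realType).
Context (nu : {finite_measure set T -> \bar R}).
Context (mu : {sigma_finite_measure set T -> \bar R}).

(** The Radon-Nikodym derivative of [nu] has the same integrals as [h] over
    measurable sets, so it agrees with [h] almost everywhere. *)
Lemma ge0_integral_density (h : T -> R) (f : T -> \bar R) :
  measurable_fun setT h ->
  (forall A, measurable A -> nu A = (\int[mu]_(x in A) (h x)%:E)%E) ->
  measurable_fun setT f -> (forall x, 0 <= f x)%E ->
  (\int[nu]_x f x = \int[mu]_x (f x * (h x)%:E))%E.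
Proof.
move=> mh nuE mf f0.
have numu : nu `<< mu.
  apply/null_content_dominatesP => A mA muA0; rewrite nuE//.
  apply: null_set_integral => //.
  by apply: measurable_funTS; exact/measurable_EFinP.
rewrite -(Radon_Nikodym_SigmaFinite.change_of_variables numu f0)//.
have mg := measurable_int _ (Radon_Nikodym_SigmaFinite.f_integrable numu).
apply: ae_eq_integral => //.
- exact: emeasurable_funM.
- by apply: emeasurable_funM => //; exact/measurable_EFinP.
have : ae_eq mu setT (Radon_Nikodym_SigmaFinite.f nu mu) (EFin \o h).
  apply: integral_ae_eq => //.
  - exact: Radon_Nikodym_SigmaFinite.f_integrable.
  - exact/measurable_EFinP.
  - by move=> E _ mE; rewrite -nuE//; exact/esym/Radon_Nikodym_SigmaFinite.f_integral.
by apply: filterS => x /= gh xT; rewrite gh.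
Qed.

End Density.

Section ImageMeasure.
Context d d' (T1 : measurableType d) (T2 : measurableType d') (R : realType).
Context (m : {measure set T1 -> \bar R}) (f : T1 -> T2).
Context (mf : measurable_fun setT f).

(** The measurability proof [mf] is part of the measure structure. *)
Definition image_measure : {measure set T2 -> \bar R} :=
  measure_function_pushforward__canonical__measure_function_Measure m mf.

Lemma image_measureE A : image_measure A = m (f @^-1` A).
Proof. by []. Qed.

Lemma ge0_integral_image (g : T2 -> \bar R) :
  measurable_fun setT g -> (forall x, 0 <= g x)%E ->
  (\int[image_measure]_y g y = \int[m]_x g (f x))%E.
Proof.
move=> mg g0; rewrite -[RHS](@ge0_integral_pushforward _ _ _ _ _ f mf m setT)//.
Qed.

End ImageMeasure.

Section Gaussian1.
Context (R : realType).
Local Notation leb := (@lebesgue_measure R).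

(** The scaled image of Lebesgue measure is Lebesgue measure, since both give
    every interval its length. *)
Lemma ge0_integral_affine (t a : R) (g : R -> \bar R) : 0 < t ->
  measurable_fun setT g -> (forall x, 0 <= g x)%E ->
  (\int[leb]_x g x = t%:E * \int[leb]_x g (t * x + a)%R)%E.
Proof.
move=> t0 mg g0.
pose F := (fun x : R => t * x + a) : measurableTypeR R -> measurableTypeR R.
have mF : measurable_fun setT F.
  by apply: measurable_funD => //; exact: measurable_funM.
pose nu : {measure set (measurableTypeR R) -> \bar R} :=
  mscale (NngNum (ltW t0)) (image_measure leb mF).
have nuE (A : set R) : measurable A -> leb A = nu A.
  move=> mA; apply: lebesgue_measure_unique => // _ [[c e]] _ <-/=.
  rewrite /mscale [X in (_ * X)%E](_ : _ = leb `](c - a) / t, (e - a) / t]%classic).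
    rewrite !lebesgue_measure_itv/= !lte_fin ltr_pM2r ?invr_gt0// ltrD2r.
    case: ifPn => // ce; last by rewrite mule0.
    by rewrite -!EFinD -EFinM; congr EFin; field; rewrite gt_eqF.
  rewrite image_measureE; congr (leb _).
  apply/seteqP; split => x /=; rewrite !in_itv/= ltr_pdivrMr// ler_pdivlMr//;
    rewrite /F mulrC; lra.
transitivity (\int[nu]_x g x)%E.
  by apply: eq_measure_integral => A mA _; exact: nuE.
by rewrite ge0_integral_mscale// ge0_integral_image.
Qed.

Lemma ge0_integral_normal_prob (m s : R) (f : R -> \bar R) :
  measurable_fun setT f -> (forall x, 0 <= f x)%E ->
  (\int[normal_prob m s]_x f x = \int[leb]_x (f x * (normal_pdf m s x)%:E))%E.
Proof.
move=> mf f0; apply: ge0_integral_density => //.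
exact: measurable_normal_pdf.
Qed.

Lemma measurable_expquad (a b : R) :
  measurable_fun setT (fun x : R => expR (a * x + b * x ^+ 2)).
Proof.
apply: measurableT_comp => //; apply: measurable_funD; apply: measurable_funM => //.
Qed.

Let complete_square (a s k x : R) : s != 0 -> k != 0 ->
  a * x + (1 - k) / (2 * s ^+ 2) * x ^+ 2 - x ^+ 2 / (2 * s ^+ 2) =
  a ^+ 2 * s ^+ 2 / (2 * k) - (x - a * s ^+ 2 / k) ^+ 2 * k / (2 * s ^+ 2).
Proof. by move=> s0 k0; field; rewrite s0 k0. Qed.

(** All Gaussian integrals below are read off from this one: completing the
    square turns the integrand into a multiple of another Gaussian density,
    of mass one. *)
Lemma normal_expquad (s a b : R) : 0 < s -> 0 < 1 - 2 * b * s ^+ 2 ->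
  (\int[normal_prob 0 s]_x (expR (a * x + b * x ^+ 2))%:E =
  ((Num.sqrt (1 - 2 * b * s ^+ 2))^-1 *
   expR (a ^+ 2 * s ^+ 2 / (2 * (1 - 2 * b * s ^+ 2))))%:E)%E.
Proof.
move=> s0 k0; set k := 1 - _ in k0 *.
have mE := measurable_expquad a b.
rewrite ge0_integral_normal_prob//; last exact/measurable_EFinP.
set C := _ * expR _.
have q0 : 0 < Num.sqrt k by rewrite sqrtr_gt0.
have q2 : Num.sqrt k ^+ 2 = k by rewrite sqr_sqrtr// ltW.
pose m' := a * s ^+ 2 / k; pose s' := s / Num.sqrt k.
have s'0 : 0 < s' by rewrite divr_gt0.
transitivity (\int[leb]_x (C%:E * (normal_pdf m' s' x)%:E))%E.
  apply: eq_integral => x _; rewrite -!EFinM !normal_pdfE ?gt_eqF//.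
  rewrite /normal_fun /C /normal_peak; congr EFin.
  have -> : Num.sqrt (s ^+ 2 * pi *+ 2) = s * Num.sqrt (pi *+ 2).
    by rewrite -mulrnAr sqrtrM ?sqr_ge0// sqrtr_sqr gtr0_norm.
  have -> : Num.sqrt (s' ^+ 2 * pi *+ 2) = s' * Num.sqrt (pi *+ 2).
    by rewrite -mulrnAr sqrtrM ?sqr_ge0// sqrtr_sqr gtr0_norm.
  have p0 : 0 < Num.sqrt (pi *+ 2 : R) by rewrite sqrtr_gt0 pmulrn_lgt0// pi_gt0.
  have expE : expR (a * x + b * x ^+ 2) * expR (- (x - 0) ^+ 2 / (s ^+ 2 *+ 2)) =
     expR (a ^+ 2 * s ^+ 2 / (2 * k)) * expR (- (x - m') ^+ 2 / (s' ^+ 2 *+ 2)).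
    have bE : b = (1 - k) / (2 * s ^+ 2).
      have -> : 1 - k = b * (2 * s ^+ 2) by rewrite /k; ring.
      by rewrite mulfK// gt_eqF// mulr_gt0// exprn_gt0.
    rewrite -!expRD; congr expR; rewrite /m' /s' expr_div_n q2 bE.
    rewrite subr0 -(mulr_natl (s ^+ 2)) -(mulr_natl (s ^+ 2 / k)) (mulrA 2) invf_div (mulrA _ k) !mulNr.
    by rewrite complete_square// gt_eqF.
  rewrite mulrCA expE /s'; field.
  by rewrite !gt_eqF.
rewrite ge0_integralZl//.
- by rewrite integral_normal_pdf mule1.
- by apply/measurable_EFinP; exact: measurable_normal_pdf.
- by move=> x _; rewrite lee_fin normal_pdf_ge0.
- by rewrite lee_fin /C mulr_ge0// ?expR_ge0// invr_ge0 ltW.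
Qed.

(** The density, with respect to the law [N(0, s^2)] itself, of the image of
    that law under [x |-> t x + a]. *)
Definition affine_density (s t a x : R) : R :=
  t^-1 * expR (x ^+ 2 / (2 * s ^+ 2) - (x - a) ^+ 2 / (2 * t ^+ 2 * s ^+ 2)).

Lemma measurable_affine_density s t a :
  measurable_fun setT (affine_density s t a).
Proof.
apply: measurable_funM => //; apply: measurableT_comp => //.
apply: measurable_funB; apply: measurable_funM => //.
by apply: measurable_funX; exact: measurable_funB.
Qed.

Lemma affine_density_ge0 s t a x : 0 < t -> 0 <= affine_density s t a x.
Proof. by move=> t0; rewrite mulr_ge0 ?invr_ge0 ?expR_ge0// ltW. Qed.

(** The change of variables, transported back to the Gaussian law: an affine
    change of the variable becomes a change of weight. *)
Lemma normal_affine (s t a : R) (g : R -> \bar R) : 0 < s -> 0 < t ->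
  measurable_fun setT g -> (forall x, 0 <= g x)%E ->
  (\int[normal_prob 0 s]_x g (t * x + a)%R =
   \int[normal_prob 0 s]_x (g x * (affine_density s t a x)%:E))%E.
Proof.
move=> s0 t0 mg g0.
have mF : measurable_fun setT (fun x : R => t * x + a).
  by apply: measurable_funD => //; exact: measurable_funM.
have mG : measurable_fun setT (fun x : R => (x - a) / t).
  by apply: measurable_funM => //; exact: measurable_funB.
rewrite ge0_integral_normal_prob//; last exact: measurableT_comp.
rewrite [RHS]ge0_integral_normal_prob//; first last.
- by move=> x; apply: mule_ge0 => //; rewrite lee_fin affine_density_ge0.
- by apply: emeasurable_funM => //; apply/measurable_EFinP; exact: measurable_affine_density.
rewrite [RHS](_ : _ = \int[leb]_x (t^-1%:E *
    (g x * (normal_pdf 0 s ((x - a) / t))%:E)))%E; last first.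
  apply: eq_integral => x _; rewrite muleCA -muleA -!EFinM; congr (_ * _%:E)%E.
  rewrite !normal_pdfE ?gt_eqF// /normal_fun /affine_density.
  have expE : expR (x ^+ 2 / (2 * s ^+ 2) - (x - a) ^+ 2 / (2 * t ^+ 2 * s ^+ 2)) *
      expR (- (x - 0) ^+ 2 / (s ^+ 2 *+ 2)) =
      expR (- ((x - a) / t - 0) ^+ 2 / (s ^+ 2 *+ 2)).
    rewrite -expRD; congr expR; rewrite -(mulr_natl (s ^+ 2)) !subr0.
    by field; rewrite !gt_eqF.
  by rewrite -expE; ring.
have mgp : measurable_fun setT
    (fun x => (g x * (normal_pdf 0 s ((x - a) / t))%:E)%E).
  apply: emeasurable_funM => //; apply/measurable_EFinP.
  by apply: (measurableT_comp (measurable_normal_pdf 0 s)).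
have gp0 x : (0 <= g x * (normal_pdf 0 s ((x - a) / t))%:E)%E.
  by apply: mule_ge0 => //; rewrite lee_fin normal_pdf_ge0.
rewrite ge0_integralZl//; last by rewrite lee_fin invr_ge0 ltW.
rewrite (ge0_integral_affine a t0 mgp)// muleA -EFinM mulVf ?gt_eqF// mul1e.
by apply: eq_integral => x _; rewrite addrK mulrAC divff ?gt_eqF// mul1r.
Qed.

End Gaussian1.

(** * Real-valued expectations *)

Section Expectations.
Context d (T : measurableType d) (R : realType) (P : probability T R).
Implicit Types f g : T -> R.

(** Integrability and expectation for real-valued functions, so that moment
    computations stay in the field [R]. *)
Definition rint f := P.-integrable setT (EFin \o f).
Definition Ex f : R := \int[P]_x f x.

Lemma rint_measurable f : rint f -> measurable_fun setT f.
Proof. by move=> /measurable_int/measurable_EFinP. Qed.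

Lemma rint_cst (c : R) : rint (fun=> c).
Proof.
apply/integrableP; split; first exact/measurable_EFinP.
by rewrite /= integral_cst//= probability_setT mule1 ltry.
Qed.

Lemma rintD f g : rint f -> rint g -> rint (fun x => f x + g x).
Proof. by move=> rf rg; exact: (integrableD measurableT rf rg). Qed.

Lemma rintZ (c : R) f : rint f -> rint (fun x => c * f x).
Proof. by move=> rf; exact: (integrableZl measurableT c rf). Qed.

Lemma rintB f g : rint f -> rint g -> rint (fun x => f x - g x).
Proof. by move=> rf rg; exact: (integrableB measurableT rf rg). Qed.

Lemma rint_sum (I : Type) (s : seq I) (f : I -> T -> R) :
  (forall i, rint (f i)) -> rint (fun x => \sum_(i <- s) f i x).
Proof.
move=> rf; elim: s => [|i s IH].
  by under [X in rint X]funext => x do rewrite big_nil; exact: rint_cst.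
under [X in rint X]funext => x do rewrite big_cons.
exact: rintD.
Qed.

Lemma rint_le f g : measurable_fun setT f -> (forall x, `|f x| <= g x) ->
  rint g -> rint f.
Proof.
move=> mf fg rg; apply: le_integrable rg => //; first exact/measurable_EFinP.
move=> x _ /=; rewrite lee_fin (le_trans (fg x))//.
by rewrite ger0_norm// (le_trans _ (fg x)).
Qed.

Lemma EFin_Ex f : rint f -> (\int[P]_x (f x)%:E = (Ex f)%:E)%E.
Proof. by move=> rf; rewrite /Ex /Rintegral fineK// integrable_fin_num. Qed.

Lemma rint_ge0 f (c : R) : measurable_fun setT f -> (forall x, 0 <= f x) ->
  (\int[P]_x (f x)%:E <= c%:E)%E -> rint f /\ Ex f <= c.
Proof.
move=> mf f0 fc; have rf : rint f.
  apply/integrableP; split; first exact/measurable_EFinP.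
  under eq_integral do rewrite /= ger0_norm//.
  exact: le_lt_trans fc (ltry _).
by split => //; rewrite -lee_fin -EFin_Ex.
Qed.

Lemma Ex_cst (c : R) : Ex (fun=> c) = c.
Proof. by rewrite /Ex Rintegral_cst//= probability_setT mulr1. Qed.

Lemma ExD f g : rint f -> rint g -> Ex (fun x => f x + g x) = Ex f + Ex g.
Proof. by move=> rf rg; rewrite /Ex RintegralD. Qed.

Lemma ExB f g : rint f -> rint g -> Ex (fun x => f x - g x) = Ex f - Ex g.
Proof. by move=> rf rg; rewrite /Ex RintegralB. Qed.

Lemma ExZ (c : R) f : rint f -> Ex (fun x => c * f x) = c * Ex f.
Proof. by move=> rf; rewrite /Ex RintegralZl. Qed.

Lemma Ex_le f g : rint f -> rint g -> (forall x, f x <= g x) -> Ex f <= Ex g.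
Proof. by move=> rf rg fg; apply: le_Rintegral => // x _. Qed.

Lemma Ex_sum (I : Type) (s : seq I) (f : I -> T -> R) :
  (forall i, rint (f i)) -> Ex (fun x => \sum_(i <- s) f i x) = \sum_(i <- s) Ex (f i).
Proof.
move=> rf; elim: s => [|i s IH].
  by under [X in Ex X]funext => x do rewrite big_nil; rewrite Ex_cst big_nil.
under [X in Ex X]funext => x do rewrite big_cons.
by rewrite ExD// ?IH ?big_cons//; exact: rint_sum.
Qed.

End Expectations.

Section Elementary.
Context (R : realType).

(** Makes an error term proportional to a free parameter vanish; each use is a
    derivative at zero taken without differentiating. *)
Lemma le_of_le_slope (M c k : R) :
  (forall y, 0 < y -> y <= 2^-1 -> M <= c + k * y) -> M <= c.
Proof.
move=> h; apply/ler_addgt0Pr => e e0.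
have k0 : 0 < `|k| + 1 by rewrite ltr_wpDl.
pose y := Num.min 2^-1 (e / (`|k| + 1)).
have y0 : 0 < y by rewrite lt_min invr_gt0 ltr0n/= divr_gt0.
have ye : y * (`|k| + 1) <= e by rewrite -ler_pdivlMr// ge_min lexx orbT.
have /(h _ y0) : y <= 2^-1 by rewrite ge_min lexx.
move=> /le_trans; apply; rewrite lerD2l.
by have := ler_norm k; nra.
Qed.

(** The Taylor expansion to second order, with an explicit cubic remainder. *)
Lemma inv_sqrt_taylor (y : R) : - 2^-1 <= y <= 2^-1 ->
  (Num.sqrt (1 - y))^-1 <= 1 + y / 2 + 3 / 8 * y ^+ 2 + `|y| ^+ 3.
Proof.
move=> /andP[ya yb]; set B := _ + _ + _ + _.
have B0 : 0 <= B.
  have : 0 <= `|y| ^+ 3 by rewrite exprn_ge0.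
  by rewrite /B; nra.
have k0 : 0 < 1 - y by lra.
rewrite -[leRHS]ger0_norm// -sqrtr_sqr -(sqrtrV (ltW k0)) ler_sqrt ?sqr_ge0//.
rewrite -div1r ler_pdivrMr// /B.
rewrite -subr_ge0.
have pow (u : R) n : 0 <= u -> u <= 2^-1 -> u ^+ n.+1 <= u ^+ n / 2.
  by move=> u0 u2; rewrite exprSr ler_wpM2l// exprn_ge0.
have [y0|y0] := leP 0 y.
  rewrite ger0_norm// (_ : _ - 1 = 11 / 8 * y ^+ 3 - 79 / 64 * y ^+ 4 - 25 / 64 * y ^+ 5 +
    4^-1 * y ^+ 6 - y ^+ 7); last by field.
  have := exprn_ge0 6 y0; have := exprn_ge0 3 y0.
  have := pow _ 3 y0 yb; have := pow _ 4 y0 yb; have := pow _ 5 y0 yb.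
  have := pow _ 6 y0 yb; lra.
have u0 : 0 <= - y by lra.
have ub : - y <= 2^-1 by lra.
rewrite ltr0_norm// (_ : _ - 1 = 21 / 8 * (- y) ^+ 3 + 49 / 64 * (- y) ^+ 4 -
  7 / 64 * (- y) ^+ 5 + 7 / 4 * (- y) ^+ 6 + (- y) ^+ 7); last by field.
have := exprn_ge0 7 u0; have := exprn_ge0 6 u0; have := exprn_ge0 3 u0.
have := exprn_ge0 4 u0; have := pow _ 4 u0 ub; lra.
Qed.

Lemma cosh_ge (u : R) : 2 + u ^+ 2 <= expR u + expR (- u).
Proof.
have sinh (v : R) : 0 <= v -> 2 * v <= expR v - expR (- v).
  move=> v0.
  have dphi (x : R) : is_derive x (1 : R)
      (fun x : R => expR x - expR (- x) - 2 * x) (expR x + expR (- x) - 2).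
    apply: is_derive_eq; rewrite /GRing.scale/=; lra.
  lapply (ray_growth (k := 0) v0 dphi).
    by rewrite mul0r mul0r oppr0 expR0; lra.
  move=> x _; have := expR_gt0 x; have := expRxMexpNx_1 x.
  have := sqr_ge0 (expR x - expR (- x)); have := expR_gt0 (- x); nra.
wlog u0 : u / 0 <= u => [hw|].
  have [/hw//|u0] := leP 0 u; have := hw (- u).
  by rewrite opprK sqrrN (addrC (expR _)); apply; rewrite oppr_ge0 ltW.
have := sinh (u / 2); rewrite divr_ge0// => /(_ isT) h.
have e0 : expR u = expR (u / 2) ^+ 2 by rewrite -expRM_natl; congr expR; field.
have e1 : expR (- u) = expR (- (u / 2)) ^+ 2 by rewrite -expRM_natl; congr expR; field.
rewrite e0 e1; have := expRxMexpNx_1 (u / 2); nra.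
Qed.

Lemma expR_sub1_le (u : R) : expR u - 1 <= u * expR u.
Proof.
have := expR_ge1Dx (- u); have := expRxMexpNx_1 u; have := expR_gt0 u; nra.
Qed.

End Elementary.

(** * Moments of a Gaussian variable *)

Section Moments.
Context d (T : measurableType d) (R : realType) (P : probability T R).
Context (Y : T -> R) (s : R) (s0 : 0 < s) (mY : measurable_fun setT Y).
Context (YN : forall A, measurable A -> P (Y @^-1` A) = normal_prob 0 s A).

Lemma ge0_integral_gaussian (g : R -> \bar R) :
  measurable_fun setT g -> (forall x, 0 <= g x)%E ->
  (\int[P]_w g (Y w) = \int[normal_prob 0 s]_x g x)%E.
Proof.
move=> mg g0.
have mY' : measurable_fun setT (Y : T -> measurableTypeR R) by exact: mY.
have mg' : measurable_fun setT (g : measurableTypeR R -> \bar R) by exact: mg.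
rewrite -(ge0_integral_image P mY' mg' g0).
by apply: eq_measure_integral => A mA _; rewrite /= -YN.
Qed.

Lemma gaussian_expquad (a b : R) : 0 < 1 - 2 * b * s ^+ 2 ->
  let G := fun w => expR (a * Y w + b * Y w ^+ 2) in
  rint P G /\ Ex P G = (Num.sqrt (1 - 2 * b * s ^+ 2))^-1 *
     expR (a ^+ 2 * s ^+ 2 / (2 * (1 - 2 * b * s ^+ 2))).
Proof.
move=> k0 G.
have mE := measurable_expquad a b.
have mG : measurable_fun setT G by apply: (measurableT_comp mE).
have GE : (\int[P]_w (G w)%:E = ((Num.sqrt (1 - 2 * b * s ^+ 2))^-1 *
     expR (a ^+ 2 * s ^+ 2 / (2 * (1 - 2 * b * s ^+ 2))))%:E)%E.
  rewrite -normal_expquad//.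
  rewrite (@ge0_integral_gaussian (fun x => (expR (a * x + b * x ^+ 2))%:E))//.
  exact/measurable_EFinP.
have GE' := GE; move: GE'; set c := _^-1 * expR _ => GE'.
have Gc : (\int[P]_w (G w)%:E <= c%:E)%E by rewrite GE'.
have [rG _] := rint_ge0 mG (fun w => expR_ge0 _) Gc.
split; first exact: rG.
by move: GE'; rewrite EFin_Ex// => -[].
Qed.

Lemma gaussian_expsq (y : R) : y < 1 ->
  let G := fun w => expR (y / (2 * s ^+ 2) * Y w ^+ 2) in
  rint P G /\ Ex P G = (Num.sqrt (1 - y))^-1.
Proof.
move=> y1 G.
have yE : 1 - 2 * (y / (2 * s ^+ 2)) * s ^+ 2 = 1 - y by field; rewrite gt_eqF.
have [] := @gaussian_expquad 0 (y / (2 * s ^+ 2)); rewrite yE ?subr_gt0//.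
rewrite expr0n/= !mul0r expR0 mulr1.
by rewrite (_ : (fun w => _) = G)//; apply/funext => w; rewrite mul0r add0r.
Qed.

Let s2 : 0 < 2 * s ^+ 2. Proof. by rewrite mulr_gt0// exprn_gt0. Qed.

(** The second moment is the slope at [y = 0] of the exponential moment of
    [y * Y ^+ 2], bounded from above through [1 + x <= expR x]. *)
Lemma gaussian_moment2 : rint P (fun w => Y w ^+ 2) /\
  Ex P (fun w => Y w ^+ 2) <= s ^+ 2.
Proof.
have bnd y w : 0 < y -> y < 1 ->
    Y w ^+ 2 <= (2 * s ^+ 2 / y) * (expR (y / (2 * s ^+ 2) * Y w ^+ 2) - 1).
  move=> y0 y1; rewrite mulrAC ler_pdivlMr// mulrC.
  have := expR_ge1Dx (y / (2 * s ^+ 2) * Y w ^+ 2).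
  rewrite -lerBrDl -(ler_pM2l s2); apply: le_trans.
  by rewrite le_eqVlt; apply/orP; left; apply/eqP; field; rewrite gt_eqF.
have rY : rint P (fun w => Y w ^+ 2).
  have [rG _] := @gaussian_expsq 2^-1 ltac:(lra).
  apply: rint_le (rintZ (2 * s ^+ 2 / 2^-1) (rintB rG (rint_cst P 1))) => [|w].
    exact: measurable_funX.
  by rewrite ger0_norm ?sqr_ge0//; apply: bnd; lra.
split => //; apply: (@le_of_le_slope _ _ _ (2 * s ^+ 2)) => y y0 y2.
have [rG GE] := @gaussian_expsq y ltac:(lra).
apply: (@le_trans _ _ (2 * s ^+ 2 / y * ((Num.sqrt (1 - y))^-1 - 1))).
  rewrite -GE -[X in _ - X](Ex_cst P 1) -ExB//; last exact: rint_cst.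
  rewrite -ExZ; last by apply: rintB => //; exact: rint_cst.
  apply: Ex_le => // [|w]; last by apply: bnd; lra.
  by apply: rintZ; apply: rintB => //; exact: rint_cst.
have := @inv_sqrt_taylor _ y; rewrite y2 (_ : - 2^-1 <= y); last lra.
rewrite gtr0_norm// => /(_ isT) h.
rewrite mulrAC ler_pdivrMr//.
have y3 : y ^+ 3 <= y ^+ 2 / 2 by rewrite exprSr ler_wpM2l// sqr_ge0.
have : (Num.sqrt (1 - y))^-1 - 1 <= y / 2 + y ^+ 2 by nra.
rewrite -(ler_pM2l s2) => /le_trans; apply; nra.
Qed.

(** The fourth moment is the second difference at [y = 0] of the same
    exponential moment, bounded through [2 + x ^+ 2 <= expR x + expR (- x)]. *)
Lemma gaussian_moment4 : rint P (fun w => Y w ^+ 4) /\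
  Ex P (fun w => Y w ^+ 4) <= 3 * s ^+ 4.
Proof.
have bnd y w : 0 < y -> Y w ^+ 4 <= (2 * s ^+ 2 / y) ^+ 2 *
    (expR (y / (2 * s ^+ 2) * Y w ^+ 2) + expR (- y / (2 * s ^+ 2) * Y w ^+ 2) - 2).
  move=> y0; have := cosh_ge (y / (2 * s ^+ 2) * Y w ^+ 2); rewrite -2!mulNr.
  have c0 : 0 < (2 * s ^+ 2 / y) ^+ 2 by rewrite exprn_gt0// divr_gt0.
  rewrite -lerBrDl -(ler_pM2l c0); apply: le_trans.
  by rewrite le_eqVlt; apply/orP; left; apply/eqP; field; rewrite !gt_eqF.
have rC y : y < 1 -> -1 < y -> rint P (fun w => (2 * s ^+ 2 / y) ^+ 2 *
    (expR (y / (2 * s ^+ 2) * Y w ^+ 2) + expR (- y / (2 * s ^+ 2) * Y w ^+ 2) - 2)).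
  move=> y1 yN1; apply: rintZ; apply: rintB; last exact: rint_cst.
  by apply: rintD; [have [] := @gaussian_expsq y y1|
    have [] := @gaussian_expsq (- y) ltac:(lra)].
have rY : rint P (fun w => Y w ^+ 4).
  apply: rint_le (@rC 2^-1 ltac:(lra) ltac:(lra)) => [|w].
    exact: measurable_funX.
  by rewrite ger0_norm ?exprn_even_ge0//; apply: bnd; lra.
split => //; apply: (@le_of_le_slope _ _ _ (8 * s ^+ 4)) => y y0 y2.
have [rG GE] := @gaussian_expsq y ltac:(lra).
have [rH HE] := @gaussian_expsq (- y) ltac:(lra).
apply: (@le_trans _ _ ((2 * s ^+ 2 / y) ^+ 2 *
    ((Num.sqrt (1 - y))^-1 + (Num.sqrt (1 - - y))^-1 - 2))).
  rewrite -GE -HE -ExD// -[X in _ - X](Ex_cst P 2) -ExB//; last exact: rint_cst.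
    rewrite -ExZ; last by apply: rintB; [exact: rintD|exact: rint_cst].
    by apply: Ex_le => // [|w]; [apply: rC; lra|exact: bnd].
  exact: rintD.
have := @inv_sqrt_taylor _ y; rewrite y2 (_ : - 2^-1 <= y); last lra.
have := @inv_sqrt_taylor _ (- y); rewrite (_ : - y <= 2^-1) ?lerN2 ?y2; last lra.
rewrite normrN gtr0_norm// => /(_ isT) h1 /(_ isT) h2.
rewrite exprMn exprVn mulrAC ler_pdivrMr ?exprn_gt0//.
have : (Num.sqrt (1 - y))^-1 + (Num.sqrt (1 - - y))^-1 - 2 <=
  3 / 4 * y ^+ 2 + 2 * y ^+ 3 by nra.
rewrite -(ler_pM2l (exprn_gt0 2 s2)) => /le_trans; apply.
by rewrite le_eqVlt; apply/orP; left; apply/eqP; field.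
Qed.

(** The exponential moment of [a * Y] squeezes [a] times the mean below a
    multiple of [a ^+ 2]; small [a] of both signs leave only zero. *)
Lemma gaussian_mean0 : rint P Y /\ Ex P Y = 0.
Proof.
have [rY2 _] := gaussian_moment2.
have rY : rint P Y.
  apply: rint_le mY _ (rintD (rint_cst P 1) rY2) => w.
  by rewrite ler_norml; apply/andP; split; nra.
split => //.
have s22 : 0 < s ^+ 2 by rewrite exprn_gt0.
have bnd a : a ^+ 2 * s ^+ 2 <= 1 -> a * Ex P Y <= a ^+ 2 * s ^+ 2.
  move=> a1; have [] := @gaussian_expquad a 0.
    by rewrite mulr0 mul0r subr0.
  rewrite mulr0 mul0r subr0 sqrtr1 invr1 mul1r mulr1 => rG GE.
  have : 1 + a * Ex P Y <= expR (a ^+ 2 * s ^+ 2 / 2).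
    rewrite -GE -ExZ// -[X in X + _](Ex_cst P 1) -ExD//.
    - apply: Ex_le => //.
      + by apply: rintD; [exact: rint_cst|exact: rintZ].
      + by move=> w; rewrite mul0r addr0 expR_ge1Dx.
    - exact: rint_cst.
    - exact: rintZ.
  set u := a ^+ 2 * s ^+ 2 / 2.
  have u2 : u <= 2^-1 by rewrite /u; lra.
  have u0 : 0 <= u by rewrite /u divr_ge0// mulr_ge0 ?sqr_ge0.
  have := expR_ge1Dx (- u); have := expRxMexpNx_1 u; have := expR_gt0 u.
  rewrite (_ : a ^+ 2 * s ^+ 2 = 2 * u); last by rewrite /u; field.
  by move=> h1 h2 h3 h4; nra.
have small y : 0 < y -> y <= 2^-1 -> `|Ex P Y| <= 0 + s * y.
  move=> y0 y2; have ys : (y / s) ^+ 2 * s ^+ 2 = y ^+ 2 by field; rewrite gt_eqF.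
  have y1 : (y / s) ^+ 2 * s ^+ 2 <= 1 by rewrite ys; nra.
  have := bnd _ y1; have := bnd (- (y / s)); rewrite sqrrN => /(_ y1).
  have ys0 : 0 < s / y by rewrite divr_gt0.
  have cancel (m : R) : s / y * (y / s * m) = m by field; rewrite !gt_eqF.
  have sy : s / y * y ^+ 2 = s * y by field; rewrite gt_eqF.
  rewrite ys -(ler_pM2l ys0) mulNr mulrN cancel sy => h1.
  rewrite -(ler_pM2l ys0) cancel sy => h2.
  by rewrite add0r ler_norml; apply/andP; split; lra.
by apply/eqP; rewrite -normr_le0; exact: le_of_le_slope small.
Qed.

End Moments.

(** * The Borel structure of Euclidean space *)

Section BorelRV.
Context (R : realType) (d : nat).
Local Notation V := (borel_rV R d).

Definition box (A : 'I_d -> set R) : set 'rV[R]_d :=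
  [set x | forall i, A i (x 0 i)].

Lemma measurable_continuous (g : 'rV[R]_d -> R) : continuous g ->
  measurable_fun setT (g : V -> R).
Proof.
move=> /continuousP cg; apply: (measurability _ (RGenOpens.measurableE R)).
move=> _ [_ [a [b ->]] <-].
by rewrite setTI; apply: sub_sigma_algebra; apply: cg; exact: interval_open.
Qed.

Lemma measurable_coord (i : 'I_d) :
  measurable_fun setT (fun x : V => (x : 'rV[R]_d) 0 i).
Proof. by apply: measurable_continuous; exact: coord_continuous. Qed.

Lemma measurable_box (A : 'I_d -> set R) : (forall i, measurable (A i)) ->
  measurable (box A : set V).
Proof.
move=> mA; rewrite (_ : box A = \big[setI/setT]_(i < d)
    [set x : V | A i ((x : 'rV[R]_d) 0 i)]).
  apply: bigsetI_measurable => i _; rewrite -[X in measurable X]setTI.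
  exact: measurable_coord.
apply/seteqP; split => x /=.
  by move=> xA; rewrite -bigcap_seq => i _; exact: xA.
by rewrite -bigcap_seq => xA i; apply: (xA i); rewrite /= mem_index_enum.
Qed.

(** Second countability: an open set is a union of boxes with rational
    corners. *)
Lemma measurable_rV_boxes : @measurable _ V =
  <<s [set B | exists2 A, (forall i, measurable (A i)) & B = box A]>>.
Proof.
apply/seteqP; split; last first.
  apply: smallest_sub; first exact: sigma_algebra_measurable.
  by move=> _ [A mA ->]; exact: measurable_box.
set G := [set B | _].
apply: smallest_sub; first exact: smallest_sigma_algebra.
move=> U oU.
pose rbox (pq : 'rV[rat]_d * 'rV[rat]_d) : set 'rV[R]_d :=
  box (fun i => `]ratr (pq.1 0 i), ratr (pq.2 0 i)[%classic).
rewrite (_ : U = \bigcup_pq (if pselect (rbox pq `<=` U) then rbox pq else set0)).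
  apply: (@countable_bigcupT_measurable _ (g_sigma_algebraType G)).
    exact: countableP.
  move=> pq; case: (pselect _) => [sub|nsub] /=; last exact: measurable0.
  apply: sub_sigma_algebra.
  by exists (fun i => `]ratr (pq.1 0 i), ratr (pq.2 0 i)[%classic).
apply/seteqP; split => [x Ux|x [pq _]]; last by case: (pselect _) => //= sub /sub.
have [B nB BU] : nbhs x U by exact: open_nbhs_nbhs.
have /choice[pq pqP] : forall i, exists pq : rat * rat,
    `]ratr pq.1, ratr pq.2[%classic (x 0 i) /\
    `]ratr pq.1, ratr pq.2[%classic `<=` B 0 i.
  move=> i; have /nbhs_ballP[e /= e0 eB] := nB 0 i.
  have [p] := @rat_in_itvoo _ (x 0 i - e) (x 0 i) ltac:(lra).
  have [q] := @rat_in_itvoo _ (x 0 i) (x 0 i + e) ltac:(lra).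
  rewrite !in_itv/= => /andP[xq qe] /andP[ep px].
  exists (p, q); split; first by rewrite /= in_itv/= xq px.
  move=> y; rewrite /= in_itv/= => /andP[py yq]; apply: eB.
  by rewrite /ball/= ltr_distlC; apply/andP; split; lra.
pose r := (\row_i (pq i).1, \row_i (pq i).2).
exists r => //; case: (pselect _) => /= [sub i|[]].
  by rewrite !mxE; have [] := pqP i.
move=> y yr; apply: BU => i j; rewrite ord1.
by have [_] := pqP j; apply; have := yr j; rewrite /= !mxE.
Qed.

Lemma measurable_rV d' (T : measurableType d') (F : T -> 'rV[R]_d) :
  (forall i, measurable_fun setT (fun w => F w 0 i)) ->
  measurable_fun setT (F : T -> V).
Proof.
move=> mF; apply: (measurability _ measurable_rV_boxes).
move=> _ [_ [A mA ->] <-]; rewrite setTI.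
rewrite (_ : F @^-1` box A = \big[setI/setT]_(i < d) [set w | A i (F w 0 i)]).
  apply: bigsetI_measurable => i _; rewrite -[X in measurable X]setTI.
  exact: mF.
apply/seteqP; split => x /=.
  by move=> xA; rewrite -bigcap_seq => i _; exact: xA.
by rewrite -bigcap_seq => xA i; apply: (xA i); rewrite /= mem_index_enum.
Qed.

Lemma measurable_rV_coord d' (T : measurableType d') (F : T -> 'rV[R]_d) i :
  measurable_fun setT (F : T -> V) -> measurable_fun setT (fun w => F w 0 i).
Proof. by move=> mF; apply: (measurableT_comp (measurable_coord i)). Qed.

(** Boxes are stable under intersection and generate the Borel sets. *)
Lemma measure_boxes_unique (m1 m2 : {measure set V -> \bar R}) :
  (m1 setT < +oo)%E ->
  (forall A, (forall i, measurable (A i)) -> m1 (box A) = m2 (box A)) ->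
  forall B, measurable B -> m1 B = m2 B.
Proof.
move=> m1fin m12; apply: (@measure_unique _ R V
  [set B | exists2 A, (forall i, measurable (A i)) & B = box A] (fun=> setT)).
- exact: measurable_rV_boxes.
- move=> _ _ [A mA ->] [B mB ->]; exists (fun i => A i `&` B i).
    by move=> i; exact: measurableI.
  apply/seteqP; split => x /=; first by move=> [xA xB] i.
  by move=> xAB; split => i; have [] := xAB i.
- by move=> _; exists (fun=> setT) => //; apply/seteqP; split.
- by rewrite bigcup_const//; exists 0%N.
- by move=> _ [A mA ->]; exact: m12.
- by move=> _.
Qed.

Section Operations.
Context d' (T : measurableType d').
Implicit Types F G : T -> 'rV[R]_d.

Lemma measurable_rVD F G :
  measurable_fun setT (F : T -> V) -> measurable_fun setT (G : T -> V) ->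
  measurable_fun setT ((fun w => F w + G w) : T -> V).
Proof.
move=> mF mG; apply: measurable_rV => i; under eq_fun do rewrite mxE.
by apply: measurable_funD; exact: measurable_rV_coord.
Qed.

Lemma measurable_rVZ (a : T -> R) F :
  measurable_fun setT a -> measurable_fun setT (F : T -> V) ->
  measurable_fun setT ((fun w => a w *: F w) : T -> V).
Proof.
move=> ma mF; apply: measurable_rV => i; under eq_fun do rewrite mxE.
by apply: measurable_funM => //; exact: measurable_rV_coord.
Qed.

Lemma measurable_rVN F : measurable_fun setT (F : T -> V) ->
  measurable_fun setT ((fun w => - F w) : T -> V).
Proof.
move=> mF; under eq_fun do rewrite -scaleN1r.
exact: (measurable_rVZ (measurable_cst _) mF).
Qed.

Lemma measurable_rVB F G :
  measurable_fun setT (F : T -> V) -> measurable_fun setT (G : T -> V) ->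
  measurable_fun setT ((fun w => F w - G w) : T -> V).
Proof. by move=> mF mG; apply: measurable_rVD => //; exact: measurable_rVN. Qed.

Lemma measurable_dotv F G :
  measurable_fun setT (F : T -> V) -> measurable_fun setT (G : T -> V) ->
  measurable_fun setT (fun w => dotv (F w) (G w)).
Proof.
move=> mF mG; apply: measurable_sum => i.
by apply: measurable_funM; exact: measurable_rV_coord.
Qed.

Lemma measurable_sqn F : measurable_fun setT (F : T -> V) ->
  measurable_fun setT (fun w => sqn (F w)).
Proof. by move=> mF; exact: measurable_dotv. Qed.

End Operations.

Lemma measurable_grad f : C1 f -> measurable_fun setT (grad f : V -> V).
Proof.
move=> [_ cg]; apply: measurable_rV => i; apply: measurable_continuous => x.
apply: (@continuous_comp _ _ _ (grad f) (fun M : 'rV[R]_d => M 0 i)).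
  exact: cg.
exact: coord_continuous.
Qed.

Lemma measurable_C1 f : C1 f -> measurable_fun setT (f : V -> R).
Proof.
move=> [df _]; apply: measurable_continuous => x.
exact: differentiable_continuous.
Qed.

End BorelRV.

(** * Gaussian vectors *)

Section WeightedMeasure.
Context d (T : measurableType d) (R : realType) (P : {measure set T -> \bar R}).
Context (w : T -> R) (mw : measurable_fun setT w) (w0 : forall x, 0 <= w x).
Context (wfin : (\int[P]_x (w x)%:E < +oo)%E).

(** The hypotheses on the density are arguments of the measure, so that its
    finiteness can be inferred from them. *)
Definition weighted (mw : measurable_fun setT w) (w0 : forall x, 0 <= w x)
  (wfin : (\int[P]_x (w x)%:E < +oo)%E) (A : set T) : \bar R :=
  (\int[P]_(x in A) (w x)%:E)%E.

Local Notation nu := (weighted mw w0 wfin).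

Let nu0 : nu set0 = 0%E.
Proof. by rewrite /weighted integral_set0. Qed.

Let nu_ge0 A : (0 <= nu A)%E.
Proof. by apply: integral_ge0 => x _; rewrite lee_fin. Qed.

Let nu_sigma_additive : semi_sigma_additive nu.
Proof.
move=> F mF tF mUF; rewrite /weighted ge0_integral_bigcup//; last first.
- by move=> x _; rewrite lee_fin.
- by apply: measurable_funTS; exact/measurable_EFinP.
apply: is_cvg_ereal_nneg_natsum_cond => n _ _.
by apply: integral_ge0 => x _; rewrite lee_fin.
Qed.

HB.instance Definition _ := isMeasure.Build _ _ _ nu nu0 nu_ge0 nu_sigma_additive.

Let nu_fin : fin_num_fun nu.
Proof.
apply: lty_fin_num_fun; exact: wfin.
Qed.

HB.instance Definition _ := Measure_isFinite.Build _ _ _ nu nu_fin.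

End WeightedMeasure.

Section ProductFormula.
Context dO (O : measurableType dO) (R : realType) (P : probability O R) (d : nat).
Context (xi : O -> 'rV[R]_d) (xiG : gaussian_vector P xi).
Local Notation N := (normal_prob 0 (Num.sqrt (d%:R^-1 : R))).

Let mxi : measurable_fun setT (xi : O -> borel_rV R d). Proof. by case: xiG. Qed.

Lemma gaussian_coord_measurable i : measurable_fun setT (fun w => xi w 0 i).
Proof. exact: measurable_rV_coord. Qed.

Lemma gaussian_coord_law i A : measurable A ->
  P ((fun w => xi w 0 i) @^-1` A) = N A.
Proof.
move=> mA; have [_ /(_ (fun j => if j == i then A else setT))] := xiG.
rewrite (bigD1 i)//= eqxx big1 ?mule1; last first.
  by move=> j /negPf ->; rewrite probability_setT.
move=> <-; last by move=> j; case: ifP.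
congr (P _); apply/seteqP; split => w /=; last by move=> /(_ i); rewrite eqxx.
by move=> Aw j; case: eqP => // ->.
Qed.

(** Independence of the coordinates, upgraded from sets to functions: the
    remaining factors serve as a density against which one coordinate is
    integrated. *)
Lemma gaussian_product (h : 'I_d -> R -> R) (m : 'I_d -> R) :
  (forall i, measurable_fun setT (h i)) -> (forall i x, 0 <= h i x) ->
  (forall i, (\int[N]_x (h i x)%:E = (m i)%:E)%E) ->
  (\int[P]_w (\prod_i h i (xi w 0 i))%:E = (\prod_i m i)%:E)%E.
Proof.
(* Indicators are replaced by general functions one coordinate at a time. *)
suff ind k : forall (h : 'I_d -> R -> R) (m : 'I_d -> R),
    (forall i, measurable_fun setT (h i)) -> (forall i x, 0 <= h i x) ->
    (forall i, (\int[N]_x (h i x)%:E = (m i)%:E)%E) ->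
    (forall i : 'I_d, (k <= i)%N -> exists2 A, measurable A & h i = \1_A) ->
    (\int[P]_w (\prod_i h i (xi w 0 i))%:E = (\prod_i m i)%:E)%E.
  move=> mh h0 hm; apply: (ind d) => // i; by rewrite leqNgt ltn_ord.
elim: k => [|k IH] {}h {}m mh h0 hm hind.
  have /choice[A AP] : forall i, exists A, measurable A /\ h i = \1_A.
    by move=> i; have [A] := hind i isT; exists A.
  have mbox : measurable ((xi : O -> borel_rV R d) @^-1` (box A)).
    rewrite -[X in measurable X]setTI.
    by apply: (mxi measurableT (measurable_box _)) => i; have [] := AP i.
  transitivity (P (xi @^-1` (box A))).
    rewrite -[X in _ = P X]setIT -integral_indic//.
    apply: eq_integral => w _; congr EFin; rewrite indicE.
    have [/set_mem Aw|] := boolP (w \in _).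
      by rewrite big1// => i _; have [_ ->] := AP i; rewrite indicE mem_set//; exact: Aw.
    move=> /negP nAw; have /existsNP[i Ai] : ~ forall i, A i (xi w 0 i).
      by move=> Aw; apply: nAw; exact: mem_set.
    rewrite (bigD1 i)//=; have [_ ->] := AP i.
    by rewrite indicE memNset// mul0r.
  have [_ ->] := xiG; last by move=> i; have [] := AP i.
  rewrite (eq_bigr (fun i => (m i)%:E)) ?prodEFin// => i _.
  by rewrite -hm; have [mA ->] := AP i; rewrite integral_indic// setIT.
have [kd|kd] := ltnP k d; last first.
  by apply: IH => // i ki; have := ltn_ord i; rewrite ltnNge (leq_trans kd ki).
pose j := Ordinal kd.
pose g w := \prod_(i | i != j) h i (xi w 0 i).
pose c := \prod_(i | i != j) m i.
have step B : measurable B ->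
    (\int[P]_w (\1_B (xi w 0 j) * g w)%:E = N B * c%:E)%E.
  move=> mB; pose h' i := if i == j then \1_B else h i.
  pose m' i := if i == j then fine (N B) else m i.
  have h'j : h' j = \1_B by rewrite /h' eqxx.
  have m'j : m' j = fine (N B) by rewrite /m' eqxx.
  have NB : N B = (fine (N B))%:E by rewrite fineK// fin_num_measure.
  have /= := IH h' m'; rewrite (bigD1 j)//= m'j.
  rewrite (eq_bigr m); last by move=> i /negPf ij; rewrite /m' ij.
  rewrite -/c EFinM -NB => <-.
  - apply: eq_integral => w _; rewrite (bigD1 j)//= h'j.
    by congr (_ * _)%:E; apply: eq_bigr => i /negPf ij; rewrite /h' ij.
  - by move=> i; rewrite /h'; case: ifP => // _; exact: measurable_indic.
  - by move=> i x; rewrite /h'; case: ifP.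
  - by move=> i; rewrite /h' /m'; case: ifP => // _; rewrite integral_indic// setIT.
  - move=> i ki; rewrite /h'; have [_|ij] := eqVneq i j; first by exists B.
    apply: hind; rewrite ltn_neqAle ki andbT eq_sym.
    by apply: contra_neq ij => ik; exact/val_inj.
have mg : measurable_fun setT g.
  rewrite /g; under eq_fun do rewrite big_mkcond/=.
  apply: measurable_prod => i _; have [_|_] := boolP (i != j) => //.
  by apply: (measurableT_comp (mh i)); exact: gaussian_coord_measurable.
have g0 w : 0 <= g w by apply: prodr_ge0 => i _.
have m0 i : 0 <= m i.
  by rewrite -lee_fin -hm; apply: integral_ge0 => x _; rewrite lee_fin.
have c0 : 0 <= c by apply: prodr_ge0 => i _.
have gfin : (\int[P]_w (g w)%:E < +oo)%E.
  have := step setT measurableT; rewrite probability_setT mul1e.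
  under eq_integral do rewrite indicT mul1r.
  by move=> ->; exact: ltry.
pose nu : {finite_measure set O -> \bar R} := weighted mg g0 gfin.
have mj := gaussian_coord_measurable j.
have mj' : measurable_fun setT ((fun w => xi w 0 j) : O -> measurableTypeR R).
  exact: mj.
transitivity (\int[image_measure nu mj']_x (h j x)%:E)%E.
  rewrite ge0_integral_image//; last 2 first.
  - apply/measurable_EFinP; exact: (mh j).
  - by move=> x; rewrite lee_fin.
  rewrite (@ge0_integral_density _ _ _ nu P g)//; last first.
  - by move=> w; rewrite lee_fin.
  - by apply/measurable_EFinP; apply: (measurableT_comp (mh j)).
  by apply: eq_integral => w _; rewrite (bigD1 j).
rewrite (@eq_measure_integral _ _ _ setT (mscale (NngNum c0) N)).
  rewrite ge0_integral_mscale//; last by move=> x _; rewrite lee_fin.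
    by rewrite hm [in RHS](bigD1 j)//= EFinM muleC.
  apply/measurable_EFinP; exact: (mh j).
move=> B mB _; rewrite image_measureE /= /weighted integral_mkcond.
transitivity (N B * c%:E)%E; last by rewrite /mscale/= muleC.
rewrite -step//; apply: eq_integral => w _; rewrite patchE indicE.
rewrite (_ : (w \in _) = (xi w 0 j \in B)); last first.
  by apply/idP/idP => /set_mem Bw; exact/mem_set.
by case: (_ \in B); rewrite ?mul1r ?mul0r.
Qed.

End ProductFormula.

(** * The law of an affine image of a Gaussian vector *)

Section AffineDensity1.
Context (R : realType).

Lemma affine_density_int1 (s t a : R) : 0 < s -> 0 < t ->
  (\int[normal_prob 0 s]_x (affine_density s t a x)%:E = 1)%E.
Proof.
move=> s0 t0; have := @normal_affine R s t a (fun=> 1%E) s0 t0.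
rewrite integral_cst//= probability_setT mule1 => ->//.
by under [RHS]eq_integral do rewrite mul1e.
Qed.

Lemma affine_density_int2 (s t a : R) : 0 < s -> 0 < t -> t ^+ 2 < 2 ->
  (\int[normal_prob 0 s]_x (affine_density s t a x ^+ 2)%:E =
   ((Num.sqrt (1 - (t ^+ 2 - 1) ^+ 2))^-1 *
     expR (a ^+ 2 / (s ^+ 2 * (2 - t ^+ 2))))%:E)%E.
Proof.
move=> s0 t0 t2.
have sn0 : s != 0 by rewrite gt_eqF.
have tn0 : t != 0 by rewrite gt_eqF.
have t20 : 2 - t ^+ 2 != 0 by rewrite gt_eqF// subr_gt0.
pose p := 2 * a / (t ^+ 2 * s ^+ 2).
pose b := s ^- 2 - (t ^+ 2 * s ^+ 2)^-1.
pose c := t ^- 2 * expR (- (a ^+ 2 / (t ^+ 2 * s ^+ 2))).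
have kE : 1 - 2 * b * s ^+ 2 = (2 - t ^+ 2) / t ^+ 2.
  by rewrite /b; field; rewrite sn0 tn0.
have k0 : 0 < 1 - 2 * b * s ^+ 2 by rewrite kE divr_gt0 ?exprn_gt0// subr_gt0.
transitivity (c%:E * \int[normal_prob 0 s]_x (expR (p * x + b * x ^+ 2))%:E)%E.
  rewrite -ge0_integralZl//.
  - apply: eq_integral => x _; rewrite -EFinM; congr EFin; rewrite /affine_density exprMn /c -[RHS]mulrA -expRD.
    rewrite exprVn; congr (_ * _); rewrite -expRM_natl; congr expR.
    by rewrite /p /b; field; rewrite sn0 tn0.
  - by apply/measurable_EFinP; exact: measurable_expquad.
  - by rewrite lee_fin mulr_ge0 ?expR_ge0// invr_ge0 exprn_ge0// ltW.
rewrite normal_expquad// kE -EFinM; congr EFin.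
rewrite /c mulrACA -expRD; congr (_ * expR _); last first.
  by rewrite /p; field; rewrite sn0 tn0 t20.
have t2p : 0 < 2 - t ^+ 2 by rewrite subr_gt0.
have -> : 1 - (t ^+ 2 - 1) ^+ 2 = (t ^+ 2) ^+ 2 * ((2 - t ^+ 2) / t ^+ 2).
  by field.
by rewrite [in RHS]sqrtrM ?sqr_ge0// sqrtr_sqr ger0_norm ?sqr_ge0// [RHS]invfM.
Qed.

End AffineDensity1.

Section GaussianVectors.
Context dO (O : measurableType dO) (R : realType) (P : probability O R) (d : nat).
Context (d0 : (0 < d)%N).
Context (xi : O -> 'rV[R]_d) (xiG : gaussian_vector P xi).
Local Notation V := (borel_rV R d).
Local Notation s := (Num.sqrt (d%:R^-1 : R)).
Local Notation N := (normal_prob 0 s).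

Let mxi : measurable_fun setT (xi : O -> V). Proof. by case: xiG. Qed.

Let dR : 0 < d%:R :> R. Proof. by rewrite ltr0n. Qed.

Let s0 : 0 < s. Proof. by rewrite sqrtr_gt0 invr_gt0. Qed.

Let s2 : s ^+ 2 = d%:R^-1. Proof. by rewrite sqr_sqrtr// invr_ge0 ltW. Qed.

(** The density of the law of [t xi + a] with respect to the law of [xi]. *)
Definition affine_weight (t : R) (a x : 'rV[R]_d) : R :=
  \prod_i affine_density s t (a 0 i) (x 0 i).

Lemma affine_weight_ge0 t a x : 0 < t -> 0 <= affine_weight t a x.
Proof. by move=> t0; apply: prodr_ge0 => i _; exact: affine_density_ge0. Qed.

Lemma measurable_affine_weight t a :
  measurable_fun setT (fun w => affine_weight t a (xi w)).
Proof.
rewrite /affine_weight; apply: measurable_prod => i _.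
apply: (measurableT_comp (measurable_affine_density s t (a 0 i))).
exact: (gaussian_coord_measurable xiG).
Qed.

Lemma affine_weight_int1 t a : 0 < t ->
  (\int[P]_w (affine_weight t a (xi w))%:E = 1)%E.
Proof.
move=> t0; rewrite (gaussian_product xiG (h := fun i => affine_density s t (a 0 i)) (m := fun=> 1)).
- by rewrite big1.
- by move=> i; exact: measurable_affine_density.
- by move=> i x; exact: affine_density_ge0.
- by move=> i; exact: affine_density_int1.
Qed.

(** The law of the affine image and the weighted law of [xi] agree on boxes,
    where both factor over the coordinates. *)
Lemma affine_weight_change (t : R) (a : 'rV[R]_d) (g : 'rV[R]_d -> \bar R) : 0 < t ->
  measurable_fun setT (g : V -> \bar R) -> (forall x, 0 <= g x)%E ->
  (\int[P]_w g (t *: xi w + a)%R =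
   \int[P]_w (g (xi w) * (affine_weight t a (xi w))%:E))%E.
Proof.
move=> t0 mg g0.
have mT : measurable_fun setT ((fun w => t *: xi w + a) : O -> V).
  by apply: measurable_rVD => //; exact: measurable_rVZ.
have mW := measurable_affine_weight t a.
have W0 w : 0 <= affine_weight t a (xi w) by exact: affine_weight_ge0.
have Wfin : (\int[P]_w (affine_weight t a (xi w))%:E < +oo)%E.
  by rewrite affine_weight_int1// ltry.
pose nu : {finite_measure set O -> \bar R} := weighted mW W0 Wfin.
rewrite -(ge0_integral_image P mT mg g0).
transitivity (\int[image_measure nu mxi]_y g y)%E; last first.
  rewrite ge0_integral_image// (@ge0_integral_density _ _ _ nu P _ _ mW)//.
  exact: (measurableT_comp mg).
apply: eq_measure_integral => B mB _.
apply: measure_boxes_unique mB.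
  by rewrite image_measureE preimage_setT -[ltLHS]/(P setT) probability_setT ltry.
move=> A mA; rewrite !image_measureE.
pose m i := fine (N ((fun x => t * x + a 0 i) @^-1` (A i))).
have mF i : measurable_fun setT (fun x : R => t * x + a 0 i).
  by apply: measurable_funD => //; exact: measurable_funM.
have mFA i : measurable ((fun x : R => t * x + a 0 i) @^-1` (A i)).
  by rewrite -[X in measurable X]setTI; exact: mF.
have NE i : N ((fun x => t * x + a 0 i) @^-1` (A i)) = (m i)%:E.
  by rewrite fineK//; apply: fin_num_measure; exact: mFA.
transitivity (\prod_i (m i))%:E; last first.
  rewrite -(gaussian_product xiG
    (h := fun i x => \1_(A i) x * affine_density s t (a 0 i) x)).
  - rewrite /nu/= /weighted [RHS]integral_mkcond; apply: eq_integral => w _.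
    rewrite patchE; case: ifPn => [/set_mem Aw|/negP nA].
      by congr EFin; apply: eq_bigr => i _; rewrite indicE mem_set ?mul1r.
    have /existsNP[i Ai] : ~ forall i, A i (xi w 0 i).
      by move=> Aw; apply: nA; exact: mem_set.
    by rewrite (bigD1 i)//= indicE memNset// !mul0r.
  - move=> i; apply: measurable_funM; first exact: measurable_indic.
    exact: measurable_affine_density.
  - by move=> i x; rewrite mulr_ge0// affine_density_ge0.
  - move=> i; rewrite -NE.
    transitivity (\int[N]_x ((\1_(A i) x)%:E * (affine_density s t (a 0 i) x)%:E))%E.
      by apply: eq_integral => x _; rewrite EFinM.
    rewrite -(@normal_affine R s t (a 0 i) (fun x => (\1_(A i) x)%:E))//; last first.
      by apply/measurable_EFinP; exact: measurable_indic.
    by rewrite -[X in _ = N X]setIT -integral_indic//; exact: mFA.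
have [_] := xiG => /(_ (fun i => (fun x => t * x + a 0 i) @^-1` (A i)) mFA).
rewrite (eq_bigr (fun i => (m i)%:E)) ?prodEFin// => <-.
by congr (P _); apply/seteqP; split => w /= Aw i; have := Aw i; rewrite !mxE.
Qed.

(** The chi-square divergence between the laws of [t xi + a] and of [xi], which
    for [t] close to 1 measures the Fisher information of the dilation. *)
Lemma affine_weight_chi2 t a : 0 < t -> t ^+ 2 < 2 ->
  rint P (fun w => (affine_weight t a (xi w) - 1) ^+ 2) /\
  Ex P (fun w => (affine_weight t a (xi w) - 1) ^+ 2) =
  \prod_(i < d) ((Num.sqrt (1 - (t ^+ 2 - 1) ^+ 2))^-1 *
     expR (d%:R * a 0 i ^+ 2 / (2 - t ^+ 2))) - 1.
Proof.
move=> t0 t2; set C := \prod_i _.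
have mW := measurable_affine_weight t a.
have W0 w : 0 <= affine_weight t a (xi w) by exact: affine_weight_ge0.
have W1 := affine_weight_int1 a t0.
have [rW _] : rint P (fun w => affine_weight t a (xi w)) /\
    Ex P (fun w => affine_weight t a (xi w)) <= 1.
  by apply: rint_ge0 => //; rewrite W1.
have EW : Ex P (fun w => affine_weight t a (xi w)) = 1.
  by move: W1; rewrite EFin_Ex// => -[].
have W2 : (\int[P]_w (affine_weight t a (xi w) ^+ 2)%:E = C%:E)%E.
  under eq_integral do rewrite -prodrXl.
  rewrite (gaussian_product xiG (h := fun i x => affine_density s t (a 0 i) x ^+ 2)
    (m := fun i => (Num.sqrt (1 - (t ^+ 2 - 1) ^+ 2))^-1 *
     expR (d%:R * a 0 i ^+ 2 / (2 - t ^+ 2))))//.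
  - move=> i; apply: measurable_funX; exact: measurable_affine_density.
  - by move=> i x; rewrite sqr_ge0.
  - move=> i; rewrite affine_density_int2//; congr (_ * expR _)%:E.
    by rewrite s2 invfM invrK mulrCA mulrA.
have [rW2 _] : rint P (fun w => affine_weight t a (xi w) ^+ 2) /\
    Ex P (fun w => affine_weight t a (xi w) ^+ 2) <= C.
  apply: rint_ge0; [exact: measurable_funX|by move=> w; rewrite sqr_ge0|].
  by rewrite W2.
have EW2 : Ex P (fun w => affine_weight t a (xi w) ^+ 2) = C.
  by move: W2; rewrite EFin_Ex// => -[].
have sqE w : affine_weight t a (xi w) ^+ 2 - 2 * affine_weight t a (xi w) + 1 =
  (affine_weight t a (xi w) - 1) ^+ 2 by ring.
have rA : rint P (fun w => affine_weight t a (xi w) ^+ 2 - 2 * affine_weight t a (xi w)).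
  by apply: rintB => //; exact: rintZ.
split.
  under [X in rint _ X]funext => w do rewrite -sqE.
  by apply: rintD => //; exact: rint_cst.
under [X in Ex _ X]funext => w do rewrite -sqE.
rewrite ExD ?Ex_cst//; last exact: rint_cst.
rewrite ExB//; last exact: rintZ.
by rewrite ExZ// EW2 EW; ring.
Qed.

End GaussianVectors.

(** * Small dilations and moments of a shifted Gaussian vector *)

Section ChiSquareBound.
Context (R : realType).

Lemma inv_sqrt_le_exp (y : R) : 0 <= y -> y < 1 ->
  (Num.sqrt (1 - y))^-1 <= expR (y / (2 * (1 - y))).
Proof.
move=> y0 y1; have k0 : 0 < 1 - y by rewrite subr_gt0.
rewrite -[leRHS]ger0_norm ?expR_ge0// -sqrtr_sqr -(sqrtrV (ltW k0)).
rewrite ler_sqrt ?sqr_ge0// -expRM_natl.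
apply: le_trans (expR_ge1Dx _).
by rewrite le_eqVlt; apply/orP; left; apply/eqP; field; rewrite gt_eqF.
Qed.

(** Second-order expansion, at [t = 1 + e], of the divergence computed in
    [affine_weight_chi2] for a shift of size proportional to [e]. The leading
    coefficient [D (2 + rho)] is the Fisher information of the dilation. *)
Lemma chi2_expansion (D rho e : R) (y := ((1 + e) ^+ 2 - 1) ^+ 2)
    (I := D * (2 + rho)) : 0 <= D -> 0 <= rho -> 0 < e -> e <= 4^-1 ->
  D * (y / (2 * (1 - y))) + D * (e ^+ 2 * rho) / (2 - (1 + e) ^+ 2) <=
    e ^+ 2 * (I * (1 + 6 * e)).
Proof.
move=> D0 rho0 e0 e4.
have e2 : e ^+ 2 <= e / 4 by rewrite expr2 mulrC ler_wpM2l// ltW.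
have e3 : e ^+ 3 <= e / 16.
  have : e ^+ 3 <= e ^+ 2 / 4 by rewrite exprSr ler_wpM2l// sqr_ge0.
  lra.
have ye : y = e ^+ 2 * (2 + e) ^+ 2 by rewrite /y; ring.
have yb : y <= 81 / 64 * e.
  have : (2 + e) ^+ 2 <= 81 / 16 by nra.
  rewrite ye => h; have := ler_wpM2l (sqr_ge0 e) h; lra.
have y1 : 0 < 1 - y by lra.
have z1 : 0 < 2 - (1 + e) ^+ 2 by nra.
have h1 : y / (2 * (1 - y)) <= e ^+ 2 * (2 * (1 + 6 * e)).
  rewrite ye -mulrA ler_wpM2l ?sqr_ge0// -ye ler_pdivrMr; last lra.
  nra.
have h2 : (2 - (1 + e) ^+ 2)^-1 <= 1 + 6 * e.
  rewrite -div1r ler_pdivrMr//; nra.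
have e20 := sqr_ge0 e.
have := ler_wpM2l D0 h1.
have := ler_wpM2l (mulr_ge0 D0 (mulr_ge0 e20 rho0)) h2.
rewrite /I; lra.
Qed.

(** The divergence is an exponential minus one; its linear term carries the
    leading coefficient [I] over, and the rest is of higher order in [e]. *)
Lemma exp_expansion (I e : R) (x := e ^+ 2 * (I * (1 + 6 * e)))
    (K := expR (3 * I)) : 0 <= I -> 0 < e -> e <= 4^-1 ->
  expR x - 1 <= e ^+ 2 * (I + 9 * I * (1 + I * K) * e).
Proof.
move=> I0 e0 e4.
have K0 : 0 < K := expR_gt0 _.
have x0 : 0 <= x by rewrite !mulr_ge0// ?sqr_ge0; lra.
have xI : x <= 3 * I * e.
  have : e ^+ 2 * (1 + 6 * e) <= 3 * e by nra.
  by move=> /(ler_wpM2l I0); rewrite /x; lra.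
have xI' : x <= 3 * I by apply: (le_trans xI); nra.
have eK : expR x <= 1 + 3 * I * e * K.
  have xK : expR x <= K by rewrite ler_expR.
  have := expR_sub1_le x; have := expR_ge0 x; nra.
apply: (le_trans (expR_sub1_le x)); rewrite /x -mulrA ler_wpM2l ?sqr_ge0// -/x.
apply: (@le_trans _ _ (I * (1 + 6 * e) * (1 + 3 * I * e * K))).
  by rewrite ler_wpM2l// mulr_ge0//; lra.
have IK : 0 <= I * K by rewrite mulr_ge0// ltW.
have IKe : 0 <= I * K * e by rewrite mulr_ge0// ltW.
have : (1 + 6 * e) * (1 + 3 * I * e * K) <= 1 + 9 * (1 + I * K) * e by nra.
by move=> /(ler_wpM2l I0); lra.
Qed.

End ChiSquareBound.

Section DominatedConvergence.
Context d (T : measurableType d) (R : realType) (P : probability T R).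

Lemma Ex_dominated (F : nat -> T -> R) (G B : T -> R) :
  (forall n, measurable_fun setT (F n)) -> measurable_fun setT G ->
  (forall w, F n w @[n --> \oo] --> G w) ->
  (forall n w, `|F n w| <= B w) -> rint P B ->
  rint P G /\ Ex P (F n) @[n --> \oo] --> Ex P G.
Proof.
move=> mF mG FG FB rB.
have [|||||rG _ cvg] := @dominated_convergence _ T R P setT measurableT
  (fun n => EFin \o F n) (EFin \o G) (EFin \o B).
- by move=> n; exact/measurable_EFinP.
- exact/measurable_EFinP.
- by apply: aeW => w _; apply: cvg_EFin; [exact: nearW|exact: FG].
- exact: rB.
- by apply: aeW => w n _ /=; rewrite lee_fin.
split; first exact: rG.
apply: fine_cvg; rewrite -EFin_Ex//.
Qed.

End DominatedConvergence.

Section GaussianNorms.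
Context dO (O : measurableType dO) (R : realType) (P : probability O R) (d : nat).
Context (d0 : (0 < d)%N).
Context (xi : O -> 'rV[R]_d) (xiG : gaussian_vector P xi).
Local Notation s := (Num.sqrt (d%:R^-1 : R)).
Local Notation V := (borel_rV R d).

Let dR : 0 < d%:R :> R. Proof. by rewrite ltr0n. Qed.
Let s0 : 0 < s. Proof. by rewrite sqrtr_gt0 invr_gt0. Qed.
Let s2 : s ^+ 2 = d%:R^-1. Proof. by rewrite sqr_sqrtr// invr_ge0 ltW. Qed.
Let mxi : measurable_fun setT (xi : O -> V). Proof. by case: xiG. Qed.
Let mi := gaussian_coord_measurable xiG.
Let li := gaussian_coord_law xiG.

Lemma gaussian_dotv_mean U : rint P (fun w => dotv (xi w) U) /\
  Ex P (fun w => dotv (xi w) U) = 0.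
Proof.
have r i : rint P (fun w => xi w 0 i * U 0 i) /\ Ex P (fun w => xi w 0 i * U 0 i) = 0.
  have [r1 e1] := gaussian_mean0 s0 (mi i) (li i).
  under [X in rint _ X /\ _]funext => w do rewrite mulrC.
  under [X in _ /\ Ex _ X = _]funext => w do rewrite mulrC.
  by split; [exact: rintZ|rewrite ExZ// e1 mulr0].
split; first by apply: rint_sum => i; have [] := r i.
rewrite Ex_sum => [|i]; last by have [] := r i.
by rewrite big1// => i _; have [] := r i.
Qed.

Lemma gaussian_sqn_mean : rint P (fun w => sqn (xi w)) /\
  Ex P (fun w => sqn (xi w)) <= 1.
Proof.
have r i := gaussian_moment2 s0 (mi i) (li i).
under [X in rint _ X /\ _]funext => w do rewrite sqnE.
under [X in _ /\ Ex _ X <= _]funext => w do rewrite sqnE.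
split; first by apply: rint_sum => i; have [] := r i.
rewrite Ex_sum => [|i]; last by have [] := r i.
apply: (@le_trans _ _ (\sum_(i < d) d%:R^-1)).
  by apply: ler_sum => i _; rewrite -s2; have [] := r i.
by rewrite sumr_const card_ord -(mulr_natr d%:R^-1) mulVf// gt_eqF.
Qed.

(** Cauchy-Schwarz over the coordinates reduces the squared norm to fourth
    moments of the coordinates. *)
Lemma gaussian_sqn2_mean : rint P (fun w => sqn (xi w) ^+ 2) /\
  Ex P (fun w => sqn (xi w) ^+ 2) <= 3.
Proof.
have r i := gaussian_moment4 s0 (mi i) (li i).
pose S w := d%:R * \sum_(i < d) xi w 0 i ^+ 4.
have rS : rint P S by apply: rintZ; apply: rint_sum => i; have [] := r i.
have bnd w : sqn (xi w) ^+ 2 <= S w.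
  pose p : 'rV[R]_d := \row_i (xi w 0 i ^+ 2); pose q : 'rV[R]_d := const_mx 1.
  have := cauchy_schwarz p q.
  rewrite (_ : dotv p q = sqn (xi w)); last first.
    by rewrite sqnE; apply: eq_bigr => i _; rewrite !mxE mulr1.
  rewrite (_ : sqn q = d%:R); last first.
    rewrite sqnE (eq_bigr (fun=> 1)) ?sumr_const ?card_ord// => i _.
    by rewrite mxE expr1n.
  rewrite mulrC (sqnE p) /S => /le_trans; apply.
  by rewrite ler_wpM2l// le_eqVlt; apply/orP; left; apply/eqP;
    apply: eq_bigr => i _; rewrite mxE -exprM.
have mS : measurable_fun setT (fun w => sqn (xi w) ^+ 2).
  by apply: measurable_funX; exact: measurable_sqn.
have r2 : rint P (fun w => sqn (xi w) ^+ 2).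
  by apply: rint_le rS => // w; rewrite ger0_norm ?sqr_ge0.
split => //; apply: (le_trans (Ex_le r2 rS bnd)).
rewrite ExZ; last by apply: rint_sum => i; have [] := r i.
rewrite Ex_sum => [|i]; last by have [] := r i.
apply: (@le_trans _ _ (d%:R * \sum_(i < d) (3 * d%:R^-1 ^+ 2))).
  rewrite ler_wpM2l//; apply: ler_sum => i _.
  by rewrite -s2 -(exprM s 2 2); have [] := r i.
rewrite sumr_const card_ord -(mulr_natr (3 * _)).
by rewrite le_eqVlt; apply/orP; left; apply/eqP; field; rewrite gt_eqF.
Qed.

Section Shifted.
Context (U : 'rV[R]_d) (sigma : R).
Local Notation X := (fun w => U - sigma *: xi w).
Local Notation m := (sqn U).

Lemma measurable_shifted : measurable_fun setT (X : O -> V).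
Proof.
apply: measurable_rVB; first exact: measurable_cst.
exact: (measurable_rVZ (measurable_cst _) mxi).
Qed.

Lemma shifted_moment2 : rint P (fun w => sqn (X w)) /\
  Ex P (fun w => sqn (X w)) <= m + sigma ^+ 2.
Proof.
have [rU eU] := gaussian_dotv_mean U; have [r2 e2] := gaussian_sqn_mean.
have rA : rint P (fun w => m - 2 * sigma * dotv (xi w) U).
  by apply: rintB; [exact: rint_cst|exact: rintZ].
under [X in rint _ X /\ _]funext => w do rewrite sqnBZ.
under [X in _ /\ Ex _ X <= _]funext => w do rewrite sqnBZ.
split; first by apply: rintD => //; exact: rintZ.
rewrite ExD//; last exact: rintZ.
rewrite ExB; [|exact: rint_cst|exact: rintZ].
rewrite Ex_cst !ExZ// eU mulr0 subr0 lerD2l.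
by rewrite ler_piMr// sqr_ge0.
Qed.

(** The terms of odd degree in [xi] are absorbed by Cauchy-Schwarz, except the
    linear one, which has mean zero; this keeps the constant 4. *)
Lemma shifted_moment4 : rint P (fun w => sqn (X w) ^+ 2) /\
  Ex P (fun w => sqn (X w) ^+ 2) <= (m + 4 * sigma ^+ 2) ^+ 2.
Proof.
have [rU eU] := gaussian_dotv_mean U; have [r2 e2] := gaussian_sqn_mean.
have [r4 e4] := gaussian_sqn2_mean.
pose B w := m ^+ 2 + 8 * m * sigma ^+ 2 * sqn (xi w) +
  3 * sigma ^+ 4 * sqn (xi w) ^+ 2 - 4 * m * sigma * dotv (xi w) U.
have bnd w : sqn (X w) ^+ 2 <= B w.
  rewrite sqnBZ /B; have := cauchy_schwarz (xi w) U.
  set x := dotv _ _; set n := sqn (xi w) => h.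
  have : 0 <= 2 * sigma ^+ 2 * (x + sigma * n) ^+ 2.
    by rewrite mulr_ge0 ?sqr_ge0// mulr_ge0 ?sqr_ge0.
  have := ler_wpM2l (sqr_ge0 sigma) h; nra.
have m0 : 0 <= m := sqn_ge0 U.
have rB1 : rint P (fun w => m ^+ 2 + 8 * m * sigma ^+ 2 * sqn (xi w)).
  by apply: rintD; [exact: rint_cst|exact: rintZ].
have rB2 : rint P (fun w => m ^+ 2 + 8 * m * sigma ^+ 2 * sqn (xi w) +
    3 * sigma ^+ 4 * sqn (xi w) ^+ 2).
  by apply: rintD => //; exact: rintZ.
have rB : rint P B by apply: rintB => //; exact: rintZ.
have rX : rint P (fun w => sqn (X w) ^+ 2).
  apply: rint_le rB => [|w]; last by rewrite ger0_norm ?sqr_ge0.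
  by apply: measurable_funX; apply: measurable_sqn; exact: measurable_shifted.
split => //; apply: (le_trans (Ex_le rX rB bnd)).
rewrite /B ExB//; last exact: rintZ.
rewrite ExD//; last exact: rintZ.
rewrite ExD; [|exact: rint_cst|exact: rintZ].
rewrite Ex_cst !ExZ// eU mulr0 subr0.
have s20 := sqr_ge0 sigma.
have := ler_wpM2l (mulr_ge0 m0 s20) e2.
have := ler_wpM2l (mulr_ge0 s20 s20) e4.
have := mulr_ge0 s20 s20; nra.
Qed.

End Shifted.
End GaussianNorms.

(** * Gaussian smoothing of the gradient *)

Section SequentialDerivative.
Context (R : realType).

(** The dilation parameters run through [1 / (n + 4)], so that they tend to 0
    and stay below 1/4, where the expansions of the divergence hold. *)
Lemma dilation_cvg0 : (n.+4%:R^-1 : R) @[n --> \oo] --> (0 : R).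
Proof.
have := @cvg_harmonic R; rewrite -(cvg_shiftn 3) => h.
apply: cvg_trans h; apply: near_eq_cvg; apply: nearW => n /=.
by rewrite /harmonic/= addn3.
Qed.

Lemma is_derive_seq (phi : R -> R) (x l : R) :
  is_derive x (1 : R) phi l ->
  (phi (x + n.+4%:R^-1) - phi x) / n.+4%:R^-1 @[n --> \oo] --> l.
Proof.
move=> [dphi <-].
have e0 : (n.+4%:R^-1 : R) @[n --> \oo] --> (0 : R)^'.
  move=> A; rewrite /dnbhs/= /within/= => A0.
  have h : \forall n \near \oo, (n.+4%:R^-1 != 0 :> R -> A n.+4%:R^-1) :=
    dilation_cvg0 A0.
  change (\forall n \near \oo, A (n.+4%:R^-1 : R)).
  by apply: filterS h => n; apply; rewrite invr_eq0 pnatr_eq0.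
have := cvg_comp _ _ e0 dphi; apply: cvg_trans; apply: near_eq_cvg.
apply: nearW => n /=; rewrite /GRing.scale/= mulr1 mulrC (addrC _ (- _)).
by rewrite (addrC (- _)) (addrC _ x).
Qed.

End SequentialDerivative.

Section Smoothing.
Context dO (O : measurableType dO) (R : realType) (P : probability O R) (d : nat).
Context (d0 : (0 < d)%N).
Context (xi : O -> 'rV[R]_d) (xiG : gaussian_vector P xi).
Local Notation s := (Num.sqrt (d%:R^-1 : R)).
Local Notation V := (borel_rV R d).

Let mxi : measurable_fun setT (xi : O -> V). Proof. by case: xiG. Qed.

Lemma affine_weight_change_Ex (t : R) (a : 'rV[R]_d) (q : 'rV[R]_d -> R) : 0 < t ->
  measurable_fun setT (q : V -> R) -> (forall x, 0 <= q x) ->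
  rint P (fun w => q (t *: xi w + a)) ->
  let W := fun w => q (xi w) * affine_weight t a (xi w) in
  rint P W /\ Ex P W = Ex P (fun w => q (t *: xi w + a)).
Proof.
move=> t0 mq q0 rq W.
have mW : measurable_fun setT W.
  apply: measurable_funM; first exact: (measurableT_comp mq mxi).
  exact: (measurable_affine_weight xiG).
have W0 w : 0 <= W w by rewrite mulr_ge0// affine_weight_ge0.
have WE : (\int[P]_w (W w)%:E = (Ex P (fun w => q (t *: xi w + a)))%:E)%E.
  rewrite -EFin_Ex//.
  rewrite (affine_weight_change d0 xiG a (g := fun x => (q x)%:E) t0)//.
  exact/measurable_EFinP.
have WE' : (\int[P]_w (W w)%:E <= (Ex P (fun w => q (t *: xi w + a)))%:E)%E.
  by rewrite WE.
have [rW _] := rint_ge0 mW W0 WE'.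
by split => //; move: WE; rewrite EFin_Ex// => -[].
Qed.

Context (alpha L beta : R) (f g : 'rV[R]_d -> R) (xs : 'rV[R]_d).
Context (alpha0 : 0 <= alpha) (L0 : 0 <= L) (beta0 : 0 <= beta).
Context (fC1 : C1 f) (fL : forall x, sqn (grad f x) <= L ^+ 2 * sqn (x - xs)).
Context (gP : one_point_convex alpha xs (f xs) g).
Context (fg : forall x, `|f x - g x| <= beta / 2 * sqn (x - xs)).
Context (U : 'rV[R]_d) (sigma : R) (sigma0 : 0 < sigma).

Local Notation disp w := (U - sigma *: xi w).
Local Notation h v := (f (xs + v) - g (xs + v)).
Local Notation m := (sqn U).
Local Notation J := (d%:R * (2 + m / sigma ^+ 2)).

Let hb v : `|h v| <= beta / 2 * sqn v.
Proof. by have := fg (xs + v); rewrite addrAC subrr add0r. Qed.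

Let mh : measurable_fun setT ((fun v => h v) : V -> R).
Proof.
have mxs : measurable_fun setT ((fun v : V => xs + v) : V -> V).
  by apply: measurable_rVD => //; exact: measurable_cst.
apply: measurable_funB.
- exact: (measurableT_comp (measurable_C1 fC1) mxs).
- by case: gP => gC1 _ _; exact: (measurableT_comp (measurable_C1 gC1) mxs).
Qed.

Let mX : measurable_fun setT ((fun w => disp w) : O -> V).
Proof. exact: (measurable_shifted xiG). Qed.

Let J0 : 0 <= J.
Proof. by rewrite mulr_ge0// addr_ge0// divr_ge0 ?sqn_ge0// sqr_ge0. Qed.

(** Dilating the displacement about the minimizer changes the law of [xi] by an
    affine map. The growth of [h] under the dilation, which the size of [h]
    does not control pointwise, is thereby moved onto the Gaussian density: it
    becomes the mean of [h] times [affine_weight - 1], and the weighted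
    inequality of arithmetic and geometric means splits it into a fourth moment and a chi-square
    divergence, with balance [theta]. *)
Lemma dilation_error (theta : R) : 0 < theta ->
  exists2 C, 0 <= C & forall e, 0 < e -> e <= 4^-1 ->
  [/\ rint P (fun w => h ((1 + e) *: disp w)), rint P (fun w => h (disp w)) &
   - (e * (beta / 2 * (theta / 2 * Ex P (fun w => sqn (disp w) ^+ 2) +
      (J + C * e) / (2 * theta)))) <=
   Ex P (fun w => h ((1 + e) *: disp w)) - Ex P (fun w => h (disp w))].
Proof.
move=> theta0; exists (9 * J * (1 + J * expR (3 * J))).
  apply: mulr_ge0; first exact: mulr_ge0.
  by apply: addr_ge0 => //; apply: mulr_ge0 => //; exact: expR_ge0.
move=> e e0 e4; set C := 9 * _ * _.
have [r2 _] := shifted_moment2 d0 xiG U sigma.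
have [r4 _] := shifted_moment4 d0 xiG U sigma.
pose a : 'rV[R]_d := - (e / sigma) *: U.
have sn0 : sigma != 0 by rewrite gt_eqF.
have TE w : (1 + e) *: disp w = U - sigma *: ((1 + e) *: xi w + a).
  apply/rowP => i; rewrite /a !mxE; field.
  done.
have t0 : 0 < 1 + e by lra.
pose T (x : 'rV[R]_d) : 'rV[R]_d := U - sigma *: x.
have mT : measurable_fun setT (T : V -> V).
  apply: measurable_rVB; first exact: measurable_cst.
  by apply: measurable_rVZ => //; exact: measurable_cst.
pose B (v : 'rV[R]_d) : R := beta / 2 * sqn v.
have rB : rint P (fun w => B (disp w)) by exact: rintZ.
have rBt : rint P (fun w => B ((1 + e) *: disp w)).
  rewrite /B; under [X in rint _ X]funext => w do rewrite sqnZ mulrCA.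
  by apply: rintZ; exact: rB.
have mB : measurable_fun setT ((fun x => B (T x)) : V -> R).
  by apply: measurable_funM => //; apply: measurable_sqn.
have mhT : measurable_fun setT ((fun x => h (T x)) : V -> R).
  exact: (measurableT_comp mh mT).
have rh : rint P (fun w => h (disp w)).
  by apply: rint_le rB => [|w]; [exact: (measurableT_comp mh mX)|exact: hb].
have rht : rint P (fun w => h ((1 + e) *: disp w)).
  apply: rint_le rBt => [|w]; last exact: hb.
  apply: (measurableT_comp mh).
  exact: (measurable_rVZ (measurable_cst (1 + e)) mX).
split => //.
have B0 v : 0 <= B v by rewrite mulr_ge0 ?divr_ge0 ?sqn_ge0.
(* [h] has no sign: it is the difference of the nonnegative [B + h] and [B]. *)
have [] := @affine_weight_change_Ex (1 + e) a (fun x => B (T x)) t0 mB (fun x => B0 _).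
  by rewrite /T; under [X in rint _ X]funext => w do rewrite -TE.
rewrite -/(T _) => rBw; rewrite /T; under [X in _ = Ex _ X -> _]funext => w do rewrite -TE.
move=> EBw.
have BH0 v : 0 <= B v + h v by have := hb v; rewrite ler_norml /B => /andP[]; lra.
have [] := @affine_weight_change_Ex (1 + e) a (fun x => B (T x) + h (T x)) t0
  (measurable_funD mB mhT) (fun x => BH0 _).
  rewrite /T; under [X in rint _ X]funext => w do rewrite -TE.
  exact: rintD.
rewrite /T => rBHw; under [X in _ = Ex _ X -> _]funext => w do rewrite -TE.
rewrite [RHS]ExD// => EBHw.
have hwE w : (B (disp w) + h (disp w)) * affine_weight (1 + e) a (xi w) -
    B (disp w) * affine_weight (1 + e) a (xi w) = h (disp w) * affine_weight (1 + e) a (xi w).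
  by ring.
have rhw : rint P (fun w => h (disp w) * affine_weight (1 + e) a (xi w)).
  by have := rintB rBHw rBw; under [X in rint _ X]funext => w do rewrite hwE.
have Ehw : Ex P (fun w => h (disp w) * affine_weight (1 + e) a (xi w)) =
    Ex P (fun w => h ((1 + e) *: disp w)).
  have := ExB rBHw rBw; under [X in Ex _ X = _]funext => w do rewrite hwE.
  by move=> ->; rewrite EBHw EBw addrC addKr.
rewrite -Ehw -ExB//.
have t22 : (1 + e) ^+ 2 < 2 by nra.
have [rw Ew] := affine_weight_chi2 d0 xiG a t0 t22.
pose D w := e * (beta / 2) * (theta / 2 * sqn (disp w) ^+ 2) +
  (beta / 2) / (2 * theta * e) * (affine_weight (1 + e) a (xi w) - 1) ^+ 2.
have rD : rint P D by apply: rintD; apply: rintZ => //; exact: rintZ.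
have te0 : 0 < theta * e by rewrite mulr_gt0.
have chi : Ex P (fun w => (affine_weight (1 + e) a (xi w) - 1) ^+ 2) <=
    e ^+ 2 * (J + C * e).
  have rho0 : 0 <= m / sigma ^+ 2 by rewrite divr_ge0 ?sqn_ge0 ?sqr_ge0.
  apply: le_trans (exp_expansion J0 e0 e4); rewrite Ew lerD2r.
  pose y := ((1 + e) ^+ 2 - 1) ^+ 2.
  have y0 : 0 <= y by rewrite sqr_ge0.
  have y1 : y < 1.
    have : (1 + e) ^+ 2 - 1 <= 9 / 16 by nra.
    have : 0 <= (1 + e) ^+ 2 - 1 by nra.
    by rewrite /y; nra.
  apply: (@le_trans _ _ (\prod_(i < d) expR (y / (2 * (1 - y)) +
      d%:R * a 0 i ^+ 2 / (2 - (1 + e) ^+ 2)))).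
    apply: ler_prod => i _; rewrite mulr_ge0 ?expR_ge0 ?invr_ge0//=.
    by rewrite expRD ler_wpM2r ?expR_ge0// inv_sqrt_le_exp.
  rewrite -expR_sum ler_expR big_split/= sumr_const card_ord -(mulr_natl (y / _)).
  rewrite -mulr_suml -mulr_sumr -sqnE /a sqnZ sqrrN expr_div_n.
  rewrite (_ : e ^+ 2 / sigma ^+ 2 * m = e ^+ 2 * (m / sigma ^+ 2)); last by ring.
  by apply: chi2_expansion.
apply: (@le_trans _ _ (- Ex P D)).
  rewrite lerN2 ExD; [|by apply: rintZ; exact: rintZ|exact: rintZ].
  rewrite !ExZ//; last exact: rintZ.
  set E4 := Ex _ _; set E2 := Ex _ _ in chi *.
  have k0 : 0 <= beta / 2 / (2 * theta * e).
    by rewrite divr_ge0 ?divr_ge0// -mulrA mulr_ge0// ltW.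
  apply: (@le_trans _ _ (e * (beta / 2) * (theta / 2 * E4) +
      beta / 2 / (2 * theta * e) * (e ^+ 2 * (J + C * e)))).
    by rewrite lerD2l ler_wpM2l.
  rewrite le_eqVlt; apply/orP; left; apply/eqP; field.
  by rewrite !gt_eqF.
rewrite -[leLHS]mulN1r -ExZ//; apply: Ex_le; [exact: rintZ|exact: rintB|].
move=> w; rewrite mulN1r -[X in _ - X]mulr1 -mulrBr.
set W := affine_weight _ _ _ - 1.
suff : `|h (disp w) * W| <= D w by rewrite ler_norml => /andP[].
rewrite normrM; apply: (@le_trans _ _ (beta / 2 * sqn (disp w) * `|W|)).
  by rewrite ler_wpM2r.
rewrite /D -/W -(real_normK (num_real W)).
set q := sqn _; set v := `|W|.
have : 0 <= beta / 2 / (2 * theta * e) * (theta * e * q - v) ^+ 2.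
  by rewrite mulr_ge0 ?sqr_ge0// divr_ge0 ?divr_ge0// -mulrA mulr_ge0// ltW.
rewrite -subr_ge0 => h1; rewrite -subr_ge0; apply: (le_trans h1).
by rewrite subr0 le_eqVlt; apply/orP; left; apply/eqP; field; rewrite !gt_eqF.
Qed.

(** A one-sided integration by parts. The mean radial derivative of [f] is the
    limit of mean difference quotients, by domination. In each quotient [f] is
    split into the surrogate [g], whose radial growth is bounded below by
    convexity, and the rest [h], bounded by [dilation_error]. Only quotients of
    [f] pass to the limit, since the gradient of [g] has no growth bound. *)
Lemma smoothed_gradient (theta : R) : 0 < theta ->
  rint P (fun w => dotv (grad f (xs + disp w)) (disp w)) /\
  alpha * Ex P (fun w => sqn (disp w)) -
   beta / 2 * (theta / 2 * Ex P (fun w => sqn (disp w) ^+ 2) + J / (2 * theta)) <=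
  Ex P (fun w => dotv (grad f (xs + disp w)) (disp w)).
Proof.
move=> theta0; have [C C0 err] := dilation_error theta0.
have [r2 _] := shifted_moment2 d0 xiG U sigma.
have mxsX : measurable_fun setT ((fun w => xs + disp w) : O -> V).
  by apply: measurable_rVD => //; exact: measurable_cst.
have mfX : measurable_fun setT (fun w => f (xs + disp w)).
  exact: (measurableT_comp (measurable_C1 fC1) mxsX).
pose e n : R := n.+4%:R^-1.
have e0 n : 0 < e n by rewrite invr_gt0.
have e4 n : e n <= 4^-1 by rewrite lef_pV2 ?posrE// ler_nat.
pose F n w := (f (xs + (1 + e n) *: disp w) - f (xs + 1 *: disp w)) / e n.
have mF n : measurable_fun setT (F n).
  apply: measurable_funM => //; apply: measurable_funB; last first.
    by under eq_fun do rewrite scale1r.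
  apply: (measurableT_comp (measurable_C1 fC1)); apply: measurable_rVD.
    exact: measurable_cst.
  exact: (measurable_rVZ (measurable_cst (1 + e n)) mX).
have FB n w : `|F n w| <= 2 * L * sqn (disp w).
  rewrite /F normrM normfV (gtr0_norm (e0 n)) ler_pdivrMr//.
  apply: (le_trans (growth_upper _ L0 (fun x => fC1.1 x) fL ler01 _)).
    by rewrite lerDl ltW.
  rewrite expr1n mulrAC -mulrA [leRHS]mulrAC.
  rewrite (_ : 2 * L * e n * sqn (disp w) = L * sqn (disp w) * (2 * e n)); last by ring.
  rewrite (_ : L / 2 * (sqn (disp w) * _) = L * sqn (disp w) * (((1 + e n) ^+ 2 - 1) / 2)); last by field.
  rewrite ler_wpM2l ?mulr_ge0 ?sqn_ge0//; have := e4 n; have := e0 n; nra.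
have FG w : F n w @[n --> \oo] --> dotv (grad f (xs + disp w)) (disp w).
  have := @is_derive_seq R _ 1 _ (is_derive_ray xs (disp w) 1 fC1.1).
  by rewrite /F scale1r.
have mG : measurable_fun setT (fun w => dotv (grad f (xs + disp w)) (disp w)).
  apply: measurable_dotv => //.
  exact: (measurableT_comp (measurable_grad fC1) mxsX).
have [rG cvgF] := Ex_dominated mF mG FG FB (rintZ (2 * L) r2).
split => //.
set A := _ - _.
pose K := beta / 2 * (C / (2 * theta)).
have low n : A - K * e n <= Ex P (F n).
  have [rht rh herr] := err _ (e0 n) (e4 n).
  have rF : rint P (F n) by apply: rint_le (rintZ (2 * L) r2).
  rewrite -(ler_pM2l (e0 n)) -ExZ//.
  pose D w := alpha / 2 * ((1 + e n) ^+ 2 - 1) * sqn (disp w) +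
    (h ((1 + e n) *: disp w) - h (disp w)).
  have rD : rint P D by apply: rintD; [exact: rintZ|exact: rintB].
  apply: (@le_trans _ _ (Ex P D)); last first.
    apply: Ex_le => //; first exact: rintZ.
    move=> w; rewrite /F mulrC divfK ?gt_eqF// /D scale1r.
    have := one_point_convex_growth (disp w) gP ler01 (_ : 1 <= 1 + e n).
    rewrite lerDl ltW// => /(_ isT); rewrite scale1r expr1n; lra.
  rewrite /D ExD; [|exact: rintZ|exact: rintB].
  rewrite ExB// ExZ//.
  have M0 : 0 <= Ex P (fun w => sqn (disp w)).
    by apply: Rintegral_ge0 => w _; exact: sqn_ge0.
  have : e n * (alpha * Ex P (fun w => sqn (disp w))) <=
    alpha / 2 * ((1 + e n) ^+ 2 - 1) * Ex P (fun w => sqn (disp w)).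
    have := mulr_ge0 (mulr_ge0 alpha0 M0) (sqr_ge0 (e n)); nra.
  move: herr; rewrite /A /K.
  set M2 := Ex P (fun w => sqn (disp w)); set M4 := Ex P (fun w => _ ^+ 2).
  rewrite (mulrDl J) (mulrDr (beta / 2)) (mulrDr (beta / 2)) (mulrAC C); nra.
have lowcvg : A - K * e n @[n --> \oo] --> A - K * 0.
  apply: cvgB; first exact: cvg_cst.
  by apply: cvgM; [exact: cvg_cst|exact: dilation_cvg0].
rewrite mulr0 subr0 in lowcvg.
exact: (ler_cvg_to lowcvg cvgF (nearW _ low)).
Qed.

End Smoothing.

(** * One step of Gaussian noise descent *)

Section Constants.
Context (R : realType) (alpha L : R).

Definition gnd_eta : R := 2 * alpha / (5 * L ^+ 2).
Definition gnd_lambda : R := 2 * alpha - gnd_eta * L ^+ 2.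
Definition gnd_s : R := gnd_lambda / (3 * L).
(** A gradient step on a one-point convex function with the same gradient growth
    contracts the squared distance by [1 - gnd_q]. *)
Definition gnd_q : R := gnd_eta * gnd_lambda.

Context (alpha0 : 0 < alpha) (aL : alpha <= L).

Let L0 : 0 < L. Proof. exact: lt_le_trans aL. Qed.

Lemma gnd_eta_gt0 : 0 < gnd_eta.
Proof. by rewrite divr_gt0 ?mulr_gt0 ?exprn_gt0. Qed.

Lemma gnd_lambdaE : gnd_lambda = 8 / 5 * alpha.
Proof. by rewrite /gnd_lambda /gnd_eta; field; rewrite gt_eqF. Qed.

Lemma gnd_etaL : 0 < gnd_eta * L /\ gnd_eta * L <= 2 / 5.
Proof.
split; first by rewrite mulr_gt0// gnd_eta_gt0.
have -> : gnd_eta * L = 2 / 5 * (alpha / L) by rewrite /gnd_eta; field; rewrite gt_eqF.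
have : alpha / L <= 1 by rewrite ler_pdivrMr// mul1r.
lra.
Qed.

Lemma gnd_qE : gnd_q = 16 / 25 * (alpha / L) ^+ 2.
Proof. by rewrite /gnd_q gnd_lambdaE /gnd_eta; field; rewrite gt_eqF. Qed.

Lemma gnd_q_bounds : 0 < gnd_q /\ gnd_q <= 16 / 25.
Proof.
rewrite gnd_qE; have k0 : 0 < alpha / L by rewrite divr_gt0.
have : alpha / L <= 1 by rewrite ler_pdivrMr// mul1r.
by split; nra.
Qed.

Lemma gnd_etas : gnd_eta * gnd_s = gnd_q / (3 * L).
Proof. by rewrite /gnd_s /gnd_q; field; rewrite gt_eqF. Qed.

End Constants.

Section GaussianStep.
Context (R : realType) (d : nat) (d0 : (0 < d)%N) (alpha L : R).
Context (alpha0 : 0 < alpha) (aL : alpha <= L).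
Context (f : 'rV[R]_d -> R) (xs : 'rV[R]_d) (nc : nearly_convex alpha L f xs).
Local Notation eta := (gnd_eta alpha L).
Local Notation s := (gnd_s alpha L).
Local Notation q := (gnd_q alpha L).
Local Notation gap := (fine (convexity_gap f xs alpha)).

Let L0 : 0 < L. Proof. exact: lt_le_trans aL. Qed.

Lemma nearly_convex_C1 : C1 f. Proof. by case: nc. Qed.

Lemma nearly_convex_min x : f xs <= f x. Proof. by case: nc => _ [h _] _ _. Qed.

Lemma nearly_convex_grad x : sqn (grad f x) <= L ^+ 2 * sqn (x - xs).
Proof.
case: nc => _ _ h _; rewrite -!sqr_enorm -exprMn ler_pXn2r ?nnegrE ?enorm_ge0//.
by rewrite mulr_ge0 ?enorm_ge0// ltW.
Qed.

Lemma nearly_convex_upper x : f x - f xs <= L / 2 * sqn (x - xs).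
Proof.
apply: quadratic_upper; first exact: ltW.
- by case: nearly_convex_C1.
- exact: nearly_convex_grad.
Qed.

Let M := 4^-1 * Num.sqrt (alpha ^+ 5 / (d%:R * L ^+ 3)).
(** Normalizes the admissible gap: [M * K = alpha / 4]. *)
Let K := Num.sqrt (d%:R * L ^+ 3 / alpha ^+ 3).

Let dL : 0 < d%:R * L ^+ 3. Proof. by rewrite mulr_gt0 ?exprn_gt0// ltr0n. Qed.

Let M0 : 0 < M.
Proof. by rewrite mulr_gt0// sqrtr_gt0 divr_gt0// exprn_gt0. Qed.

Let K2 : K ^+ 2 = d%:R * L ^+ 3 / alpha ^+ 3.
Proof. by rewrite sqr_sqrtr// divr_ge0 ?exprn_ge0// ltW. Qed.

Let K1 : 1 <= K.
Proof.
rewrite -[leLHS]sqrtr1; apply: ler_wsqrtr.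
rewrite ler_pdivlMr ?exprn_gt0// mul1r.
apply: (@le_trans _ _ (L ^+ 3)).
  by rewrite ler_pXn2r ?nnegrE// ltW.
by rewrite ler_peMl ?exprn_ge0 ?ler1n// ltW.
Qed.

Let MK : M * K = alpha / 4.
Proof.
rewrite /M /K -mulrA -sqrtrM; last by rewrite divr_ge0 ?exprn_ge0 ?ltW.
rewrite (_ : _ / _ * (_ / _) = alpha ^+ 2).
  by rewrite sqrtr_sqr gtr0_norm// mulrC.
have dn0 : d%:R != 0 :> R by rewrite pnatr_eq0 -lt0n.
by field; rewrite dn0 !gt_eqF.
Qed.

Lemma gap_bounds : 0 <= gap /\ gap <= alpha / 4.
Proof.
case: nc => _ _ _ h; have [g0 gM _] := near_optimal_surrogate d0 h (@ltr01 R).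
by split => //; apply: (le_trans gM); rewrite -/M -MK ler_peMr// ltW.
Qed.

(** The constant 101/400 leaves room above 1/4 because the infimum defining
    the gap may not be attained. *)
Lemma surrogate : exists beta g, [/\ 0 <= beta, beta * K <= 101 / 400 * alpha,
  one_point_convex alpha xs (f xs) g &
  forall x, `|f x - g x| <= beta / 2 * sqn (x - xs)].
Proof.
case: nc => _ _ _ h.
have [g0 gM [g gP fg]] := near_optimal_surrogate d0 h (divr_gt0 M0 (ltr0n R 100%N)).
exists (gap + M / 100), g; split => //.
  by rewrite addr_ge0// divr_ge0// ltW.
rewrite (_ : 101 / 400 * alpha = (M + M / 100) * K); last first.
  rewrite (_ : (M + M / 100) * K = 101 / 100 * (M * K)); last by field.
  by rewrite MK; field.
by rewrite ler_wpM2r ?(le_trans ler01)// lerD2r.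
Qed.

Lemma nearly_convex_lower x : (alpha - gap) / 2 * sqn (x - xs) <= f x - f xs.
Proof.
case: nc => _ _ _ h.
suff lo e : 0 < e -> (alpha - gap) / 2 * sqn (x - xs) <= f x - f xs + e / 2 * sqn (x - xs).
  apply: (@le_of_le_slope _ _ _ (sqn (x - xs) / 2)) => y y0 _.
  by apply: (le_trans (lo _ y0)); rewrite lerD2l mulrC mulrA [leRHS]mulrAC.
move=> e0; have [_ _ [g gP fg]] := near_optimal_surrogate d0 h e0.
have := one_point_convex_growth (x - xs) gP (lexx 0) ler01.
have [_ gxs _] := gP.
rewrite scale1r scale0r addr0 (addrC xs) subrK expr1n expr0n/= subr0 mulr1 gxs.
have := fg x; rewrite ler_norml => /andP[]; lra.
Qed.

Definition descent (x : 'rV[R]_d) : 'rV[R]_d := x - eta *: grad f x.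

Lemma descent_upper x : sqn (descent x - xs) <= (1 + eta * L) ^+ 2 * sqn (x - xs).
Proof.
rewrite /descent addrAC; apply: gradient_step_le (nearly_convex_grad x).
- exact: ltW.
- exact/ltW/gnd_eta_gt0.
Qed.

Lemma descent_lower x : (1 - eta * L) ^+ 2 * sqn (x - xs) <= sqn (descent x - xs).
Proof.
rewrite /descent addrAC; apply: gradient_step_ge (nearly_convex_grad x).
- exact: ltW.
- exact/ltW/gnd_eta_gt0.
- by have [_] := gnd_etaL alpha0 aL; lra.
Qed.

Lemma measurable_descent : measurable_fun setT (descent : borel_rV R d -> borel_rV R d).
Proof.
apply: measurable_rVB; first exact: measurable_id.
exact: (measurable_rVZ (measurable_cst _) (measurable_grad nearly_convex_C1)).
Qed.

Definition noise_scale (flb : R) (u : 'rV[R]_d) : R :=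
  Num.sqrt (eta * s * Num.max (f u - flb) 0).

Lemma noise_scale_ge0 flb u : 0 <= noise_scale flb u.
Proof. exact: sqrtr_ge0. Qed.

Lemma sqr_noise_scale flb u : flb <= f xs ->
  noise_scale flb u ^+ 2 = q / (3 * L) * (f u - flb).
Proof.
move=> flbs; have [q0 _] := gnd_q_bounds alpha0 aL.
have fu : 0 <= f u - flb by rewrite subr_ge0 (le_trans flbs)// nearly_convex_min.
rewrite /noise_scale max_l// gnd_etas// sqr_sqrtr// mulr_ge0//.
by apply/ltW; rewrite divr_gt0// mulr_gt0.
Qed.

Section Step.
Context dO (O : measurableType dO) (P : probability O R).
Context (xi : O -> 'rV[R]_d) (xiG : gaussian_vector P xi).

(** Expanding the descent step, the mean squared distance is governed by the
    mean of [dotv (grad f) X] for the noisy displacement [X] from the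
    minimizer, bounded below by [smoothed_gradient]. The noise is proportional
    to [f u - flb], which dominates the squared displacement; so the Fisher
    information is at most [16 * K ^+ 2] and the error of the surrogate, of
    size at most [alpha / (4 * K)] up to one percent, costs only about half of
    the convexity. *)
Lemma gaussian_step_pos (flb : R) (u : 'rV[R]_d) (sigma := noise_scale flb u) :
  flb <= f xs -> 0 < sigma ->
  let Y := fun w => sqn (descent (u - sigma *: xi w) - xs) in
  rint P Y /\
  Ex P Y <= (1 - q / 30) * sqn (u - xs) + 2 * q / (3 * L) * (f xs - flb).
Proof.
move=> flbs sigma0 Y.
have [beta [g [b0 bK gP fg]]] := surrogate.
pose U := u - xs; set m := sqn (u - xs).
have XE w : u - sigma *: xi w = xs + (U - sigma *: xi w).
  by rewrite addrA /U (addrC xs) subrK.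
have m0 : 0 <= m := sqn_ge0 _.
have s20 : 0 < sigma ^+ 2 by rewrite exprn_gt0.
pose S := m + 4 * sigma ^+ 2.
have S0 : 0 < S by rewrite /S; lra.
have K0 : 0 < K by rewrite (lt_le_trans ltr01).
(* The balance [4 * K / S] makes both parts of the error at most [2 * K * S]. *)
have theta0 : 0 < 4 * K / S by rewrite divr_gt0// mulr_gt0.
have fC1 := nearly_convex_C1; have fL := nearly_convex_grad.
have [r2 e2] := shifted_moment2 d0 xiG U sigma.
have [r4 e4] := shifted_moment4 d0 xiG U sigma.
have [rG eG] := smoothed_gradient d0 xiG (ltW alpha0) (ltW L0) b0 fC1 fL gP fg U
  sigma0 theta0.
have eta0 := gnd_eta_gt0 alpha0 aL.
have YB w : Y w <= (1 + eta ^+ 2 * L ^+ 2) * sqn (U - sigma *: xi w) -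
   2 * eta * dotv (grad f (xs + (U - sigma *: xi w))) (U - sigma *: xi w).
  rewrite /Y XE; set v := U - sigma *: xi w.
  have -> : descent (xs + v) - xs = v - eta *: grad f (xs + v).
    by rewrite /descent addrAC [xs + v - xs]addrAC subrr add0r.
  rewrite sqnBZ; have := fL (xs + v); rewrite [xs + v - xs]addrAC subrr add0r.
  by move=> /(ler_wpM2l (sqr_ge0 eta)); lra.
have mY : measurable_fun setT Y.
  apply: measurable_sqn; apply: measurable_rVB; last exact: measurable_cst.
  by apply: (measurableT_comp measurable_descent); exact: (measurable_shifted xiG).
have rB : rint P (fun w => (1 + eta ^+ 2 * L ^+ 2) * sqn (U - sigma *: xi w) -
   2 * eta * dotv (grad f (xs + (U - sigma *: xi w))) (U - sigma *: xi w)).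
  by apply: rintB; exact: rintZ.
have rY : rint P Y by apply: rint_le rB => // w; rewrite ger0_norm ?sqn_ge0.
split => //; apply: (le_trans (Ex_le rY rB YB)).
rewrite ExB ?ExZ//; [|exact: rintZ|exact: rintZ].
have [q0 q1] := gnd_q_bounds alpha0 aL.
set E2 := Ex P (fun w => sqn _) in e2 eG *.
set E4 := Ex P (fun w => sqn _ ^+ 2) in e4 eG *.
set G := Ex P (fun w => dotv _ _) in eG *.
rewrite -[sqn U]/m in e2 e4 eG.
have sE := sqr_noise_scale u flbs; rewrite -/sigma in sE.
have qL0 : 0 < q / (3 * L) by rewrite divr_gt0// mulr_gt0.
have kap : 1 <= (L / alpha) ^+ 3.
  by apply: exprn_ege1; rewrite ler_pdivlMr// mul1r.
have s_lower : m <= 14 * (L / alpha) ^+ 3 * sigma ^+ 2.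
  have [g0 g4] := gap_bounds; have := nearly_convex_lower u; rewrite -/m => lo.
  have : 3 / 8 * alpha * m <= f u - flb.
    apply: (@le_trans _ _ ((alpha - gap) / 2 * m)); last by lra.
    by rewrite ler_wpM2r//; lra.
  move=> /(ler_wpM2l (ltW qL0)); rewrite -sE gnd_qE// => h.
  have k0 : 0 <= 14 * (L / alpha) ^+ 3 by lra.
  have := ler_wpM2l k0 h; apply: le_trans.
  rewrite (_ : 14 * _ * _ = 28 / 25 * m); last by field; rewrite !gt_eqF.
  by lra.
have J16 : d%:R * (2 + m / sigma ^+ 2) <= 16 * K ^+ 2.
  rewrite K2 (_ : 16 * _ = d%:R * (16 * (L / alpha) ^+ 3)); last first.
    by field; rewrite gt_eqF.
  rewrite ler_wpM2l//.
  have : m / sigma ^+ 2 <= 14 * (L / alpha) ^+ 3 by rewrite ler_pdivrMr.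
  by lra.
have h1 : 4 * K / S / 2 * E4 <= 2 * K * S.
  rewrite (_ : 2 * K * S = 4 * K / S / 2 * S ^+ 2); last by field; rewrite gt_eqF.
  by rewrite ler_wpM2l// divr_ge0// ltW.
have h2 : d%:R * (2 + m / sigma ^+ 2) / (2 * (4 * K / S)) <= 2 * K * S.
  have k20 : 0 < 2 * (4 * K / S) by rewrite mulr_gt0.
  rewrite (ler_pdivrMr _ _ k20).
  rewrite (_ : 2 * K * S * _ = 16 * K ^+ 2); first exact: J16.
  by field; rewrite gt_eqF.
have h3 : beta / 2 * (4 * K / S / 2 * E4 + d%:R * (2 + m / sigma ^+ 2) / (2 * (4 * K / S)))
    <= 101 / 200 * alpha * S.
  have b20 : 0 <= beta / 2 by rewrite divr_ge0.
  apply: (@le_trans _ _ (beta / 2 * (4 * K * S))).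
    rewrite ler_wpM2l//; apply: (le_trans (lerD h1 h2)).
    by rewrite le_eqVlt; apply/orP; left; apply/eqP; ring.
  by have := ler_wpM2r (ltW S0) bK; lra.
have eG' : alpha * E2 - 101 / 200 * alpha * S <= G by lra.
have qa : q = 8 / 5 * (eta * alpha) by rewrite /gnd_q gnd_lambdaE//; ring.
have qd : q = 2 * (eta * alpha) - eta ^+ 2 * L ^+ 2 by rewrite /gnd_q /gnd_lambda; ring.
have e1 : (1 + eta ^+ 2 * L ^+ 2) * E2 - 2 * eta * G <=
    (1 - q) * E2 + 101 / 160 * q * S.
  have := ler_wpM2l (ltW eta0) eG'; rewrite qd; nra.
apply: (le_trans e1).
have s_upper : sigma ^+ 2 <= q / 6 * m + q / (3 * L) * (f xs - flb).
  rewrite sE.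
  have := ler_wpM2l (ltW qL0) (nearly_convex_upper u); rewrite -/m.
  rewrite (_ : q / (3 * L) * (L / 2 * m) = q / 6 * m); last by field; rewrite gt_eqF.
  lra.
have D0 : 0 <= q / (3 * L) * (f xs - flb) by rewrite mulr_ge0 ?subr_ge0// ltW.
set D := q / (3 * L) * _ in s_upper D0.
rewrite (_ : 2 * q / (3 * L) * _ = 2 * D); last by rewrite /D; ring.
apply: (@le_trans _ _ ((1 - q) * (m + sigma ^+ 2) + 101 / 160 * q * S)).
  by rewrite lerD2r ler_wpM2l//; lra.
have c0 : 0 <= 1 - q + 404 / 160 * q by lra.
have := ler_wpM2l c0 s_upper; rewrite /S.
have q2 : q ^+ 2 <= 16 / 25 * q by rewrite expr2 ler_wpM2r// ltW.
have q3 := ler_wpM2r m0 q2.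
have q4 := ler_wpM2r D0 q1.
have q5 := mulr_ge0 (ltW q0) m0.
have q6 := mulr_ge0 (ltW q0) D0.
nra.
Qed.

(** When the noise vanishes, the iterate is already the minimizer. *)
Lemma gaussian_step (flb : R) (u : 'rV[R]_d) : flb <= f xs ->
  (\int[P]_w (sqn (descent (u - noise_scale flb u *: xi w) - xs))%:E <=
   ((1 - q / 30) * sqn (u - xs) + 2 * q / (3 * L) * (f xs - flb))%:E)%E.
Proof.
move=> flbs; have [q0 q1] := gnd_q_bounds alpha0 aL.
have [s0|s0] := ltP 0 (noise_scale flb u).
  by have [rY eY] := gaussian_step_pos flbs s0; rewrite EFin_Ex// lee_fin.
have s00 : noise_scale flb u = 0 by apply/eqP; rewrite eq_le s0 noise_scale_ge0.
have := sqr_noise_scale u flbs; rewrite s00 expr0n/= => /esym/eqP.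
have qL0 : 0 < q / (3 * L) by rewrite divr_gt0// mulr_gt0.
rewrite mulf_eq0 gt_eqF//= subr_eq0 => /eqP fu.
have uxs : u = xs.
  case: nc => _ [_ uniq] _ _; apply: uniq => y.
  by rewrite fu (le_trans flbs)// nearly_convex_min.
have g0 : descent xs = xs.
  rewrite /descent (sqn_eq0 (u := grad f xs)) ?scaler0 ?subr0//.
  apply/eqP; rewrite eq_le sqn_ge0 andbT.
  by have := nearly_convex_grad xs; rewrite subrr sqn0 mulr0.
under eq_integral => w _ do rewrite scale0r subr0 uxs g0 subrr sqn0.
rewrite integral0 lee_fin uxs subrr sqn0 mulr0 add0r; apply: mulr_ge0; last by rewrite subr_ge0.
by apply: divr_ge0; apply: mulr_ge0; rewrite ?ltW.
Qed.

End Step.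

End GaussianStep.

Section OracleStep.
Context (R : realType) (d : nat) (alpha L : R).
Context (f : 'rV[R]_d -> R) (xs : 'rV[R]_d).
Context (dZ : measure_display) (Z : measurableType dZ) (Q : probability Z R).
Context (SG : 'rV[R]_d -> Z -> 'rV[R]_d) (r : R).
Context (mSG : measurable_oracle SG) (meanSG : unbiased_oracle Q SG f).
Context (varSG : oracle_variance_le Q SG f r).
Local Notation eta := (gnd_eta alpha L).

(** The oracle error has mean zero, so it adds its variance to the squared
    distance of the exact descent point. *)
Lemma oracle_step x :
  (\int[Q]_z (sqn (x - eta *: SG x z - xs))%:E <=
   (sqn (descent alpha L f x - xs) + eta ^+ 2 * r ^+ 2)%:E)%E.
Proof.
have mS : measurable_fun setT (SG x : Z -> borel_rV R d).
  have hx := @pair1_measurable _ _ (borel_rV R d) Z x.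
  have hS : measurable_fun setT ((fun p => SG p.1 p.2) : borel_rV R d * Z -> borel_rV R d) := mSG.
  exact: (measurableT_comp hS hx).
pose v := descent alpha L f x - xs.
pose e z := SG x z - grad f x.
have me : measurable_fun setT (e : Z -> borel_rV R d).
  by apply: measurable_rVB => //; exact: measurable_cst.
have re i : rint Q (fun z => e z 0 i) /\ Ex Q (fun z => e z 0 i) = 0.
  have [rS ES] := meanSG x i.
  have eE : (fun z => e z 0 i) = (fun z => SG x z 0 i - grad f x 0 i).
    by apply/funext => z; rewrite !mxE.
  have ES' : Ex Q (fun z => SG x z 0 i) = grad f x 0 i.
    by move: ES; rewrite unlock -[X in X = _ -> _]/(\int[Q]_z (SG x z 0 i)%:E)%E
      EFin_Ex// => -[].
  rewrite eE; split; first by apply: rintB => //; exact: rint_cst.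
  by rewrite ExB ?Ex_cst ?ES' ?subrr//; exact: rint_cst.
have [rd Ed] : rint Q (fun z => dotv (e z) v) /\ Ex Q (fun z => dotv (e z) v) = 0.
  have r1 i : rint Q (fun z => e z 0 i * v 0 i) /\ Ex Q (fun z => e z 0 i * v 0 i) = 0.
    have [ri Ei] := re i.
    under [X in rint _ X /\ _]funext => z do rewrite mulrC.
    under [X in _ /\ Ex _ X = _]funext => z do rewrite mulrC.
    by split; [exact: rintZ|rewrite ExZ// Ei mulr0].
  split; first by apply: rint_sum => i; have [] := r1 i.
  rewrite Ex_sum => [|i]; last by have [] := r1 i.
  by rewrite big1// => i _; have [] := r1 i.
have [r2 E2] : rint Q (fun z => sqn (e z)) /\ Ex Q (fun z => sqn (e z)) <= r ^+ 2.
  apply: rint_ge0; [exact: measurable_sqn|by move=> z; exact: sqn_ge0|].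
  have := varSG x; rewrite unlock; apply: le_trans.
  by rewrite le_eqVlt; apply/orP; left; apply/eqP; apply: eq_integral => z _;
    rewrite /= sqr_enorm.
have xE z : sqn (x - eta *: SG x z - xs) =
    sqn v - 2 * eta * dotv (e z) v + eta ^+ 2 * sqn (e z).
  rewrite -sqnBZ; congr sqn; rewrite /v /e /descent.
  by apply/rowP => i; rewrite !mxE; ring.
have rA : rint Q (fun z => sqn v - 2 * eta * dotv (e z) v).
  by apply: rintB; [exact: rint_cst|exact: rintZ].
have rX : rint Q (fun z => sqn (x - eta *: SG x z - xs)).
  under [X in rint _ X]funext => z do rewrite xE.
  by apply: rintD => //; exact: rintZ.
rewrite EFin_Ex// lee_fin; under [X in Ex _ X]funext => z do rewrite xE.
rewrite ExD//; last exact: rintZ.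
rewrite ExB; [|exact: rint_cst|exact: rintZ].
rewrite Ex_cst !ExZ// Ed mulr0 subr0 lerD2l.
by rewrite ler_wpM2l// sqr_ge0.
Qed.

End OracleStep.

(** * Independence of the past *)

Section Decoupling.
Context dO (O : measurableType dO) (R : realType) (P : probability O R).
Context (F : set (set O)) (mF : F `<=` measurable).
Context d2 (T2 : measurableType d2) (Y : O -> T2) (mY : measurable_fun setT Y).
Context (indep : independent_systems P <<s F>> (events_of Y)).

Local Notation OF := (g_sigma_algebraType F).

Lemma sub_sigma_measurable : <<s F>> `<=` @measurable _ O.
Proof. by apply: smallest_sub => //; exact: sigma_algebra_measurable. Qed.

Lemma measurable_sub_sigma d' (T' : measurableType d') (g : O -> T') :
  measurable_fun setT (g : OF -> T') -> measurable_fun setT g.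
Proof.
move=> mg _ A mA; apply: sub_sigma_measurable; exact: (mg measurableT A mA).
Qed.

(** A variable independent of a sub-sigma-algebra may be integrated
    separately, with everything measurable for the latter kept fixed. *)
Lemma decoupling (Phi : O -> T2 -> \bar R) :
  measurable_fun setT ((fun p => Phi p.1 p.2) : OF * T2 -> \bar R) ->
  (forall w y, 0 <= Phi w y)%E ->
  measurable_fun setT (fun w => \int[P]_w' Phi w (Y w'))%E /\
  (\int[P]_w Phi w (Y w) = \int[P]_w \int[P]_w' Phi w (Y w'))%E.
Proof.
move=> mPhi Phi0.
have mid : measurable_fun setT ((fun w => w) : O -> OF).
  by move=> _ A mA; rewrite setTI; exact: sub_sigma_measurable.
pose Xid : {mfun O >-> OF} := HB.pack ((fun w => w) : O -> OF)
  (isMeasurableFun.Build _ _ _ _ _ mid).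
pose XY : {mfun O >-> T2} := HB.pack Y (isMeasurableFun.Build _ _ _ _ _ mY).
pose m1 : probability OF R := distribution P Xid.
pose m2 : probability T2 R := distribution P XY.
have mpair : measurable_fun setT ((fun w => (w, Y w)) : O -> OF * T2).
  exact: measurable_fun_pair.
pose m := image_measure P mpair.
have mE A : measurable A -> (m1 \x m2)%E A = m A.
  apply: product_measure_unique => A1 A2 mA1 mA2.
  rewrite /m image_measureE.
  rewrite (_ : _ @^-1` _ = A1 `&` (Y @^-1` A2)); last by apply/seteqP; split.
  by apply: (indep mA1); exists A2 => //; rewrite setTI.
have mFF : measurable_fun setT (fubini_F m2 (fun p : OF * T2 => Phi p.1 p.2)).
  by apply: measurable_fun_fubini_tonelli_F => // p; exact: Phi0.
have FE w : fubini_F m2 (fun p : OF * T2 => Phi p.1 p.2) w = (\int[P]_w' Phi w (Y w'))%E.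
  rewrite /fubini_F /m2 ge0_integral_distribution//.
  exact: (measurableT_comp mPhi (pair1_measurable w)).
split.
  have FE' : (fun w => \int[P]_w' Phi w (Y w'))%E =
      fubini_F m2 (fun p : OF * T2 => Phi p.1 p.2) :> (O -> \bar R).
    by apply/funext => w; rewrite FE.
  by rewrite FE'; exact: measurable_sub_sigma.
transitivity (\int[m]_p Phi p.1 p.2)%E.
  by rewrite /m ge0_integral_image.
transitivity (\int[(m1 \x m2)%E]_p Phi p.1 p.2)%E.
  by apply: eq_measure_integral => A mA _; exact/esym/mE.
rewrite fubini_tonelli1// /m1 ge0_integral_distribution//; last first.
  by move=> w; apply: integral_ge0.
by apply: eq_integral => w _ /=; rewrite FE.
Qed.

End Decoupling.

(** * The filtration of the algorithm *)

Lemma measurable_sigma_mono dO (O : measurableType dO) (F F' : set (set O)) d' (T' : measurableType d')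
    (g : O -> T') : F `<=` <<s F'>> ->
  measurable_fun setT (g : g_sigma_algebraType F -> T') ->
  measurable_fun setT (g : g_sigma_algebraType F' -> T').
Proof.
move=> FF' mg _ A mA.
have : <<s F>> `<=` <<s F'>>.
  by apply: smallest_sub => //; exact: smallest_sigma_algebra.
by apply; exact: (mg measurableT A mA).
Qed.

Lemma measurable_events dO (O : measurableType dO) (F : set (set O)) d' (T' : measurableType d')
    (g : O -> T') : events_of g `<=` F ->
  measurable_fun setT (g : g_sigma_algebraType F -> T').
Proof.
by move=> gF _ A mA; apply: sub_sigma_algebra; apply: gF; exists A.
Qed.

Section Process.
Context (R : realType) (d : nat) (d0 : (0 < d)%N) (alpha L : R).
Context (alpha0 : 0 < alpha) (aL : alpha <= L).
Context (f : 'rV[R]_d -> R) (xs : 'rV[R]_d) (nc : nearly_convex alpha L f xs).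
Context (dZ : measure_display) (Z : measurableType dZ) (Q : probability Z R).
Context (SG : 'rV[R]_d -> Z -> 'rV[R]_d) (r : R).
Context (mSG : measurable_oracle SG) (meanSG : unbiased_oracle Q SG f).
Context (varSG : oracle_variance_le Q SG f r).
Context dO (O : measurableType dO) (P : probability O R).
Context (z : nat -> O -> Z) (xi : nat -> O -> 'rV[R]_d) (N : nat).
Context (fresh : fresh_randomness P Q z xi N).

Local Notation V := (borel_rV R d).
Local Notation eta := (gnd_eta alpha L).
Local Notation lambda := (gnd_lambda alpha L).
Local Notation s := (gnd_s alpha L).
Local Notation q := (gnd_q alpha L).
Local Notation y := (descent alpha L f).
Local Notation F k := (past z xi k).
Local Notation sF k := (g_sigma_algebraType (past z xi k)).

Lemma past_mono k k' : (k <= k')%N -> F k `<=` F k'.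
Proof. by move=> kk' A [j jk jA]; exists j => //; exact: leq_trans kk'. Qed.

Lemma past_measurable k : (k <= N)%N -> F k `<=` @measurable _ O.
Proof.
move=> kN A [j jk]; have [mz _ [mxi _] _ _] := fresh (leq_trans jk kN).
by move=> -[] [B mB <-]; [exact: mz|exact: mxi].
Qed.

Lemma measurable_past k k' d' (T' : measurableType d') (g : O -> T') :
  (k <= k')%N -> measurable_fun setT (g : sF k -> T') ->
  measurable_fun setT (g : sF k' -> T').
Proof.
move=> kk'; apply: measurable_sigma_mono => A FA.
by apply: sub_sigma_algebra; exact: past_mono FA.
Qed.

Lemma measurable_past_z k : measurable_fun setT (z k : sF k.+1 -> Z).
Proof. by apply: measurable_events => A zA; exists k => /=; [exact: ltnSn|left]. Qed.

Lemma measurable_past_xi k : measurable_fun setT (xi k : sF k.+1 -> V).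
Proof. by apply: measurable_events => A zA; exists k => /=; [exact: ltnSn|right]. Qed.

Section Steps.
Context d' (T : measurableType d').
Context (Fl : T -> R) (X : T -> 'rV[R]_d) (mFl : measurable_fun setT Fl).
Context (mX : measurable_fun setT (X : T -> V)).

Lemma measurable_half_step (zk : T -> Z) : measurable_fun setT zk ->
  measurable_fun setT ((fun w => X w - eta *: SG (X w) (zk w)) : T -> V).
Proof.
move=> mz; apply: measurable_rVB => //.
apply: (measurable_rVZ (measurable_cst _)).
have mp : measurable_fun setT ((fun w => (X w, zk w)) : T -> V * Z).
  exact: measurable_fun_pair.
exact: (measurableT_comp mSG mp).
Qed.

Lemma measurable_value : measurable_fun setT (fun w => f (X w)).
Proof. exact: (measurableT_comp (measurable_C1 (nearly_convex_C1 nc)) mX). Qed.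

Lemma measurable_noise_step (v : T -> 'rV[R]_d) : measurable_fun setT (v : T -> V) ->
  measurable_fun setT
    ((fun w => X w - noise_scale alpha L f (Fl w) (X w) *: v w) : T -> V).
Proof.
move=> mv; apply: measurable_rVB => //; apply: measurable_rVZ => //.
rewrite /noise_scale.
have mM : measurable_fun setT (fun w => Num.max (f (X w) - Fl w) 0).
  apply: measurable_maxr; last exact: measurable_cst.
  by apply: measurable_funB => //; exact: measurable_value.
apply: (measurableT_comp (f := fun x : R => Num.sqrt x)).
  by apply: continuous_measurable_fun; exact: sqrt_continuous.
by apply: measurable_funM => //; exact: measurable_cst.
Qed.

Lemma measurable_sqdist : measurable_fun setT (fun w => sqn (y (X w) - xs)).
Proof.
apply: measurable_sqn; apply: measurable_rVB; last exact: measurable_cst.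
exact: (measurableT_comp (measurable_descent nc) mX).
Qed.

End Steps.

Section Run.
Context (k0 : nat) (Fl : O -> R) (X0 : O -> 'rV[R]_d).
Context (mFl : measurable_fun setT (Fl : sF k0 -> R)).
Context (mX0 : measurable_fun setT (X0 : sF k0 -> V)).

Definition run (t : nat) (w : O) : 'rV[R]_d :=
  gnd_iter f SG eta s (z ^~ w) (xi ^~ w) (Fl w) k0 (X0 w) t.

Lemma measurable_run t : measurable_fun setT (run t : sF (k0 + t) -> V).
Proof.
elim: t => [|t IH]; first by rewrite addn0.
rewrite addnS.
have m1 := measurable_past (leqnSn (k0 + t)) IH.
have m2 := measurable_half_step m1 (@measurable_past_z (k0 + t)%N).
have mF : measurable_fun setT (Fl : sF (k0 + t).+1 -> R).
  by apply: measurable_past mFl; rewrite leqW// leq_addr.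
exact: (measurable_noise_step mF m2 (@measurable_past_xi (k0 + t)%N)).
Qed.

(** As long as the squared distance of the descent point exceeds [200 * level],
    the contraction of one step outweighs both the oracle variance and the
    noise due to the gap [Delta] between the minimum and its lower bound. *)
Definition level (Delta : R) : R :=
  eta * r ^+ 2 / lambda + (5 * eta * lambda + 14) / (42 * L) * Delta.

Context (Bmin Mx : R) (Bmin0 : 0 < Bmin) (Mx0 : 0 <= Mx).

(** The run has stayed far from the minimizer up to time [t]. The conditions on
    the inputs of the run belong to the event because they are random: they
    hold only outside the failures of the preceding runs. *)
Definition far (t : nat) : set O :=
  [set w | [/\ Fl w <= f xs, sqn (y (X0 w) - xs) <= Mx &
    forall u, (u <= t)%N ->
      200 * Num.max (level (f xs - Fl w)) Bmin < sqn (y (run u w) - xs)]].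

Lemma far_past t : measurable (far t : set (sF (k0 + t))).
Proof.
have mF : measurable_fun setT (Fl : sF (k0 + t) -> R).
  by apply: measurable_past mFl; rewrite leq_addr.
have mX : measurable_fun setT (X0 : sF (k0 + t) -> V).
  by apply: measurable_past mX0; rewrite leq_addr.
have mlev : measurable_fun setT
    ((fun w => 200 * Num.max (level (f xs - Fl w)) Bmin) : sF (k0 + t) -> R).
  apply: measurable_funM; first exact: measurable_cst.
  apply: measurable_maxr; last exact: measurable_cst.
  rewrite /level; apply: measurable_funD; first exact: measurable_cst.
  by apply: measurable_funM => //; apply: measurable_funB.
rewrite (_ : far t = [set w | Fl w <= f xs] `&` [set w | sqn (y (X0 w) - xs) <= Mx] `&`
   \bigcap_(u in [set u | (u <= t)%N]) [set w |
     200 * Num.max (level (f xs - Fl w)) Bmin < sqn (y (run u w) - xs)]); last first.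
  by apply/seteqP; split => w /= => [[]|[[]]].
apply: measurableI; first apply: measurableI.
- by rewrite -[X in measurable X]setTI; apply: measurable_fun_le.
- rewrite -[X in measurable X]setTI; apply: measurable_fun_le => //.
  exact: measurable_sqdist.
- apply: bigcap_measurable => [|u ut]; first by exists 0%N.
  rewrite (_ : [set w | _] = ~` [set w | sqn (y (run u w) - xs) <=
      200 * Num.max (level (f xs - Fl w)) Bmin]); last first.
    by apply/seteqP; split => w /=; rewrite ltNge => /negP.
  apply: measurableC.
  rewrite -[X in measurable X]setTI; apply: measurable_fun_le => //.
  have mru : measurable_fun setT (run u : sF (k0 + t) -> V).
    by apply: measurable_past (@measurable_run u); rewrite leq_add2l.
  exact: measurable_sqdist.
Qed.

Lemma far_decr t : far t.+1 `<=` far t.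
Proof. by move=> w [? ? h]; split => // u ut; apply: h; rewrite leqW. Qed.

(** One step contracts the truncated second moment: the noise and the oracle
    seed are integrated separately, given the past. *)
Lemma far_step t : (k0 + t < N)%N ->
  (\int[P]_w (\1_(far t) w * sqn (y (run t.+1 w) - xs))%:E <=
   (1 - q / 200)%:E * \int[P]_w (\1_(far t) w * sqn (y (run t w) - xs))%:E)%E.
Proof.
move=> ktN; have [mz zQ xiG indz indxi] := fresh ktN.
have [q0 q1] := gnd_q_bounds alpha0 aL.
set k := (k0 + t)%N in ktN mz zQ xiG indz indxi *.
pose u w := run t w - eta *: SG (run t w) (z k w).
pose Fz := past z xi k `|` events_of (z k).
have Fsub : F k `<=` <<s Fz>>.
  by move=> A FA; apply: sub_sigma_algebra; left.
have Fzm : Fz `<=` @measurable _ O.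
  rewrite subUset; split; first exact: past_measurable (ltnW ktN).
  by move=> _ [B mB <-]; exact: mz.
have mi := @measurable_run t; rewrite -/k in mi.
have mfar := @far_past t; rewrite -/k in mfar.
have mF : measurable_fun setT (Fl : sF k -> R).
  by apply: measurable_past mFl; rewrite leq_addr.
have mind : measurable_fun setT (\1_(far t) : sF k -> R) by exact: measurable_indic.
have q30 : 0 <= 1 - q / 30 by lra.
have qL : 0 <= 2 * q / (3 * L).
  have L0 : 0 < L by exact: lt_le_trans aL.
  by apply: divr_ge0; apply: mulr_ge0; rewrite ?ltW.
have far0 w : \1_(far t) w = 0 :> R \/ (\1_(far t) w = 1 :> R /\ far t w).
  rewrite indicE; case: (boolP (w \in _)) => [/set_mem|_]; first by right.
  by left.
have i0 w : 0 <= \1_(far t) w :> R by case: (far0 w) => [->|[-> _]].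
(* The Gaussian vector is integrated first, with the past and the seed fixed,
   because the noise scale depends on the seed. *)
have mixi : measurable_fun setT (xi k : O -> V) by case: xiG.
pose Phi w v := (\1_(far t) w *
  sqn (y (u w - noise_scale alpha L f (Fl w) (u w) *: v) - xs))%:E.
have [mPhi' PhiE] : measurable_fun setT (fun w => \int[P]_w' Phi w (xi k w'))%E /\
  (\int[P]_w Phi w (xi k w) = \int[P]_w \int[P]_w' Phi w (xi k w'))%E.
  apply: (decoupling Fzm mixi indxi); last first.
    by move=> w v; rewrite lee_fin mulr_ge0// sqn_ge0.
  pose OF := g_sigma_algebraType Fz.
  have m1 : measurable_fun setT (run t : OF -> V) := measurable_sigma_mono Fsub mi.
  have mzF : measurable_fun setT (z k : OF -> Z).
    by apply: measurable_events => A zA; right.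
  have mu : measurable_fun setT (u : OF -> V) := measurable_half_step m1 mzF.
  have mFlF : measurable_fun setT (Fl : OF -> R) := measurable_sigma_mono Fsub mF.
  have mindF : measurable_fun setT (\1_(far t) : OF -> R) :=
    measurable_sigma_mono Fsub mind.
  apply/measurable_EFinP; apply: measurable_funM.
    exact: (measurableT_comp mindF measurable_fst).
  apply: measurable_sqdist.
  have mFl1 : measurable_fun setT ((Fl \o fst) : OF * V -> R).
    exact: (measurableT_comp mFlF measurable_fst).
  have mu1 : measurable_fun setT ((u \o fst) : OF * V -> V).
    exact: (measurableT_comp mu measurable_fst).
  exact: (measurable_noise_step mFl1 mu1 measurable_snd).
(* What remains depends on the seed only through the half step, where
   [oracle_step] applies with the past fixed. *)
pose Psi w v := (\1_(far t) w * ((1 - q / 30) *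
  sqn (run t w - eta *: SG (run t w) v - xs) + 2 * q / (3 * L) * (f xs - Fl w)))%:E.
have Psi0 w v : (0 <= Psi w v)%E.
  rewrite lee_fin; case: (far0 w) => [->|[-> [fl _ _]]]; first by rewrite mul0r.
  rewrite mul1r; apply: addr_ge0; apply: mulr_ge0 => //; first exact: sqn_ge0.
  by rewrite subr_ge0.
have mPsi : measurable_fun setT ((fun p => Psi p.1 p.2) : sF k * Z -> \bar R).
  have mi1 : measurable_fun setT ((run t \o fst) : sF k * Z -> V).
    exact: (measurableT_comp mi measurable_fst).
  apply/measurable_EFinP; apply: measurable_funM.
    exact: (measurableT_comp mind measurable_fst).
  apply: measurable_funD; apply: measurable_funM => //.
    apply: measurable_sqn; apply: measurable_rVB; last exact: measurable_cst.
    exact: (measurable_half_step mi1 measurable_snd).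
  apply: measurable_funB => //.
  exact: (measurableT_comp mF measurable_fst).
have Fkm := past_measurable (ltnW ktN).
have [mPsi' PsiE] := decoupling Fkm mz indz mPsi Psi0.
have mid : measurable_fun setT ((fun w => w) : O -> sF k).
  by move=> _ A mA; rewrite setTI; exact: sub_sigma_measurable Fkm _ mA.
have mPsiz : measurable_fun setT (fun w => Psi w (z k w)).
  exact: (measurableT_comp mPsi (measurable_fun_pair mid mz)).
have mfarO : measurable_fun setT (\1_(far t) : O -> R).
  exact: (measurable_sub_sigma Fkm mind).
have mrunO : measurable_fun setT (run t : O -> V) := measurable_sub_sigma Fkm mi.
have mW : measurable_fun setT (fun w => \1_(far t) w * sqn (y (run t w) - xs)).
  by apply: measurable_funM => //; exact: measurable_sqdist.
have W0 w : 0 <= \1_(far t) w * sqn (y (run t w) - xs).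
  by rewrite mulr_ge0// sqn_ge0.
apply: (@le_trans _ _ (\int[P]_w Psi w (z k w))%E).
  rewrite -[leLHS]/(\int[P]_w Phi w (xi k w))%E PhiE.
  apply: ge0_le_integral => //.
  - by move=> w _; apply: integral_ge0 => w' _; rewrite lee_fin mulr_ge0// sqn_ge0.
  - move=> w _; rewrite /Phi /Psi; case: (far0 w) => [->|[-> [fl _ _]]].
      by under eq_integral do rewrite mul0r; rewrite integral0 mul0r.
    under eq_integral do rewrite mul1r; rewrite mul1r.
    exact: (gaussian_step d0 alpha0 aL nc xiG).
rewrite PsiE; apply: (@le_trans _ _
    (\int[P]_w ((1 - q / 200)%:E * (\1_(far t) w * sqn (y (run t w) - xs))%:E))%E); last first.
  rewrite ge0_integralZl//; last by rewrite lee_fin; lra.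
    exact/measurable_EFinP.
  by move=> w _; rewrite lee_fin.
apply: ge0_le_integral => //.
- by move=> w _; apply: integral_ge0 => w' _; exact: Psi0.
- apply: emeasurable_funM; first exact: measurable_cst.
  exact/measurable_EFinP.
move=> w _; rewrite /Psi; case: (far0 w) => [->|[-> [fl _ farw]]].
  by under eq_integral do rewrite mul0r; rewrite integral0 mul0r mule0.
under eq_integral do rewrite mul1r; rewrite mul1r.
pose g v := sqn (run t w - eta *: SG (run t w) v - xs).
have mg : measurable_fun setT g.
  apply: measurable_sqn; apply: measurable_rVB; last exact: measurable_cst.
  by apply: (measurable_half_step (X := fun=> run t w)) => //; exact: measurable_cst.
have [rg Eg] : rint Q g /\ Ex Q g <= sqn (y (run t w) - xs) + eta ^+ 2 * r ^+ 2.
  apply: rint_ge0 => // [v|]; first exact: sqn_ge0.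
  exact: (oracle_step alpha L xs mSG meanSG varSG).
pose h v := (1 - q / 30) * g v + 2 * q / (3 * L) * (f xs - Fl w).
have rh : rint Q h by apply: rintD; [exact: rintZ|exact: rint_cst].
have h0 v : 0 <= h v.
  apply: addr_ge0; apply: mulr_ge0 => //; first exact: sqn_ge0.
  by rewrite subr_ge0.
have hE : (\int[P]_w' (h (z k w'))%:E = \int[Q]_v (h v)%:E)%E.
  rewrite -(@ge0_integral_image _ _ _ _ _ P (z k) mz (fun v => (h v)%:E))//.
    by apply: eq_measure_integral => A mA _; exact: zQ.
  by apply/measurable_EFinP; exact: rint_measurable rh.
rewrite -[leLHS]/(\int[P]_w' (h (z k w'))%:E)%E hE.
rewrite EFin_Ex// -EFinM lee_fin /h ExD; [|exact: rintZ|exact: rint_cst].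
rewrite Ex_cst ExZ//.
set S := sqn _ in Eg *; set D := f xs - Fl w.
have L0 : 0 < L by exact: lt_le_trans aL.
have D0 : 0 <= D by rewrite subr_ge0.
have S0 : 200 * level D <= S.
  apply/ltW; apply: le_lt_trans (farw t (leqnn t)).
  by rewrite ler_wpM2l// le_max lexx.
have lev : q * level D = eta ^+ 2 * r ^+ 2 + q / (3 * L) * D * (1 + 5 / 14 * q).
  have lam0 : lambda != 0 by rewrite gnd_lambdaE// mulf_neq0// gt_eqF.
  rewrite /level /gnd_q; field.
  by rewrite lam0 gt_eqF.
have qS := ler_wpM2l (ltW q0) S0.
have qD : 0 <= q / (3 * L) * D.
  by apply: mulr_ge0 => //; apply: divr_ge0; [exact: ltW|rewrite mulr_ge0// ltW].
have qqD := mulr_ge0 (ltW q0) qD.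
have eg := ler_wpM2l q30 Eg.
have er : 0 <= eta ^+ 2 * r ^+ 2 by rewrite mulr_ge0 ?sqr_ge0.
have qer := mulr_ge0 (ltW q0) er.
rewrite (_ : 2 * q / (3 * L) * D = 2 * (q / (3 * L) * D)); last by ring.
rewrite (mulrCA q 200) lev in qS.
move: qS qD qqD eg er qer; set e := eta ^+ 2 * r ^+ 2; set h' := q / (3 * L) * D.
by move=> qS qD qqD eg er qer; lra.
Qed.

Lemma measurable_far t : (k0 + t <= N)%N -> measurable (far t).
Proof.
by move=> ktN; exact: (sub_sigma_measurable (past_measurable ktN) (@far_past t)).
Qed.

Lemma measurable_run_far t : (k0 + t <= N)%N ->
  measurable_fun setT (fun w => \1_(far t) w * sqn (y (run t w) - xs)).
Proof.
move=> ktN; apply: measurable_funM.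
  by apply: measurable_indic; exact: measurable_far.
apply: measurable_sqdist.
exact: (measurable_sub_sigma (past_measurable ktN) (@measurable_run t)).
Qed.

Lemma far_mean t : (k0 + t <= N)%N ->
  (\int[P]_w (\1_(far t) w * sqn (y (run t w) - xs))%:E <=
   ((1 - q / 200) ^+ t * Mx)%:E)%E.
Proof.
have [q0 q1] := gnd_q_bounds alpha0 aL.
have W0 t' w : 0 <= \1_(far t) w * sqn (y (run t' w) - xs) by rewrite mulr_ge0// sqn_ge0.
elim: t W0 => [|t IH] W0 ktN.
  rewrite expr0 mul1r; apply: (@le_trans _ _ (\int[P]_w (cst Mx%:E) w)%E).
    apply: ge0_le_integral => //.
    - by move=> w _; rewrite lee_fin.
    - by apply/measurable_EFinP; exact: measurable_run_far.
    - move=> w _; rewrite /= lee_fin indicE.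
      case: (boolP (w \in _)) => [/set_mem[_ wM _]|_]; first by rewrite mul1r.
      by rewrite mul0r.
  by rewrite integral_cst//= probability_setT mule1.
have ktN' : (k0 + t < N)%N by rewrite -addnS.
apply: (@le_trans _ _ (\int[P]_w (\1_(far t) w * sqn (y (run t.+1 w) - xs))%:E)%E).
  apply: ge0_le_integral => //.
  - by move=> w _; rewrite lee_fin.
  - by apply/measurable_EFinP; exact: measurable_run_far.
  - apply/measurable_EFinP; apply: measurable_funM.
      by apply: measurable_indic; apply: measurable_far; exact: ltnW.
    apply: measurable_sqdist.
    exact: (measurable_sub_sigma (past_measurable ktN) (@measurable_run t.+1)).
  - move=> w _; rewrite lee_fin ler_wpM2r ?sqn_ge0// !indicE ler_nat.
    case: (boolP (w \in far t.+1)) => // /set_mem /far_decr wt.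
    by rewrite mem_set.
apply: (le_trans (far_step ktN')).
rewrite exprS -mulrA EFinM lee_pmul2l//; last first.
  by rewrite lte_fin; lra.
apply: IH; last exact: ltnW.
by move=> t' w; rewrite mulr_ge0// sqn_ge0.
Qed.

(** Markov's inequality for the truncated second moment, which is at least
    [200 * Bmin] on the event. *)
Lemma far_prob t (c A : R) : (k0 + t <= N)%N -> 0 < c -> Mx / (200 * Bmin) <= A ->
  200 / q * ln (A / c) <= t%:R -> (P (far t) <= c%:E)%E.
Proof.
move=> ktN c0 MA tc; have [q0 q1] := gnd_q_bounds alpha0 aL.
have B0 : 0 < 200 * Bmin by rewrite mulr_gt0.
have A0 : 0 <= A by apply: le_trans MA; rewrite divr_ge0// ltW.
have rho0 : 0 <= 1 - q / 200 by lra.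
have markov : ((200 * Bmin)%:E * P (far t) <= ((1 - q / 200) ^+ t * Mx)%:E)%E.
  apply: le_trans (far_mean ktN).
  have -> : P (far t) = (\int[P]_w (\1_(far t) w)%:E)%E.
    by rewrite integral_indic ?setIT//; exact: measurable_far.
  rewrite -ge0_integralZl//; last 2 first.
  - by apply/measurable_EFinP; apply: measurable_indic; exact: measurable_far.
  - by rewrite lee_fin ltW.
  apply: ge0_le_integral => //.
  - by move=> w _; rewrite -EFinM lee_fin mulr_ge0// ltW.
  - apply: emeasurable_funM; first exact: measurable_cst.
    by apply/measurable_EFinP; apply: measurable_indic; exact: measurable_far.
  - by apply/measurable_EFinP; exact: measurable_run_far.
  - move=> w _; rewrite -EFinM lee_fin indicE.
    case: (boolP (w \in _)) => [/set_mem[_ _ wM]|_]; last by rewrite mulr0 mul0r.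
    rewrite mulr1 mul1r; apply/ltW; apply: le_lt_trans (wM _ (leqnn t)).
    by rewrite ler_wpM2l// le_max lexx orbT.
have fP : P (far t) \is a fin_num by rewrite fin_num_measure//; exact: measurable_far.
rewrite -(fineK fP) -EFinM lee_fin in markov.
rewrite -(fineK fP) lee_fin.
apply: (@le_trans _ _ ((1 - q / 200) ^+ t * A)).
  rewrite -(ler_pM2l B0); apply: (le_trans markov).
  rewrite mulrCA ler_wpM2l ?exprn_ge0//.
  by rewrite mulrC -ler_pdivrMr.
move: A0; rewrite le_eqVlt => /predU1P[<-|A0]; first by rewrite mulr0 ltW.
have Ac : 0 < A / c by rewrite divr_gt0.
have ex : (1 - q / 200) ^+ t <= expR (- ln (A / c)).
  apply: (@le_trans _ _ (expR (- (q / 200)) ^+ t)).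
    apply: lerXn2r; rewrite ?nnegrE ?expR_ge0//.
    by apply: le_trans (expR_ge1Dx _); lra.
  rewrite -expRM_natl ler_expR mulrN lerN2.
  rewrite -(ler_pM2r (divr_gt0 (ltr0n R 200%N) q0)).
  apply: (@le_trans _ _ t%:R); first by rewrite mulrC.
  by rewrite le_eqVlt; apply/orP; left; apply/eqP; field; rewrite gt_eqF.
apply: (le_trans (ler_wpM2r (ltW A0) ex)).
rewrite expRN lnK ?posrE// invf_div divfK// gt_eqF//.
Qed.

End Run.
End Process.

(** * The first minimizing index *)

Section Argmin.
Context (R : realType) (d : nat) (f : 'rV[R]_d -> R).
Implicit Types (x : nat -> 'rV[R]_d).

Definition is_argmin x T t : bool :=
  all (fun u => f (x t) <= f (x u)) (iota 0 T.+1).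

Lemma is_argminP x T t :
  reflect (forall u, (u <= T)%N -> f (x t) <= f (x u)) (is_argmin x T t).
Proof.
apply: (iffP allP) => h u; last by rewrite mem_iota/= add0n ltnS => /h.
by move=> uT; apply: h; rewrite mem_iota/= add0n ltnS.
Qed.

Lemma argmin_exists x T : exists2 t, (t <= T)%N & is_argmin x T t.
Proof.
elim: T => [|T [t tT /is_argminP ht]].
  by exists 0%N => //; apply/is_argminP => u; rewrite leqn0 => /eqP ->.
have [le|lt] := leP (f (x t)) (f (x T.+1)).
  exists t; first exact: leqW.
  apply/is_argminP => u; rewrite leq_eqVlt ltnS => /predU1P[->//|]; exact: ht.
exists T.+1 => //; apply/is_argminP => u.
rewrite leq_eqVlt ltnS => /predU1P[->//|/ht]; exact/le_trans/ltW.
Qed.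

Lemma first_argminE x T : first_argmin f x T = find (is_argmin x T) (iota 0 T.+1).
Proof. by []. Qed.

Lemma first_argmin_has x T : has (is_argmin x T) (iota 0 T.+1).
Proof.
have [t tT tP] := argmin_exists x T; apply/hasP; exists t => //.
by rewrite mem_iota/= add0n ltnS.
Qed.

Lemma first_argmin_leq x T : (first_argmin f x T <= T)%N.
Proof.
by have := first_argmin_has x T; rewrite has_find size_iota ltnS.
Qed.

Lemma first_argminP x T u : (u <= T)%N -> f (x (first_argmin f x T)) <= f (x u).
Proof.
have := nth_find 0%N (first_argmin_has x T).
rewrite -first_argminE nth_iota ?ltnS ?first_argmin_leq// add0n => /is_argminP.
exact.
Qed.

Lemma first_argmin_eq x T t : (t <= T)%N ->
  (first_argmin f x T = t) <->
  (is_argmin x T t /\ forall j, (j < t)%N -> ~~ is_argmin x T j).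
Proof.
move=> tT; have nthE j : (j <= T)%N -> nth 0%N (iota 0 T.+1) j = j.
  by move=> jT; rewrite nth_iota ?ltnS// add0n.
split=> [<-|[pt pj]].
  split.
    have := nth_find 0%N (first_argmin_has x T).
    by rewrite -first_argminE nthE// first_argmin_leq.
  move=> j jt; have jT : (j <= T)%N.
    by apply: (leq_trans (ltnW jt)); exact: first_argmin_leq.
  by have := before_find 0%N jt; rewrite nthE// => h; apply/negbT.
apply/eqP; rewrite eqn_leq; apply/andP; split.
  rewrite leqNgt; apply/negP => lt; have := before_find 0%N lt.
  by rewrite nthE//; move/negP; apply.
rewrite leqNgt; apply/negP => /pj.
have := nth_find 0%N (first_argmin_has x T).
by rewrite -first_argminE nthE ?first_argmin_leq// => ->.
Qed.

(** The index is random; the selected iterate is measurable because it is the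
    [t]-th one on the measurable event that the index is [t]. *)
Lemma measurable_first_argmin d' (T' : measurableType d') (X : nat -> T' -> 'rV[R]_d) T :
  (forall t, (t <= T)%N -> measurable_fun setT (X t : T' -> borel_rV R d)) ->
  measurable_fun setT (f : borel_rV R d -> R) ->
  measurable_fun setT
    ((fun w => X (first_argmin f (X ^~ w) T) w) : T' -> borel_rV R d).
Proof.
move=> mX mf.
have mfX t : (t <= T)%N -> measurable_fun setT (fun w => f (X t w)).
  by move=> tT; exact: (measurableT_comp mf (mX t tT)).
have marg t : (t <= T)%N -> measurable [set w | is_argmin (X ^~ w) T t].
  move=> tT; rewrite (_ : [set w | _] = \bigcap_(u in [set u | (u <= T)%N])
      [set w | f (X t w) <= f (X u w)]).
    apply: bigcap_measurable => [|u uT]; first by exists 0%N.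
    rewrite -[X in measurable X]setTI; apply: measurable_fun_le => //; exact: mfX.
  apply/seteqP; split => w /=; first by move=> /is_argminP h u; exact: h.
  by move=> h; apply/is_argminP => u; exact: h.
move=> _ A mA; rewrite setTI.
rewrite (_ : _ @^-1` A = \bigcup_(t in [set t | (t <= T)%N])
   (([set w | is_argmin (X ^~ w) T t] `&`
    \bigcap_(j in [set j | (j < t)%N]) ~` [set w | is_argmin (X ^~ w) T j]) `&`
    X t @^-1` A)).
  apply: bigcup_measurable => t tT; apply: measurableI.
    apply: measurableI; first exact: marg.
    have [->|t0] := posnP t.
      by rewrite (_ : [set j | (j < 0)%N] = set0) ?bigcap_set0//; apply/seteqP; split.
    apply: bigcap_measurable => [|j jt]; first by exists 0%N.
    by apply: measurableC; apply: marg; apply: ltnW; exact: leq_trans tT.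
  by rewrite -[X in measurable X]setTI; exact: mX.
apply/seteqP; split => w /=.
  move=> Aw; exists (first_argmin f (X ^~ w) T); first exact: first_argmin_leq.
  have [h1 h2] := (first_argmin_eq (X ^~ w) (first_argmin_leq (X ^~ w) T)).1 erefl.
  by split => //; split => // j /h2 /negP.
move=> [t tT [[h1 h2] h3]].
rewrite (_ : first_argmin _ _ _ = t)//; apply/first_argmin_eq => //.
by split => // j jt; apply/negP; exact: h2.
Qed.

End Argmin.

(** * The outer loop *)

Section Outer.
Context (R : realType) (d : nat) (d0 : (0 < d)%N) (alpha L : R).
Context (alpha0 : 0 < alpha) (aL : alpha <= L).
Context (f : 'rV[R]_d -> R) (xs : 'rV[R]_d) (nc : nearly_convex alpha L f xs).
Context (dZ : measure_display) (Z : measurableType dZ) (Q : probability Z R).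
Context (SG : 'rV[R]_d -> Z -> 'rV[R]_d) (r : R).
Context (mSG : measurable_oracle SG) (meanSG : unbiased_oracle Q SG f).
Context (varSG : oracle_variance_le Q SG f r).
Context dO (O : measurableType dO) (P : probability O R).
Context (z : nat -> O -> Z) (xi : nat -> O -> 'rV[R]_d).

Local Notation V := (borel_rV R d).
Local Notation eta := (gnd_eta alpha L).
Local Notation lambda := (gnd_lambda alpha L).
Local Notation s := (gnd_s alpha L).
Local Notation q := (gnd_q alpha L).
Local Notation y := (descent alpha L f).
Local Notation sF k := (g_sigma_algebraType (past z xi k)).
Local Notation level := (level alpha L r).
Local Notation far := (far alpha L f xs SG r z xi).
Local Notation run := (run alpha L f SG z xi).
Local Notation gap := (fine (convexity_gap f xs alpha)).
Local Notation ell := ((1 - eta * L) ^+ 2).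

Section Stage.
Context (k0 : nat) (Fl : O -> R) (X0 : O -> 'rV[R]_d).

Definition stage_output (T : nat) (w : O) : 'rV[R]_d :=
  gnd f SG eta s (z ^~ w) (xi ^~ w) (Fl w) k0 (X0 w) T.

Lemma stage_output_min T w u : (u <= T)%N ->
  f (stage_output T w) <= f (run k0 Fl X0 u w).
Proof. exact: (@first_argminP R d f (run k0 Fl X0 ^~ w)). Qed.

Lemma measurable_stage_output T :
  measurable_fun setT (Fl : sF k0 -> R) -> measurable_fun setT (X0 : sF k0 -> V) ->
  measurable_fun setT (stage_output T : sF (k0 + T) -> V).
Proof.
move=> mFl mX0.
apply: (@measurable_first_argmin R d f _ (sF (k0 + T)) (run k0 Fl X0)).
  move=> t tT; have mr := @measurable_run _ _ _ _ _ _ nc _ _ _ mSG _ _ _ _ _ _ _ mFl mX0 t.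
  by apply: measurable_past mr; rewrite leq_add2l.
exact: (measurable_C1 (nearly_convex_C1 nc)).
Qed.

Lemma ell_gt0 : 0 < ell.
Proof. by have [? ?] := gnd_etaL alpha0 aL; rewrite exprn_gt0//; lra. Qed.

(** A run that is not far at all times has visited a point within the noise
    level; the best iterate has at most the value of that point. *)
Lemma stage_output_le Bmin Mx T w : Fl w <= f xs -> sqn (y (X0 w) - xs) <= Mx ->
  ~ far k0 Fl X0 Bmin Mx T w ->
  f (stage_output T w) - f xs <= 100 * L * Num.max (level (f xs - Fl w)) Bmin / ell.
Proof.
move=> Flw Mw; apply: contra_notP => /negP; rewrite -ltNge => big.
split => // u uT; rewrite ltNge; apply/negP => near; move: big; apply/negP; rewrite -leNgt.
have L0 : 0 < L by exact: lt_le_trans aL.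
rewrite ler_pdivlMr ?ell_gt0//.
have h1 := stage_output_min w uT.
have h2 := nearly_convex_upper alpha0 aL nc (run k0 Fl X0 u w).
have h3 := descent_lower alpha0 aL nc (run k0 Fl X0 u w).
have h4 := ell_gt0.
have h5 : f (stage_output T w) - f xs <= L / 2 * sqn (run k0 Fl X0 u w - xs).
  by apply: le_trans h2; rewrite lerD2r.
have h6 := ler_wpM2r (ltW h4) h5; apply: (le_trans h6).
rewrite -(mulrA (L / 2)) (mulrC (sqn _) ell).
have h7 : L / 2 * (ell * sqn (run k0 Fl X0 u w - xs)) <=
   L / 2 * (200 * Num.max (level (f xs - Fl w)) Bmin).
  by rewrite ler_wpM2l//; [rewrite divr_ge0// ltW|exact: le_trans near].
by apply: (le_trans h7); rewrite le_eqVlt; apply/orP; left; apply/eqP; field.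
Qed.

End Stage.

Context (flb0 eps gamma : R) (x0 : 'rV[R]_d) (T1 T2 : nat).
Context (flb0_lt : flb0 < f xs) (eps0 : 0 < eps).

Local Notation b0 := (level (f xs - flb0)).
Local Notation beps := (level eps).
Local Notation F := (100 * L * beps / ell).

Lemma level_pos D : 0 < D -> 0 < level D.
Proof.
have L0 : 0 < L by exact: lt_le_trans aL.
have e0 := gnd_eta_gt0 alpha0 aL.
have l0 : 0 < lambda by rewrite gnd_lambdaE// mulr_gt0.
move=> D0; rewrite /level ltr_wpDl//.
  by rewrite divr_ge0 ?(ltW l0)// mulr_ge0 ?(ltW e0)// sqr_ge0.
rewrite mulr_gt0// divr_gt0 ?mulr_gt0//.
by have := mulr_gt0 e0 l0; lra.
Qed.

Lemma level_mono D D' : D <= D' -> level D <= level D'.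
Proof.
have L0 : 0 < L by exact: lt_le_trans aL.
have e0 := gnd_eta_gt0 alpha0 aL.
have l0 : 0 < lambda by rewrite gnd_lambdaE// mulr_gt0.
move=> D0; rewrite /level lerD2l ler_wpM2l// divr_ge0 ?mulr_ge0 ?(ltW L0)//.
by have := mulr_gt0 e0 l0; lra.
Qed.

(** The level is affine with a nonnegative constant term, so that it grows at
    most proportionally beyond [eps]. *)
Lemma level_le_proportional D : eps <= D -> level D <= beps * (D / eps).
Proof.
have e0 := gnd_eta_gt0 alpha0 aL.
have l0 : 0 < lambda by rewrite gnd_lambdaE// mulr_gt0.
move=> epsD; rewrite /level; set A := _ / lambda; set B := (_ / (42 * L)).
have A0 : 0 <= A.
  by rewrite divr_ge0 ?(ltW l0)// mulr_ge0 ?(ltW e0)// sqr_ge0.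
rewrite mulrDl lerD//; last first.
  by rewrite -mulrA (mulrCA eps) divff ?gt_eqF// mulr1.
rewrite ler_peMr//.
by rewrite ler_pdivlMr// mul1r.
Qed.

Definition state nu w := dlgnd_state f SG eta s (z ^~ w) (xi ^~ w) x0 flb0 gamma T1 T2 nu.

(** Stage [nu] is the [nu]-th call of the inner algorithm; it starts at the
    global iteration [start nu] from the point [entry nu] and is run with the
    lower bound [bound nu] for [duration nu] iterations. *)
Definition bound nu w := (state nu w).1.
Definition entry nu w := if nu is nu'.+1 then (state nu' w).2 else x0.
Definition start nu := if nu is nu'.+1 then (T1 + nu' * T2)%N else 0%N.
Definition duration nu := if nu is _.+1 then T2 else T1.

Lemma start_duration nu : (start nu + duration nu)%N = start nu.+1.
Proof. by case: nu => [|nu] /=; [rewrite add0n mul0n addn0|rewrite mulSn -addnA (addnC T2)]. Qed.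

Lemma entryS nu w : entry nu.+1 w = stage_output (start nu) (bound nu) (entry nu) (duration nu) w.
Proof.
case: nu => [//|nu]; rewrite /stage_output /entry /bound /state /=.
by case: (dlgnd_state _ _ _ _ _ _ _ _ _ _ _ nu).
Qed.

Lemma boundS nu w : bound nu.+1 w = (1 - gamma) * bound nu w + gamma * f (entry nu.+1 w).
Proof. by rewrite /entry /bound /state /=; case: (dlgnd_state _ _ _ _ _ _ _ _ _ _ _ nu). Qed.

Lemma measurable_stage nu :
  measurable_fun setT (bound nu : sF (start nu) -> R) /\
  measurable_fun setT (entry nu : sF (start nu) -> V).
Proof.
elim: nu => [|nu [mb me]]; first by split; exact: measurable_cst.
have mx : measurable_fun setT (entry nu.+1 : sF (start nu.+1) -> V).
  rewrite (_ : entry nu.+1 = stage_output (start nu) (bound nu) (entry nu) (duration nu)).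
    by rewrite -start_duration; exact: measurable_stage_output.
  by apply/funext => w; rewrite entryS.
split => //; rewrite (_ : bound nu.+1 = fun w => (1 - gamma) * bound nu w + gamma * f (entry nu.+1 w)).
  apply: measurable_funD; apply: measurable_funM.
  - exact: measurable_cst.
  - by apply: measurable_past mb; rewrite -start_duration leq_addr.
  - exact: measurable_cst.
  - exact: (measurable_value nc mx).
by apply/funext => w; rewrite boundS.
Qed.

(** Later stages aim at the level of [eps] at least: below it the final accuracy
    is reached. Their entry point is controlled by the level [b0] of the initial
    gap, which bounds all levels met before that. *)
Definition floor_level nu := if nu is _.+1 then beps else b0.
Definition entry_radius nu :=
  if nu is _.+1 then (1 + eta * L) ^+ 2 * (2 / (alpha - gap) * (100 * L * b0 / ell))
  else sqn (y x0 - xs).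

Definition bad nu := far (start nu) (bound nu) (entry nu) (floor_level nu)
  (entry_radius nu) (duration nu).

Lemma sqdist_of_value x v : f x - f xs <= v -> sqn (x - xs) <= 2 / (alpha - gap) * v.
Proof.
have [g0 g1] := gap_bounds d0 alpha0 aL nc; have ag : 0 < alpha - gap by move: g1 alpha0; lra.
move=> xv; have := nearly_convex_lower d0 nc x => /le_trans /(_ xv) h.
rewrite mulrAC ler_pdivlMr//; move: h; set S := sqn _; lra.
Qed.

Context (gammaE : gamma = eps / (eps + F)).

Lemma accuracy_gt0 : 0 < F.
Proof.
have L0 : 0 < L by exact: lt_le_trans aL.
by rewrite divr_gt0 ?ell_gt0// mulr_gt0 ?level_pos// mulr_gt0.
Qed.

Lemma gamma_bounds : [/\ 0 < gamma, gamma < 1 & gamma * F = (1 - gamma) * eps].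
Proof.
have F0 := accuracy_gt0; have eF : 0 < eps + F by rewrite addr_gt0.
split; rewrite gammaE; first exact: divr_gt0.
  by rewrite ltr_pdivrMr// mul1r ltrDl.
by move: F0 eF; set G := F => F0 eF; field; rewrite gt_eqF.
Qed.

(** Outside the bad events each stage either has already reached the final
    accuracy [F], or the gap between the minimum and the lower bound, shifted
    by [F], has contracted by [1 - gamma]. *)
Lemma stage_invariant w nu : (forall i, (i <= nu)%N -> ~ bad i w) ->
  let v := f (entry nu.+1 w) - f xs in let Delta := f xs - bound nu w in
  v <= F \/ [/\ eps < Delta, Delta <= f xs - flb0,
    Delta + F <= (1 - gamma) ^+ nu * (f xs - flb0 + F) &
    v <= 100 * L * level Delta / ell].
Proof.
have L0 : 0 < L by exact: lt_le_trans aL.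
have l0 := ell_gt0; have F0 := accuracy_gt0; have [g0 g1 gF] := gamma_bounds.
have scale D D' : D <= D' -> 100 * L * D / ell <= 100 * L * D' / ell.
  by move=> DD; rewrite ler_wpM2r ?invr_ge0 ?(ltW l0)// ler_wpM2l// mulr_ge0// ltW.
elim: nu => [|nu IH] good /=.
  have := good 0%N (leqnn _); have e1 := entryS 0 w; rewrite /= in e1.
  move=> /stage_output_le h; have {h} := h (ltW flb0_lt) (lexx _).
  rewrite /floor_level maxxx -e1 => h.
  have [De|De] := leP (f xs - flb0) eps.
    by left; apply: (le_trans h); apply: scale; exact: level_mono.
  by right; split => //; rewrite expr0 mul1r.
have {}IH := IH (fun i iN => good i (leqW iN)).
have dec : f (entry nu.+2 w) <= f (entry nu.+1 w).
  by rewrite (entryS nu.+1); exact: (stage_output_min _ _ _ _ (leq0n T2)).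
set v := f (entry nu.+1 w) - f xs in IH; set D := f xs - bound nu w in IH.
have vv : f (entry nu.+2 w) - f xs <= v by rewrite lerD2r.
(* Above the accuracy [F], the new bound stays below the minimum by the choice
   of [gamma], as the level is at most proportional to the gap. *)
have [vF|Fv] := leP v F; first by left; exact: le_trans vF.
case: IH => [/(lt_le_trans Fv)|[eD DD0 DF vD]]; first by rewrite ltxx.
set D' := f xs - bound nu.+1 w.
have D'E : D' = (1 - gamma) * D - gamma * v by rewrite /D' boundS /D /v; ring.
have vFD : v <= F * (D / eps).
  apply: (le_trans vD); apply: (le_trans (scale _ _ (level_le_proportional (ltW eD)))).
  by rewrite le_eqVlt; apply/orP; left; apply/eqP; ring.
have gv : gamma * v <= (1 - gamma) * D.
  apply: (le_trans (ler_wpM2l (ltW g0) vFD)).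
  by rewrite (mulrA gamma F) gF -mulrA (mulrCA eps) divff ?gt_eqF// mulr1.
have D'0 : 0 <= D' by rewrite D'E subr_ge0.
have gFv : gamma * F < gamma * v by rewrite ltr_pM2l.
have D'D : D' <= D.
  have gD : 0 < gamma * D by rewrite mulr_gt0// (lt_trans eps0).
  have gF0 : 0 < gamma * F by exact: mulr_gt0.
  by rewrite D'E; move: gFv gD gF0; set a := gamma * v; set b := gamma * F; lra.
have Mw : sqn (y (entry nu.+1 w) - xs) <= entry_radius nu.+1.
  apply: (le_trans (descent_upper alpha0 aL nc _)).
  rewrite /entry_radius ler_wpM2l ?sqr_ge0//; apply: sqdist_of_value.
  by apply: (le_trans vD); apply: scale; exact: level_mono.
have := good nu.+1 (leqnn _) => /stage_output_le h.
have {h} := h; rewrite -/(bound nu.+1 w) => h.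
have {h} := h ltac:(by rewrite -subr_ge0) Mw.
rewrite -entryS -/D' => h.
have [De|De] := leP D' eps.
  left; apply: (le_trans h); apply: scale; rewrite ge_max lexx andbT; exact: level_mono.
right; split => //.
- exact: le_trans DD0.
- rewrite (exprS _ nu) -(mulrA (1 - gamma)); apply: le_trans (ler_wpM2l _ DF); last by rewrite subr_ge0 ltW.
  by rewrite D'E; move: gFv; set b := gamma * v; rewrite mulrDr mulrBl mul1r; lra.
- apply: (le_trans h); apply: scale; rewrite ge_max lexx/=; exact/level_mono/ltW.
Qed.

(** Were the accuracy not reached, the shifted gap would exceed [eps + F] after
    [N] contractions by [1 - gamma <= expR (- gamma)]. *)
Lemma outer_accuracy w N :
  gamma^-1 * ln ((1 - gamma) + gamma * ((f xs - flb0) / eps)) <= N%:R ->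
  (forall i, (i <= N)%N -> ~ bad i w) -> f (entry N.+1 w) - f xs <= F.
Proof.
move=> hN /stage_invariant /= [//|[eD _ DF _]]; exfalso.
have F0 := accuracy_gt0; have [g0 g1 gF] := gamma_bounds.
set D0 := f xs - flb0 in hN DF.
have D00 : 0 < D0 by rewrite subr_gt0.
set E := (1 - gamma) + _ in hN.
have E0 : 0 < E.
  by rewrite addr_gt0 ?subr_gt0// mulr_gt0// divr_gt0.
have EE : D0 + F = (eps + F) * E.
  have eF : eps + F = eps / gamma.
    by rewrite gammaE invf_div mulrCA divff ?gt_eqF// mulr1.
  apply: (@mulfI _ gamma); first by rewrite gt_eqF.
  rewrite mulrDr gF eF /E; field; rewrite !gt_eqF//.
have h1 : E <= expR (gamma * N%:R).
  rewrite -[leLHS]lnK ?posrE// ler_expR mulrC -ler_pdivrMr//.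
  by rewrite mulrC.
have h2 : (1 - gamma) ^+ N <= expR (- (gamma * N%:R)).
  have g1' : 0 <= 1 - gamma by rewrite subr_ge0 ltW.
  rewrite -mulNr mulrC expRM_natl lerXn2r ?nnegrE ?expR_ge0//.
  exact: expR_ge1Dx.
have h3 : (1 - gamma) ^+ N * E <= 1.
  apply: (@le_trans _ _ (expR (- (gamma * N%:R)) * expR (gamma * N%:R))).
    apply: ler_pM => //; [|exact: ltW].
    by rewrite exprn_ge0// subr_ge0 ltW.
  by rewrite -expRD addNr expR0.
have : eps + F < (1 - gamma) ^+ N * (D0 + F).
  by apply: lt_le_trans DF; rewrite ltrD2r.
rewrite EE mulrCA; apply/negP; rewrite -leNgt.
by rewrite -[leRHS]mulr1 ler_wpM2l// ltW// addr_gt0.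
Qed.

End Outer.

(** * The failure probability *)

Section Union.
Context (R : realType) d (O : measurableType d) (P : probability O R).

Lemma probability_avoid (A : nat -> set O) (B : set O) n (c : R) :
  (forall i, (i < n)%N -> measurable (A i)) -> measurable B ->
  (forall i, (i < n)%N -> (P (A i) <= c%:E)%E) ->
  (forall w, (forall i, (i < n)%N -> ~ A i w) -> B w) ->
  ((1 - n%:R * c)%:E <= P B)%E.
Proof.
move=> mA mB PA AB; pose U := \big[setU/set0]_(i < n) A i.
have mU : measurable U by apply: bigsetU_measurable => i _; exact: mA.
have PU : (P U <= (n%:R * c)%:E)%E.
  apply: (le_trans (Boole_inequality P mA)).
  apply: (@le_trans _ _ (\sum_(i < n) c%:E)%E); first by apply: lee_sum => i _; exact: PA.
  by rewrite sumEFin sumr_const card_ord mulr_natl.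
apply: (@le_trans _ _ (P (~` U))).
  by rewrite probability_setC// EFinB leeB.
apply: le_measure; rewrite ?inE//; first exact: measurableC.
move=> w Uw; apply: AB => i i_n Aw; apply: Uw.
by rewrite /U -bigcup_mkord; exists i.
Qed.

End Union.

Section Final.
Context (R : realType) (d : nat) (d0 : (0 < d)%N) (alpha L : R).
Context (alpha0 : 0 < alpha) (aL : alpha <= L).
Context (f : 'rV[R]_d -> R) (xs : 'rV[R]_d) (nc : nearly_convex alpha L f xs).
Context (dZ : measure_display) (Z : measurableType dZ) (Q : probability Z R).
Context (SG : 'rV[R]_d -> Z -> 'rV[R]_d) (r : R).
Context (mSG : measurable_oracle SG) (meanSG : unbiased_oracle Q SG f).
Context (varSG : oracle_variance_le Q SG f r).
Context dO (O : measurableType dO) (P : probability O R).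
Context (z : nat -> O -> Z) (xi : nat -> O -> 'rV[R]_d).

Local Notation V := (borel_rV R d).
Local Notation eta := (gnd_eta alpha L).
Local Notation q := (gnd_q alpha L).
Local Notation y := (descent alpha L f).
Local Notation level := (level alpha L r).
Local Notation gap := (fine (convexity_gap f xs alpha)).
Local Notation ell := ((1 - eta * L) ^+ 2).

Context (flb0 eps gamma : R) (x0 : 'rV[R]_d) (N T1 T2 : nat).
Context (flb0_lt : flb0 < f xs) (eps0 : 0 < eps).
Context (fresh : fresh_randomness P Q z xi (T1 + N * T2)).
Local Notation b0 := (level (f xs - flb0)).
Local Notation beps := (level eps).
Local Notation F := (100 * L * beps / ell).
Local Notation bad := (bad alpha L f xs SG r z xi flb0 eps gamma x0 T1 T2).
Local Notation start := (start T1 T2).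
Local Notation duration := (duration T1 T2).

Lemma stage_end_leq i : (i < N.+1)%N -> (start i + duration i <= T1 + N * T2)%N.
Proof. by move=> iN; rewrite start_duration /= leq_add2l leq_mul2r orbC -ltnS iN. Qed.

Lemma bad_measurable i : (i < N.+1)%N -> measurable (bad i).
Proof.
move=> /stage_end_leq kN; have [mb me] := @measurable_stage _ _ _ _ _ _ nc _ _ _ mSG _ _ z xi flb0 gamma x0 T1 T2 i.
exact: (measurable_far nc r mSG fresh mb me).
Qed.

(** The two iteration counts are those for which the Markov bounds of the first
    stage and of the later stages are at most [c]. *)
Lemma bad_prob (c : R) i : 0 < c ->
  200 / q * ln (sqn (y x0 - xs) / (100 * b0 * c)) <= T1%:R ->
  200 / q * ln (2 * (1 + eta * L) ^+ 2 * L * b0 / (ell * (alpha - gap) * beps * c))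
    <= T2%:R ->
  (i < N.+1)%N -> (P (bad i) <= c%:E)%E.
Proof.
move=> c0 hT1 hT2 /stage_end_leq kN.
have [mb me] := @measurable_stage _ _ _ _ _ _ nc _ _ _ mSG _ _ z xi flb0 gamma x0 T1 T2 i.
have L0 : 0 < L by exact: lt_le_trans aL.
have l0 := ell_gt0 alpha0 aL.
have B0 : 0 < b0 by rewrite level_pos// subr_gt0.
have Be : 0 < beps by rewrite level_pos.
have [g0 g1] := gap_bounds d0 alpha0 aL nc.
have ag : 0 < alpha - gap by move: g1 alpha0; lra.
have fl0 : 0 < floor_level alpha L f xs r flb0 eps i by case: (i).
have er0 : 0 <= entry_radius alpha L f xs r flb0 x0 i.
  case: (i) => [|j] /=; first exact: sqn_ge0.
  rewrite mulr_ge0 ?sqr_ge0// mulr_ge0 ?divr_ge0 ?(ltW ag)// ?(ltW l0)//.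
  by rewrite !mulr_ge0// ltW.
pose A := if i is _.+1 then
  2 * (1 + eta * L) ^+ 2 * L * b0 / (ell * (alpha - gap) * beps)
  else sqn (y x0 - xs) / (100 * b0).
apply: (far_prob d0 alpha0 aL nc mSG meanSG varSG fresh mb me fl0 er0 (A := A) kN c0).
- rewrite {}/A; case: (i) er0 => [|j] er0 /=.
    rewrite ler_wpM2l ?sqn_ge0// lef_pV2 ?posrE ?mulr_gt0// ler_wpM2r ?(ltW B0)//.
    by rewrite ler_nat.
  rewrite /entry_radius /floor_level in er0 *.
  have num0 : 0 <= 2 * (1 + eta * L) ^+ 2 * L * b0 / (ell * (alpha - gap) * beps).
    apply: divr_ge0; last by apply/ltW/mulr_gt0 => //; exact: mulr_gt0.
    by do 2 (apply: mulr_ge0; last exact: ltW); rewrite mulr_ge0 ?sqr_ge0.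
  apply: le_trans (_ : 2 * (1 + eta * L) ^+ 2 * L * b0 / (ell * (alpha - gap) * beps) / 2 <= _); last by lra.
  rewrite le_eqVlt; apply/orP; left; apply/eqP.
  move: l0 ag Be; set e := ell; set a := alpha - gap; set b := beps => l0 ag Be.
  by field; rewrite !gt_eqF.
- have divM (a b : R) : a / b / c = a / (b * c) by rewrite -mulrA -invfM.
  by rewrite {}/A; case: (i) => [|j] /=; rewrite divM.
Qed.

End Final.

Theorem theorem4p2 (R : realType) (d : nat) (hd : (0 < d)%N)
    (alpha L : R) (halpha : 0 < alpha) (hL : alpha <= L)
    (f : 'rV[R]_d -> R) (xstar : 'rV[R]_d)
    (hf : nearly_convex alpha L f xstar)
    (dZ : measure_display) (Z : measurableType dZ) (Q : probability Z R)
    (SG : 'rV[R]_d -> Z -> 'rV[R]_d) (r : R) (hr : 0 <= r)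
    (hSGmeas : measurable_oracle SG)
    (hSGmean : unbiased_oracle Q SG f)
    (hSGvar : oracle_variance_le Q SG f r)
    (dO : measure_display) (Omega : measurableType dO)
    (P : probability Omega R)
    (z : nat -> Omega -> Z) (xi : nat -> Omega -> 'rV[R]_d)
    (flb0 : R) (hflb : flb0 < f xstar) (x0 : 'rV[R]_d)
    (eps zeta : R) (heps : 0 < eps) (hzeta0 : 0 < zeta) (hzeta1 : zeta < 1)
    (N T1 T2 : nat) (hN : (0 < N)%N) (hT1 : (0 < T1)%N) (hT2 : (0 < T2)%N) :
  let fstar : R := f xstar in
  let eta : R := 2 * alpha / (5 * L ^+ 2) in
  let lambda : R := 2 * alpha - eta * L ^+ 2 in
  let s : R := lambda / (3 * L) in
  let y0 : 'rV[R]_d := x0 - eta *: grad f x0 in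
  let beta : R := fine (convexity_gap f xstar alpha) in
  let b0 : R := eta * r ^+ 2 / lambda
            + (5 * eta * lambda + 14) / (42 * L) * (fstar - flb0) in
  let beps : R := eta * r ^+ 2 / lambda
              + (5 * eta * lambda + 14) / (42 * L) * eps in
  let gamma : R := (1 - eta * L) ^+ 2 * eps
               / ((1 - eta * L) ^+ 2 * eps + 100 * L * beps) in
  let zeta' : R := zeta / N.+1%:R in
  let xout := fun w : Omega =>
    dlgnd f SG eta s (z ^~ w) (xi ^~ w) x0 flb0 gamma N T1 T2 in
  let good := [set w : Omega |
    f (xout w) - fstar <= 100 * L * beps / (1 - eta * L) ^+ 2
    /\ enorm (xout w - xstar) ^+ 2 <=
         200 * L * beps / ((1 - eta * L) ^+ 2 * (alpha - beta))] in
  fresh_randomness P Q z xi (T1 + N * T2) ->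
  gamma^-1 * ln ((1 - gamma) + gamma * ((fstar - flb0) / eps)) <= N%:R ->
  200 / (eta * lambda)
    * ln (enorm (y0 - xstar) ^+ 2 / (100 * b0 * zeta')) <= T1%:R ->
  200 / (eta * lambda)
    * ln (2 * (1 + eta * L) ^+ 2 * L * b0
          / ((1 - eta * L) ^+ 2 * (alpha - beta) * beps * zeta')) <= T2%:R ->
  ((1 - zeta)%:E <= P good)%E.
Proof.
move=> fstar eta lambda s y0 beta b0 beps gamma zeta' xout good fresh hNg hT1g hT2g.
have L0 : 0 < L by exact: lt_le_trans hL.
have l0 : 0 < (1 - eta * L) ^+ 2 := ell_gt0 halpha hL.
have be0 : 0 < beps := level_pos halpha hL r heps.
have zeta'0 : 0 < zeta' by rewrite divr_gt0.
have [g0 g1] := gap_bounds hd halpha hL hf.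
have ag : 0 < alpha - beta by rewrite /beta; move: g1 halpha; lra.
have gammaE : gamma = eps / (eps + 100 * L * beps / (1 - eta * L) ^+ 2).
  rewrite /gamma; move: l0; set e := (1 - eta * L) ^+ 2 => l0.
  have -> : eps + 100 * L * beps / e = (e * eps + 100 * L * beps) / e.
    by rewrite (mulrDl _ _ e^-1) (mulrC e) mulfK ?gt_eqF.
  by rewrite invf_div mulrCA mulrA.
rewrite (_ : 1 - zeta = 1 - N.+1%:R * zeta'); last first.
  by rewrite /zeta' mulrCA divff ?mulr1// pnatr_eq0.
pose bad := bad alpha L f xstar SG r z xi flb0 eps gamma x0 T1 T2.
have xoutE : xout = entry alpha L f SG z xi flb0 gamma x0 T1 T2 N.+1 by [].
have mx : measurable_fun setT (xout : Omega -> borel_rV R d).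
  have [_ mx] := @measurable_stage _ _ _ _ _ _ hf _ _ _ hSGmeas _ _ z xi flb0 gamma x0 T1 T2 N.+1.
  exact: (measurable_sub_sigma (past_measurable fresh (leqnn _)) mx).
apply: (@probability_avoid _ _ _ P bad).
- by move=> i iN; exact: (bad_measurable hf r hSGmeas flb0 eps gamma x0 fresh iN).
- rewrite (_ : good = [set w | f (xout w) <= fstar + 100 * L * beps / (1 - eta * L) ^+ 2] `&`
    [set w | sqn (xout w - xstar) <=
         200 * L * beps / ((1 - eta * L) ^+ 2 * (alpha - beta))]).
    apply: measurableI; rewrite -[X in measurable X]setTI;
      apply: measurable_fun_le => //.
      exact: (measurable_value hf mx).
    by apply: measurable_sqn; apply: measurable_rVB => //; exact: measurable_cst.
  by apply/seteqP; split => w; rewrite /good/= sqr_enorm lerBlDl.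
- move=> i iN; apply: (@bad_prob _ _ hd _ _ halpha hL _ _ hf _ _ _ _ _ hSGmeas hSGmean
     hSGvar _ _ _ _ _ _ _ _ _ N) => //.
  by move: hT1g; rewrite sqr_enorm.
- move=> w avoid.
  have acc := @outer_accuracy _ _ hd _ _ halpha hL _ _ hf _ _ SG r _ _ z xi _ _ _
     x0 T1 T2 hflb heps gammaE w N hNg avoid.
  split; first exact: acc.
  have dist : sqn (xout w - xstar) <=
      2 / (alpha - beta) * (100 * L * beps / (1 - eta * L) ^+ 2).
    exact: (sqdist_of_value hd halpha hL hf acc).
  rewrite sqr_enorm; apply: (le_trans dist); rewrite le_eqVlt; apply/orP; left.
  move: l0 ag; set e := (1 - _) ^+ 2; set a := alpha - beta => l0 ag.
  by apply/eqP; field; rewrite !gt_eqF.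
Qed.
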